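(* Let $R$ be a ring, let $\mathcal{M}$ be one of the following three classes of homomorphisms of left $R$-modules: all embeddings, all $RD$-embeddings, all pure embeddings, and let $K$ be a class of left $R$-modules, containing a nonzero module, closed under direct sums, $\mathcal{M}$-submodules and $\mathcal{M}$-epimorphic images. The following are equivalent. \begin{enumerate} \item $(K, \mathcal{M})$ is noetherian. \item The abstract elementary class $\mathcal{K}_\mathcal{M} = (K, \leq_\mathcal{M})$ is superstable. \end{enumerate}
   Context: Rings are associative with unity; modules are left $R$-modules; $\|A\|$ is the cardinality of $A$. Pure embeddings and pure epimorphisms are meant in the usual sense. A short exact sequence $0 \to A \xrightarrow{f} B \xrightarrow{g} C \to 0$ is $RD$-exact if $f[A] \cap rB = r f[A]$ for every $r \in R$; then $f$ is an $RD$-embedding and $g$ an $RD$-epimorphism. An $\mathcal{M}$-embedding is a member of $\mathcal{M}$; an $\mathcal{M}$-epimorphism is the map $g$ in a short exact sequence $0 \to A \xrightarrow{f} B \xrightarrow{g} C \to 0$ with $f \in \mathcal{M}$ (for $\mathcal{M}$ the class of all embeddings, any surjective homomorphism). $A \leq_\mathcal{M} B$ means that $A$ is a submodule of $B$ and the inclusion is in $\mathcal{M}$. Closure of $K$ under $\mathcal{M}$-submodules: $A \in K$, $B \leq_\mathcal{M} A$ imply $B \in K$; under $\mathcal{M}$-epimorphic images: if $f : A \to B$ is an $\mathcal{M}$-epimorphism and $A \in K$ then $B \in K$. A module $E \in K$ is $\mathcal{K}_\mathcal{M}$-injective if for every $\mathcal{M}$-embedding $f: A \to B$ with $A, B \in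 K$ and every homomorphism $g: A \to E$ there is a homomorphism $h: B \to E$ with $h \circ f = g$. $(K, \mathcal{M})$ is noetherian if every direct sum of $\mathcal{K}_\mathcal{M}$-injective modules is $\mathcal{K}_\mathcal{M}$-injective. $\mathcal{K}_\mathcal{M} = (K, \leq_\mathcal{M})$ is an abstract elementary class with L\''owenheim-Skolem number $\operatorname{LS}(\mathcal{K}_\mathcal{M}) = \operatorname{card}(R) + \aleph_0$. For $N \leq_\mathcal{M} M$ in $K$ with $\|N\| = \|M\| = \lambda$, $M$ is universal over $N$ if for every $N^* \in K$ with $N \leq_\mathcal{M} N^*$ and $\|N^*\| \leq \lambda$ there is an $\mathcal{M}$-embedding $N^* \to M$ which is the identity on $N$. For an infinite cardinal $\lambda$ and a limit ordinal $\alpha < \lambda^+$, $M$ is a $(\lambda,\alpha)$-limit model if $M = \bigcup_{i<\alpha} M_i$ for some $\leq_\mathcal{M}$-increasing continuous chain $\{M_i : i < \alpha\}$ of members of $K$ of cardinality $\lambda$ such that $M_{i+1}$ is universal over $M_i$ for each $i < \alpha$. $M$ is a $\lambda$-limit model if it is a $(\lambda,\alpha)$-limit model for some limit $\alpha < \lambda^+$. $\mathcal{K}_\mathcal{M}$ is superstable if there is a cardinal $\mu \geq \operatorname{LS}(\mathcal{K}_\mathcal{M})$ such that for every $\lambda \geq \mu$ there is a $\lambda$-limit model and it is unique up to isomorphism. *)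

(* Defs.v *)
From HB Require Import structures.
From mathcomp Require Import all_boot all_order all_algebra.
From mathcomp Require Import all_classical.
From mathcomp Require Import wochoice.

Set Implicit Arguments.
Unset Strict Implicit.
Unset Printing Implicit Defensive.

Import GRing.Theory.

Local Open Scope classical_set_scope.
Local Open Scope card_scope.
Local Open Scope ring_scope.

(* The universe of the carriers of modules.  Index sets of direct sums,
   cardinals and ordinals must range over exactly this universe: cardinals from
   a larger one would not be cardinalities of modules. *)
Definition small := Type@{GRing.Lmodule.axioms_.u0}.

Section DirectProduct.
Variables (R : pzRingType) (I : small) (F : I -> lmodType R).

Definition dprod := forall i, F i.

HB.instance Definition _ := gen_eqMixin dprod.
HB.instance Definition _ := gen_choiceMixin dprod.

Definition dprod_add (u v : dprod) : dprod := fun i => u i + v i.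
Definition dprod_opp (u : dprod) : dprod := fun i => - u i.
Definition dprod_scale (r : R) (u : dprod) : dprod := fun i => r *: u i.

Fact dprod_addA : associative dprod_add.
Proof. by move=> u v w; apply: functional_extensionality_dep => i; apply: addrA. Qed.
Fact dprod_addC : commutative dprod_add.
Proof. by move=> u v; apply: functional_extensionality_dep => i; apply: addrC. Qed.
Fact dprod_add0 : left_id (fun i => 0 : F i) dprod_add.
Proof. by move=> u; apply: functional_extensionality_dep => i; apply: add0r. Qed.
Fact dprod_addN : left_inverse (fun i => 0 : F i) dprod_opp dprod_add.
Proof. by move=> u; apply: functional_extensionality_dep => i; apply: addNr. Qed.

HB.instance Definition _ :=
  GRing.isZmodule.Build dprod dprod_addA dprod_addC dprod_add0 dprod_addN.

Fact dprod_scaleA a b u : dprod_scale a (dprod_scale b u) = dprod_scale (a * b) u.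
Proof. by apply: functional_extensionality_dep => i; apply: scalerA. Qed.
Fact dprod_scale1 : left_id 1 dprod_scale.
Proof. by move=> u; apply: functional_extensionality_dep => i; apply: scale1r. Qed.
Fact dprod_scaleDr : right_distributive dprod_scale +%R.
Proof. by move=> a u v; apply: functional_extensionality_dep => i; apply: scalerDr. Qed.
Fact dprod_scaleDl u : {morph dprod_scale^~ u : a b / a + b}.
Proof. by move=> a b; apply: functional_extensionality_dep => i; apply: scalerDl. Qed.

HB.instance Definition _ := GRing.Zmodule_isLmodule.Build R dprod
  dprod_scaleA dprod_scale1 dprod_scaleDr dprod_scaleDl.

Definition finsupp : {pred dprod} :=
  fun u => `[< finite_set [set i | u i != 0] >].

Fact finsupp_submod : submod_closed finsupp.
Proof.
split=> [|a u v /asboolP fu /asboolP fv]; apply/asboolP.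
  by apply: sub_finite_set (finite_set0 _) => i /=; rewrite eqxx.
apply: (@sub_finite_set _ _ ([set i | u i != 0] `|` [set i | v i != 0])).
  move=> i /= uv0; apply/or_asboolP; rewrite !asboolb; apply: contraNT uv0.
  rewrite negb_or !negbK => /andP[/eqP ui0 /eqP vi0].
  by apply/eqP; rewrite -[LHS]/(a *: u i + v i) ui0 vi0 scaler0 addr0.
by rewrite finite_setU.
Qed.

HB.instance Definition _ :=
  GRing.isSubmodClosed.Build R dprod finsupp (GRing.submod_closed_semi finsupp_submod).

Record direct_sum : Type :=
  DirectSum { dsum_val :> dprod; _ : dsum_val \in finsupp }.

HB.instance Definition _ := [isSub for dsum_val].
HB.instance Definition _ := [Choice of direct_sum by <:].
HB.instance Definition _ := [SubChoice_isSubLmodule of direct_sum by <:].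

End DirectProduct.

Section Homomorphisms.
Variable R : pzRingType.

Definition hom_class := forall A B : lmodType R, {linear A -> B} -> Prop.

Definition embedding : hom_class := fun A B f => injective f.

Definition RD_embedding : hom_class := fun A B f =>
  injective f /\
  forall r : R,
    range f `&` range (fun b : B => r *: b) = [set r *: b | b in range f].

(* Purity in the sense of finite systems of linear equations with constants in
   the image of [f]. *)
Definition pure_embedding : hom_class := fun A B f =>
  injective f /\
  forall (m n : nat) (C : 'M[R]_(m, n)) (a : 'I_m -> A),
    (exists b : 'I_n -> B, forall i, \sum_j C i j *: b j = f (a i)) ->
    exists b : 'I_n -> A, forall i, \sum_j C i j *: f (b j) = f (a i).

Definition short_exact (A B C : lmodType R)
    (f : {linear A -> B}) (g : {linear B -> C}) :=
  [/\ injective f, range f = [set b | g b = 0] & range g = setT].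

Definition epi_class (M : hom_class) : hom_class := fun B C g =>
  exists (A : lmodType R) (f : {linear A -> B}), short_exact f g /\ M A B f.

Definition isomorphic (A B : lmodType R) :=
  exists f : {linear A -> B}, bijective f.

End Homomorphisms.

(* "A is an M-submodule of B" is rendered, up to isomorphism, by an M-embedding
   of A into B.  Closure under epi_class M includes closure under isomorphism. *)

Section Classes.
Variables (R : pzRingType) (M : hom_class R) (K : lmodType R -> Prop).

Definition closed_direct_sums :=
  forall (I : small) (F : I -> lmodType R),
    (forall i, K (F i)) -> K (direct_sum F).

Definition closed_submodules :=
  forall (A B : lmodType R) (f : {linear B -> A}), K A -> M f -> K B.

Definition closed_epi_images :=
  forall (A B : lmodType R) (f : {linear A -> B}), K A -> epi_class M f -> K B.

Definition rel_injective (E : lmodType R) :=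
  K E /\
  forall (A B : lmodType R) (f : {linear A -> B}) (g : {linear A -> E}),
    K A -> K B -> M f -> exists h : {linear B -> E}, h \o f =1 g.

Definition noetherian :=
  forall (I : small) (F : I -> lmodType R),
    (forall i, rel_injective (F i)) -> rel_injective (direct_sum F).

Definition universal_over (A B : lmodType R) (f : {linear A -> B}) :=
  [/\ K A, K B, M f, [set: A] #= [set: B] &
    forall (C : lmodType R) (g : {linear A -> C}),
      K C -> M g -> [set: C] #<= [set: B] ->
      exists h : {linear C -> B}, M h /\ h \o g =1 f].

End Classes.

Section Ordinals.
Variables (alpha : small) (le : rel alpha).

(* [le] is the reflexive order: [well_order le] applied to singletons makes it
   reflexive, and applied to pairs, total and antisymmetric. *)
Definition wo_lt i j := i <> j /\ le i j.

Definition wo_succ i j := wo_lt i j /\ forall k, wo_lt i k -> le j k.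

Definition wo_limit j :=
  (exists i, wo_lt i j) /\ forall i, wo_lt i j -> exists2 k, wo_lt i k & wo_lt k j.

Definition limit_ordinal :=
  [/\ well_order le, inhabited alpha & forall i, exists j, wo_lt i j].

End Ordinals.

Section LimitModels.
Variables (R : pzRingType) (M : hom_class R) (K : lmodType R -> Prop).

(* The chain consists of the submodules [range (e i)] of [X], each presented as
   the injective image of a module [N i]; the inclusion of the [i]-th one in the
   [j]-th one is then the map [f] such that [e j \o f =1 e i]. *)
Definition limit_chain (lambda alpha : small) (le : rel alpha)
    (X : lmodType R) (N : alpha -> lmodType R)
    (e : forall i, {linear N i -> X}) : Prop :=
  [/\ forall i, [/\ K (N i), [set: N i] #= [set: lambda] & injective (e i)],
      forall i j, le i j ->
        exists f : {linear N i -> N j}, M f /\ e j \o f =1 e i,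
      forall j, wo_limit le j ->
        range (e j) = \bigcup_(i in [set i | wo_lt le i j]) range (e i),
      forall i j, wo_succ le i j ->
        exists f : {linear N i -> N j}, universal_over M K f /\ e j \o f =1 e i &
      [set: X] = \bigcup_i range (e i)].

Definition ordinal_limit_model (lambda alpha : small) (le : rel alpha)
    (X : lmodType R) :=
  exists (N : alpha -> lmodType R) (e : forall i, {linear N i -> X}),
    limit_chain lambda le e.

(* A limit ordinal is less than the successor cardinal of [lambda] iff its
   cardinality is at most [lambda]. *)
Definition limit_model (lambda : small) (X : lmodType R) :=
  [set: nat] #<= [set: lambda] /\
  exists (alpha : small) (le : rel alpha),
    [/\ limit_ordinal le, [set: alpha] #<= [set: lambda] &
        ordinal_limit_model lambda le X].

Definition superstable :=
  exists mu : small, [set: R + nat] #<= [set: mu] /\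
  forall lambda : small, [set: mu] #<= [set: lambda] ->
    (exists X, limit_model lambda X) /\
    (forall X Y, limit_model lambda X -> limit_model lambda Y -> isomorphic X Y).

End LimitModels.

(* Main.v *)
Require Import Defs.
From HB Require Import structures.
From mathcomp Require Import all_boot all_order all_algebra.
From mathcomp Require Import all_classical.
From mathcomp Require Import wochoice.

Set Implicit Arguments.
Unset Strict Implicit.
Unset Printing Implicit Defensive.

Import GRing.Theory.

Local Open Scope classical_set_scope.
Local Open Scope card_scope.
Local Open Scope ring_scope.

(** All three classes of monomorphisms have the same shape.  Fix a family of
    finite systems of linear equations over R.  A monomorphism f : A -> B is
    pure for the family when every system of the family with constants in A
    that is solvable in B is solvable in A.  The empty family gives the
    embeddings, the single equations in one unknown the RD-embeddings, all
    systems the pure embeddings.  Everything below holds for an arbitrary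
    family: such maps compose, f is one whenever g o f is, pushouts preserve
    them, and they behave well under directed unions because systems are finite.  Below,
    M is the class of these maps and injective means relatively injective.

    Two tools serve both implications.  First, testing injectivity on a set of
    small extension problems is enough ([baer_criterion]): an element of
    a module and a pure submodule can be joined through a piece bounded by
    a type [Theta] that depends on R only ([lowenheim_skolem]).  Second, a step
    which extends every module of K can be iterated along any well-order
    ([tower]).  If the length has cofinality larger than the small problems,
    each problem posed in the union is already posed at a stage and is solved
    at the next one, so the union is injective ([tower_injective]); this gives
    enough injectives ([enough_injectives]).

    Noetherian implies superstable.  Closing an element of an injective module
    under solutions of the small problems yields an injective submodule bounded
    by a type [Omega] that depends on R only ([in_small_sub]).  It is a direct
    summand, and since sums of injectives are injective, Zorn's lemma makes every
    injective a direct sum of bounded ones ([decomposition]).  Hence, for all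
    large lambda, the sum U0 of lambda copies of each bounded injective is
    injective, has size lambda and receives an M-embedding from every module of
    K of size at most lambda ([injmod_sum_universal]).  If A is injective, then
    A + U0 is universal over A ([universal_over_injective]): an extension C of A
    maps to A by injectivity and to U0 through C / A.  So the sum U of countably
    many copies of U0 is a limit model.  Conversely, in a limit model Y a copy of
    U fits between each member of the chain and the next one, so Y is the union
    of a chain of injectives; splitting off each member from the union of the
    earlier ones writes Y as a direct sum of injectives ([chain_injective]).  Thus
    Y = U + Z with Z a summand of U0, and U absorbs Z ([absorb_summand]).

    Superstable implies noetherian.  The existence of a limit model at lambda
    already provides a universal extension of every module of size lambda
    ([universal_extension]), hence a limit model V of large cofinality, which is
    injective ([injective_limit_model]).  By uniqueness every limit model of size
    lambda is injective.  Given injectives F_i, consider the partial sums of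
    V + (F_0 + V) + (F_1 + V) + ... along a well-order of limit type.  Each
    successor step is universal as soon as the smaller sum is injective; at
    a limit stage the partial sum is then a limit model, hence injective.  So all
    partial sums and the total sum are injective, and the sum of the F_i is
    a retract of the total sum ([superstable_noetherian]). *)

(** * Linear maps, submodules and quotients *)
Section Linear.
Variable R : pzRingType.
Implicit Types A B C : lmodType R.

Fact mklin_ex A B (f : A -> B) : linear f -> exists g : {linear A -> B}, g =1 f.
Proof.
move=> H; pose g : {linear A -> B} := HB.pack f (GRing.isLinear.Build R A B *:%R f H).
by exists g.
Qed.
(** The map is hidden behind a choice so that it never unfolds under
    simplification; [mklinE] is its only computation rule. *)
Definition mklin A B (f : A -> B) (H : linear f) : {linear A -> B} :=
  projT1 (cid (mklin_ex H)).
Lemma mklinE A B (f : A -> B) (H : linear f) x : mklin H x = f x.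
Proof. by rewrite /mklin; case: cid. Qed.

Definition compL A B C (g : {linear B -> C}) (f : {linear A -> B}) :
  {linear A -> C} := g \o f.

Definition idL A : {linear A -> A} := idfun.

Definition zeroL A B : {linear A -> B} := \0.

Lemma lin_factor_inj A B C (f : {linear A -> B}) (g : {linear C -> B}) :
  injective f -> (forall c, exists a, f a = g c) ->
  exists h : {linear C -> A}, forall c, f (h c) = g c.
Proof.
move=> fI fg; have [h hE] := choice fg.
have hL : linear h by move=> a u v; apply: fI; rewrite linearP !hE linearP.
by exists (mklin hL) => c; rewrite mklinE.
Qed.

Lemma lin_factor_surj A B C (p : {linear A -> B}) (g : {linear A -> C}) :
  (forall b, exists a, p a = b) -> (forall a, p a = 0 -> g a = 0) ->
  exists h : {linear B -> C}, forall a, h (p a) = g a.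
Proof.
move=> pS pg; have [s sE] := choice pS.
have gp a b : p a = p b -> g a = g b.
  by move=> pab; apply/subr0_eq; rewrite -linearB pg // linearB /= pab subrr.
have hL : linear (g \o s).
  by move=> a u v /=; rewrite -linearP; apply: gp; rewrite linearP !sE.
by exists (mklin hL) => a; rewrite mklinE; apply: gp; rewrite sE.
Qed.

Lemma lin_inj A B (f : {linear A -> B}) : (forall a, f a = 0 -> a = 0) -> injective f.
Proof. by move=> f0 a b fab; apply/subr0_eq/f0; rewrite linearB /= fab subrr. Qed.

Lemma lin_inverse A B (f : {linear A -> B}) :
  injective f -> (forall b, exists a, f a = b) ->
  exists g : {linear B -> A}, (forall a, g (f a) = a) /\ (forall b, f (g b) = b).
Proof.
move=> fI fS; have [|g gE] := lin_factor_inj (g := idL B) fI; first by move=> b; exact: fS.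
by exists g; split=> // a; apply: fI; rewrite gE.
Qed.

Lemma isomorphicP A B (f : {linear A -> B}) :
  injective f -> (forall b, exists a, f a = b) -> isomorphic A B.
Proof.
by move=> fI /(lin_inverse fI) [g [gK Kg]]; exists f; exists g.
Qed.

Section Pair.
Variables A B C : lmodType R.
Definition fstL : {linear (A * B)%type -> A} := fst.
Definition sndL : {linear (A * B)%type -> B} := snd.
Fact pair_linear (f : {linear C -> A}) (g : {linear C -> B}) :
  linear (fun c => (f c, g c) : (A * B)%type).
Proof. by move=> a u v; rewrite !linearP. Qed.
Definition pairL f g : {linear C -> (A * B)%type} := mklin (pair_linear f g).
Lemma pairLE f g c : pairL f g c = (f c, g c). Proof. exact: mklinE. Qed.
Fact copair_linear (f : {linear A -> C}) (g : {linear B -> C}) :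
  linear (fun p : (A * B)%type => f p.1 + g p.2).
Proof. by move=> a u v; rewrite !linearP /= scalerDr addrACA. Qed.
Definition copairL f g : {linear (A * B)%type -> C} := mklin (copair_linear f g).
Lemma copairLE f g p : copairL f g p = f p.1 + g p.2. Proof. exact: mklinE. Qed.
End Pair.
Definition inlL A B : {linear A -> (A * B)%type} := pairL (idL A) (zeroL A B).
Definition inrL A B : {linear B -> (A * B)%type} := pairL (zeroL B A) (idL B).
Lemma inlLE A B (x : A) : inlL A B x = (x, 0). Proof. by rewrite pairLE. Qed.
Lemma inrLE A B (x : B) : inrL A B x = (0, x). Proof. by rewrite pairLE. Qed.

End Linear.

Section Submodules.
Variables (R : pzRingType) (V : lmodType R).

(** The predicate is stored with its bare function type, so that the type of all
    submodules of V lives in the same universe as V. *)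
Record submod := Submod {
  smem :> V -> Prop;
  smem0 : smem 0;
  smemP : forall a u v, smem u -> smem v -> smem (a *: u + v) }.

Section Theory.
Variable X : submod.
Lemma smemD u v : X u -> X v -> X (u + v).
Proof. by move=> Xu Xv; rewrite -[u]scale1r; apply: smemP. Qed.
Lemma smemZ a u : X u -> X (a *: u).
Proof. by move=> Xu; rewrite -[_ *: _]addr0; apply: smemP => //; apply: smem0. Qed.
Lemma smemN u : X u -> X (- u).
Proof. by rewrite -scaleN1r; exact: smemZ. Qed.
Lemma smemB u v : X u -> X v -> X (u - v).
Proof. by move=> Xu /smemN; exact: smemD. Qed.
Lemma smem_sum (I : Type) (r : seq I) (P : pred I) (f : I -> V) :
  (forall i, P i -> X (f i)) -> X (\sum_(i <- r | P i) f i).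
Proof. by move=> Xf; apply: big_ind => //; [exact: smem0 | exact: smemD]. Qed.

Definition spred : {pred V} := fun v => `[< X v >].
Fact spred_closed : submod_closed spred.
Proof.
split=> [|a u v /asboolP Xu /asboolP Xv]; apply/asboolP; first exact: smem0.
exact: smemP.
Qed.
HB.instance Definition _ :=
  GRing.isSubmodClosed.Build R V spred (GRing.submod_closed_semi spred_closed).

Record subm : Type := Subm { subm_val : V; _ : subm_val \in spred }.
HB.instance Definition _ := [isSub for subm_val].
HB.instance Definition _ := [Choice of subm by <:].
HB.instance Definition _ := [SubChoice_isSubLmodule of subm by <:].

Fact val_linear : linear (fun x : subm => subm_val x).
Proof. by []. Qed.
Definition incL : {linear subm -> V} := mklin val_linear.
Lemma incLE x : incL x = subm_val x. Proof. exact: mklinE. Qed.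
Lemma incL_inj : injective incL.
Proof. by move=> x y; rewrite !incLE => /val_inj. Qed.
Lemma incLP x : X (incL x).
Proof. by rewrite incLE; apply/asboolP; exact: (valP x). Qed.
Lemma incL_ex v : X v -> exists x, incL x = v.
Proof. by move=> /asboolP Xv; exists (Subm Xv); rewrite incLE. Qed.

(** The elements are the cosets of X, as predicates. *)
Record quo : Type := Quo { quo_set : V -> Prop;
  _ : exists v, quo_set = fun w => X (w - v) }.
Lemma quo_ex v : exists v', (fun w => X (w - v)) = fun w => X (w - v').
Proof. by exists v. Qed.
Definition quo_pi v : quo := Quo (quo_ex v).
Lemma quo_piP u v : quo_pi u = quo_pi v <-> X (u - v).
Proof.
split=> [[E]|Xuv].
  have /= <- := congr1 (fun f => f u) E; by rewrite subrr; apply: smem0.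
have E : (fun w => X (w - u)) = fun w => X (w - v).
  apply/funext => w; apply/propext; split=> Xw.
    by rewrite -(subrKA u); apply: smemD.
  by rewrite -(subrKA v) -[v - u]opprB; apply: smemB.
rewrite /quo_pi; move: (quo_ex u) (quo_ex v); rewrite E => p q.
by congr Quo; apply: Prop_irrelevance.
Qed.
Lemma quo_surj q : exists v, quo_pi v = q.
Proof.
case: q => s [v E]; exists v; subst s; rewrite /quo_pi.
by congr Quo; apply: Prop_irrelevance.
Qed.
Definition quo_repr q := projT1 (cid (quo_surj q)).
Lemma quo_reprK q : quo_pi (quo_repr q) = q.
Proof. by rewrite /quo_repr; case: cid. Qed.

HB.instance Definition _ := gen_eqMixin quo.
HB.instance Definition _ := gen_choiceMixin quo.

Definition quo_add p q := quo_pi (quo_repr p + quo_repr q).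
Definition quo_opp p := quo_pi (- quo_repr p).
Definition quo_scale a p := quo_pi (a *: quo_repr p).
Lemma quo_addE u v : quo_add (quo_pi u) (quo_pi v) = quo_pi (u + v).
Proof. by apply/quo_piP; rewrite opprD addrACA; apply: smemD; apply/quo_piP; rewrite quo_reprK. Qed.
Lemma quo_oppE u : quo_opp (quo_pi u) = quo_pi (- u).
Proof. by apply/quo_piP; rewrite opprK addrC; apply/quo_piP; rewrite quo_reprK. Qed.
Lemma quo_scaleE a u : quo_scale a (quo_pi u) = quo_pi (a *: u).
Proof. by apply/quo_piP; rewrite -scalerBr; apply: smemZ; apply/quo_piP; rewrite quo_reprK. Qed.
Fact quo_addA : associative quo_add.
Proof.
by move=> p q r; rewrite -[p]quo_reprK -[q]quo_reprK -[r]quo_reprK !quo_addE addrA.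
Qed.
Fact quo_addC : commutative quo_add.
Proof. by move=> p q; rewrite -[p]quo_reprK -[q]quo_reprK !quo_addE addrC. Qed.
Fact quo_add0 : left_id (quo_pi 0) quo_add.
Proof. by move=> p; rewrite -[p]quo_reprK quo_addE add0r. Qed.
Fact quo_addN : left_inverse (quo_pi 0) quo_opp quo_add.
Proof. by move=> p; rewrite -[p]quo_reprK quo_oppE quo_addE addNr. Qed.
HB.instance Definition _ :=
  GRing.isZmodule.Build quo quo_addA quo_addC quo_add0 quo_addN.
Fact quo_scaleA a b u : quo_scale a (quo_scale b u) = quo_scale (a * b) u.
Proof. by rewrite -[u]quo_reprK !quo_scaleE scalerA. Qed.
Fact quo_scale1 : left_id 1 quo_scale.
Proof. by move=> u; rewrite -[u]quo_reprK !quo_scaleE scale1r. Qed.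
Fact quo_scaleDr : right_distributive quo_scale +%R.
Proof.
move=> a u v; have [x <-] := quo_surj u; have [y <-] := quo_surj v.
by rewrite [quo_pi x + _]quo_addE !quo_scaleE [RHS]quo_addE scalerDr.
Qed.
Fact quo_scaleDl u : {morph quo_scale^~ u : a b / a + b}.
Proof.
by move=> a b; rewrite -[u]quo_reprK !quo_scaleE [RHS]quo_addE -scalerDl.
Qed.
HB.instance Definition _ := GRing.Zmodule_isLmodule.Build R quo
  quo_scaleA quo_scale1 quo_scaleDr quo_scaleDl.

Fact quo_pi_linear : linear quo_pi.
Proof. by move=> a u v; rewrite -quo_addE -quo_scaleE. Qed.
Definition piL : {linear V -> quo} := mklin quo_pi_linear.
Lemma piLE v : piL v = quo_pi v. Proof. exact: mklinE. Qed.
Lemma piL_surj q : exists v, piL v = q.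
Proof. by have [v <-] := quo_surj q; exists v; rewrite piLE. Qed.
Lemma piL0 v : piL v = 0 <-> X v.
Proof.
by rewrite piLE -[v in X v]subr0 -quo_piP.
Qed.
End Theory.
End Submodules.

Section MoreSubmodules.
Variable R : pzRingType.
Implicit Types A B C : lmodType R.

Definition kerS A B (f : {linear A -> B}) : submod A.
Proof.
apply: (@Submod _ _ (fun a => f a = 0)); first exact: linear0.
by move=> a u v fu fv; rewrite linearP fu fv scaler0 addr0.
Defined.
Definition ranS A B (f : {linear A -> B}) : submod B.
Proof.
apply: (@Submod _ _ (fun b => exists a, f a = b)); first by exists 0; exact: linear0.
by move=> a u v [x <-] [y <-]; exists (a *: x + y); exact: linearP.
Defined.
Definition botS A : submod A.
Proof.
apply: (@Submod _ _ (fun x => x = 0)) => // a u v -> ->.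
by rewrite scaler0 addr0.
Defined.
Definition imS A B (f : {linear A -> B}) (X : submod A) : submod B :=
  ranS (compL f (incL X)).
Definition preS A B (f : {linear A -> B}) (Y : submod B) : submod A.
Proof.
apply: (@Submod _ _ (fun a => Y (f a))); first by rewrite linear0; exact: smem0.
by move=> a u v Yu Yv; rewrite linearP; exact: smemP.
Defined.
Lemma imSP A B (f : {linear A -> B}) (X : submod A) b :
  imS f X b <-> exists2 a, X a & f a = b.
Proof.
split=> [[x <-]|[a Xa <-]]; first by exists (incL X x) => //; exact: incLP.
by have [x <-] := incL_ex Xa; exists x.
Qed.
Lemma sub_factor A (X Y : submod A) : (forall a, X a -> Y a) ->
  exists h : {linear subm X -> subm Y}, forall x, incL Y (h x) = incL X x.
Proof.
move=> XY; apply: lin_factor_inj; first exact: incL_inj.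
by move=> c; apply: incL_ex; apply: XY; exact: incLP.
Qed.
End MoreSubmodules.

(** * Direct sums and free modules *)
Section DirectSums.
Variables (R : pzRingType) (I : small) (F : I -> lmodType R).
Implicit Types (u v : direct_sum F) (i j : I).

Fact dsum_coord_linear i : linear (fun u => dsum_val u i : F i).
Proof. by []. Qed.
Definition coordL i : {linear direct_sum F -> F i} := mklin (dsum_coord_linear i).
Lemma coordLE i u : coordL i u = dsum_val u i. Proof. exact: mklinE. Qed.

Lemma dsum_ext u v : (forall i, coordL i u = coordL i v) -> u = v.
Proof.
move=> uv; apply: val_inj; apply: functional_extensionality_dep => i.
by have := uv i; rewrite !coordLE.
Qed.

Lemma dsum_supp u : finite_set [set i | coordL i u != 0].
Proof.
have /asboolP := valP u; apply: sub_finite_set => i /=.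
by rewrite coordLE.
Qed.

Lemma dsum_mk (f : forall i, F i) : finite_set [set i | f i != 0] ->
  exists u, forall i, coordL i u = f i.
Proof.
move=> /asboolP fin; exists (DirectSum (fin : (f : dprod F) \in @finsupp _ _ _)) => i.
by rewrite coordLE.
Qed.

Definition delta i (x : F i) j : F j :=
  if pselect (i = j) is left e then ecast k (F k) e x else 0.
Lemma delta_eq i (x : F i) : delta x i = x.
Proof.
rewrite /delta; case: pselect => // e.
by rewrite (Prop_irrelevance e erefl).
Qed.
Lemma delta_neq i (x : F i) j : i <> j -> delta x j = 0.
Proof. by rewrite /delta; case: pselect. Qed.
Lemma delta_finite i (x : F i) : finite_set [set j | delta x j != 0].
Proof.
apply: (@sub_finite_set _ _ [set i]) => // j /= /eqP; apply: contra_notP => ij.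
by apply: delta_neq => // e; apply: ij.
Qed.
Lemma dsum_inj_ex i : exists f : {linear F i -> direct_sum F},
  forall x j, coordL j (f x) = delta x j.
Proof.
have [f fE] := choice (fun x : F i => dsum_mk (delta_finite x)).
have fL : linear f.
  move=> a x y; apply: dsum_ext => j; rewrite linearP !fE.
  have [<-|ij] := pselect (i = j); first by rewrite !delta_eq.
  by rewrite !delta_neq // scaler0 addr0.
by exists (mklin fL) => x j; rewrite (mklinE fL) fE.
Qed.
Definition injL i : {linear F i -> direct_sum F} := projT1 (cid (dsum_inj_ex i)).
Lemma coord_inj i x : coordL i (injL i x) = x.
Proof. by rewrite /injL; case: cid => f /= ->; rewrite delta_eq. Qed.
Lemma coord_inj_neq i j x : i <> j -> coordL j (injL i x) = 0.
Proof. by move=> ij; rewrite /injL; case: cid => f /= ->; rewrite delta_neq. Qed.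

Let J := {classic I}.

Lemma dsum_list u : exists2 s : seq J, uniq s & forall i, coordL i u <> 0 -> (i : J) \in s.
Proof.
have /finite_seqP[s sE] := @dsum_supp u : finite_set ([set i | coordL i u != 0] : set J).
exists (undup s); first exact: undup_uniq.
by move=> i /eqP ui; rewrite mem_undup; have : [set` s] (i : J) by rewrite -sE.
Qed.

Lemma dsum_expand u (s : seq J) : uniq s -> (forall i, coordL i u <> 0 -> (i : J) \in s) ->
  u = \sum_(i <- s) injL i (coordL i u).
Proof.
move=> us su; apply: dsum_ext => j; rewrite linear_sum /=.
have [js|js] := boolP ((j : J) \in s).
  rewrite (bigD1_seq (j : J)) //= coord_inj big1 ?addr0 // => i ij.
  by apply: coord_inj_neq; move/eqP: ij.
rewrite big_seq big1 => [|i si].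
  by apply: contrapT => /su; rewrite (negbTE js).
by apply: coord_inj_neq => e; rewrite -e si in js.
Qed.

(** The last hypothesis concerns the components of the given [u] only, which
    is how conditions on its support enter an induction. *)
Lemma dsum_ind (P : direct_sum F -> Prop) u : P 0 ->
  (forall v w, P v -> P w -> P (v + w)) ->
  (forall i, coordL i u <> 0 -> P (injL i (coordL i u))) -> P u.
Proof.
move=> P0 PD Pu; have [s us su] := dsum_list u; rewrite (dsum_expand us su).
apply: big_ind => // i _.
by have [->|/eqP /Pu //] := eqVneq (coordL i u) 0; rewrite linear0.
Qed.

Section Lift.
Variables (W : lmodType R) (f : forall i, {linear F i -> W}).
Lemma lift_ex : exists g : {linear direct_sum F -> W}, forall i x, g (injL i x) = f i x.
Proof.
have [h hE] : exists h : direct_sum F -> W, forall u (s : seq J), uniq s ->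
    (forall i, coordL i u <> 0 -> (i : J) \in s) -> h u = \sum_(i <- s) f i (coordL i u).
  exists (fun u => \sum_(i \in [set: J]) f i (coordL i u)) => u s us su.
  have us0 i : (i : J) \notin s -> f i (coordL i u) = 0.
    move=> si; have -> : coordL i u = 0 by apply: contrapT => /su; rewrite (negbTE si).
    exact: linear0.
  rewrite (fsbigE s) // => [|i _]; last exact: us0.
  by apply: eq_bigl => i; rewrite in_setT.
have hL : linear h.
  move=> a u v; have [s us su] := dsum_list u; have [t ut tv] := dsum_list v.
  pose r := undup (s ++ t).
  have ru i : coordL i u <> 0 -> (i : J) \in r.
    by move=> /su; rewrite mem_undup mem_cat => ->.
  have rv i : coordL i v <> 0 -> (i : J) \in r.
    by move=> /tv; rewrite mem_undup mem_cat orbC => ->.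
  have r_uniq : uniq r by apply: undup_uniq.
  rewrite (hE _ r) // ?(hE u r) // ?(hE v r) //.
    by rewrite scaler_sumr -big_split; apply: eq_bigr => i _; rewrite !linearP.
  move=> i; apply: contra_notT => ir; rewrite linearP.
  have -> : coordL i u = 0 by apply: contrapT => /ru; rewrite (negbTE ir).
  have -> : coordL i v = 0 by apply: contrapT => /rv; rewrite (negbTE ir).
  by rewrite scaler0 addr0.
exists (mklin hL) => i x; rewrite (mklinE hL) (hE _ [:: i : J]) //.
  by rewrite big_seq1 coord_inj.
move=> j; apply: contra_notT => ij; apply: coord_inj_neq => e.
by rewrite e mem_head in ij.
Qed.
Definition liftL : {linear direct_sum F -> W} := projT1 (cid lift_ex).
Lemma liftLE i x : liftL (injL i x) = f i x.
Proof. by rewrite /liftL; case: cid => g /= ->. Qed.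
End Lift.

Lemma dsum_lin_ext (W : lmodType R) (g h : {linear direct_sum F -> W}) :
  (forall i x, g (injL i x) = h (injL i x)) -> forall u, g u = h u.
Proof.
move=> gh u; apply: (@dsum_ind (fun v => g v = h v) u); first by rewrite !linear0.
  by move=> v w gv gw; rewrite !linearD gv gw.
by move=> i _; exact: gh.
Qed.
End DirectSums.

Section Free.
Variables (R : pzRingType) (X : small).
Definition freemod : lmodType R := direct_sum (fun _ : X => (R^o : lmodType R)).
Definition gen (x : X) : freemod := @injL R X (fun _ : X => (R^o : lmodType R)) x (1 : R^o).
Lemma free_lift (W : lmodType R) (f : X -> W) :
  exists g : {linear freemod -> W}, forall x, g (gen x) = f x.
Proof.
have sL x : linear ((fun r : R => r *: f x) : (R^o : lmodType R) -> W).
  by move=> a r s; rewrite scalerDl -scalerA.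
exists (liftL (fun x => mklin (sL x))) => x.
by rewrite liftLE (mklinE (sL x)) scale1r.
Qed.
(** The modules onto which [X] maps form a set up to isomorphism: they are the
    quotients of the free module on [X]. *)
Lemma quo_free (W : lmodType R) (f : X -> W) : (forall w, exists x, f x = w) ->
  exists Z : submod freemod, exists g : {linear quo Z -> W},
    injective g /\ (forall w, exists q, g q = w).
Proof.
move=> fS; have [g gE] := free_lift f.
have [|h hE] := lin_factor_surj (g := g) (@piL_surj _ _ (kerS g)).
  by move=> a /piL0.
exists (kerS g), h; split.
  apply: lin_inj => q; have [v <-] := piL_surj q.
  by rewrite hE => gv; apply/piL0.
by move=> w; have [x <-] := fS w; exists (piL (kerS g) (gen x)); rewrite hE gE.
Qed.
End Free.

(** * Purity for a family of linear systems *)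
Section Pure.
Variable R : pzRingType.
Implicit Types A B C D E : lmodType R.

Definition lincomb A m n (c : 'I_m -> 'I_n -> R) (b : 'I_n -> A) (i : 'I_m) : A :=
  \sum_j c i j *: b j.

Lemma lincomb_map A B (f : {linear A -> B}) m n (c : 'I_m -> 'I_n -> R) b i :
  f (lincomb c b i) = lincomb c (f \o b) i.
Proof. by rewrite linear_sum; apply: eq_bigr => j _; rewrite linearZ. Qed.
Lemma lincombD A m n (c : 'I_m -> 'I_n -> R) (b b' : 'I_n -> A) i :
  lincomb c (fun j => b j + b' j) i = lincomb c b i + lincomb c b' i.
Proof. by rewrite -big_split; apply: eq_bigr => j _; rewrite scalerDr. Qed.
Lemma lincombB A m n (c : 'I_m -> 'I_n -> R) (b b' : 'I_n -> A) i :
  lincomb c (fun j => b j - b' j) i = lincomb c b i - lincomb c b' i.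
Proof. by rewrite -sumrB; apply: eq_bigr => j _; rewrite scalerBr. Qed.
Lemma eq_lincomb A m n (c : 'I_m -> 'I_n -> R) (b b' : 'I_n -> A) i :
  b =1 b' -> lincomb c b i = lincomb c b' i.
Proof. by move=> bb; apply: eq_bigr => j _; rewrite bb. Qed.

(** The coefficients are plain functions, so that systems can be constructor
    arguments of small inductive types. *)
Definition systems := forall m n, ('I_m -> 'I_n -> R) -> Prop.
Variable Sys : systems.

Definition sys_pure : hom_class R := fun A B f =>
  injective f /\
  forall m n (c : 'I_m -> 'I_n -> R), Sys c -> forall a b,
    (forall i, lincomb c b i = f (a i)) -> exists b', forall i, lincomb c b' i = a i.

Lemma sys_pure_comp A B C (f : {linear A -> B}) (g : {linear B -> C}) :
  sys_pure f -> sys_pure g -> sys_pure (compL g f).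
Proof.
move=> [fI fP] [gI gP]; split=> [|m n c S a b E]; first exact: inj_comp.
by have [b' E'] := gP _ _ _ S _ _ E; exact: fP E'.
Qed.

Lemma sys_pure_cancel A B C (f : {linear A -> B}) (g : {linear B -> C}) :
  sys_pure (compL g f) -> sys_pure f.
Proof.
move=> [gfI gfP]; split=> [x y fxy|m n c S a b E].
  by apply: gfI; rewrite /= fxy.
by apply: (gfP _ _ _ S a (g \o b)) => i; rewrite -lincomb_map E.
Qed.

Lemma sys_pure_ext A B (f g : {linear A -> B}) : f =1 g -> sys_pure f -> sys_pure g.
Proof.
move=> fg [fI fP]; split=> [x y|m n c S a b E]; first by rewrite -!fg => /fI.
by apply: (fP _ _ _ S a b) => i; rewrite fg E.
Qed.

Lemma sys_pure_cancel_ext A B C (f : {linear A -> B}) (g : {linear B -> C}) (h : {linear A -> C}) :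
  sys_pure h -> (forall x, g (f x) = h x) -> sys_pure f.
Proof. by move=> hP gfh; apply: (@sys_pure_cancel _ _ _ f g); apply: sys_pure_ext hP => x /=. Qed.

Lemma sys_pure_comp_ext A B C (f : {linear A -> B}) (g : {linear B -> C}) (h : {linear A -> C}) :
  sys_pure f -> sys_pure g -> (forall x, g (f x) = h x) -> sys_pure h.
Proof. by move=> fP gP E; apply: sys_pure_ext (sys_pure_comp fP gP) => x /=. Qed.

Lemma sys_pure_id A : sys_pure (idL A).
Proof. by split=> // m n c S a b E; exists b. Qed.

Lemma sys_pure_split A B (f : {linear A -> B}) (g : {linear B -> A}) :
  (forall x, g (f x) = x) -> sys_pure f.
Proof. by move=> gf; apply: (sys_pure_cancel_ext (sys_pure_id A) (g := g)). Qed.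

Lemma sys_pure_iso A B (f : {linear A -> B}) :
  injective f -> (forall b, exists a, f a = b) -> sys_pure f.
Proof. by move=> fI /(lin_inverse fI) [g [gK _]]; exact: sys_pure_split gK. Qed.

(** For the inclusion of a submodule both directions of purity can be read
    inside the ambient module. *)
Lemma sys_pure_inc A (X : submod A) :
  (forall m n (c : 'I_m -> 'I_n -> R), Sys c -> forall (a : 'I_m -> A) b,
    (forall i, X (a i)) -> (forall i, lincomb c b i = a i) ->
    exists2 b', (forall j, X (b' j)) & forall i, lincomb c b' i = a i) ->
  sys_pure (incL X).
Proof.
move=> XP; split=> [|m n c S a b E]; first exact: incL_inj.
have [b' Xb' E'] := XP _ _ _ S _ _ (fun i => incLP (a i)) E.
have [b2 b2E] := choice (fun j => incL_ex (Xb' j)).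
exists b2 => i; apply: (@incL_inj _ _ X); rewrite lincomb_map -E'.
by apply: eq_lincomb => j /=.
Qed.

Lemma inc_sys_pure A (X : submod A) : sys_pure (incL X) ->
  forall m n (c : 'I_m -> 'I_n -> R), Sys c -> forall (a : 'I_m -> A) b,
    (forall i, X (a i)) -> (forall i, lincomb c b i = a i) ->
    exists2 b', (forall j, X (b' j)) & forall i, lincomb c b' i = a i.
Proof.
move=> [_ XP] m n c S a b Xa E.
have [a2 a2E] := choice (fun j => incL_ex (Xa j)).
have [|b' E'] := XP _ _ _ S a2 b; first by move=> i; rewrite E a2E.
exists (fun j => incL X (b' j)) => [j|i]; first exact: incLP.
by rewrite -a2E -E' lincomb_map.
Qed.

(** A map out of N is detected on the submodule [j] and on its quotient [p].
    Given a solution of a system in E * U, its U-part descends to a solution in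
    the quotient; lift that to N, and the error lies in A, where the E-part
    together with purity of [u \o j] corrects it. *)
Lemma sys_pure_pair (A N E D U : lmodType R) (j : {linear A -> N}) (u : {linear N -> E})
    (p : {linear N -> D}) (k : {linear D -> U}) :
  sys_pure (compL u j) -> (forall x, p x = 0 -> exists a, j a = x) ->
  (forall a, p (j a) = 0) ->
  (forall d, exists x, p x = d) -> sys_pure k ->
  sys_pure (pairL u (compL k p)).
Proof.
move=> [ujI ujP] pj jp pS [kI kP]; split.
  apply: lin_inj => x; rewrite pairLE => -[ux].
  rewrite /= -[RHS](linear0 k) => /kI /pj [a ja].
  by rewrite -ja; have -> : a = 0; [apply: ujI; rewrite /= linear0 ja ux linear0|rewrite linear0].
move=> m n c S a b Eq.
have E1 i : lincomb c (fst \o b) i = u (a i).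
  by have := congr1 (fun x => fstL _ _ x) (Eq i); rewrite lincomb_map pairLE.
have E2 i : lincomb c (snd \o b) i = k (p (a i)).
  by have := congr1 (fun x => sndL _ _ x) (Eq i); rewrite lincomb_map pairLE.
have [d dE] := kP _ _ _ S (p \o a) _ E2.
have [y yE] := choice (fun l => pS (d l)).
have [|a0 a0E] := choice (X := 'I_m) (P := fun i x => j x = a i - lincomb c y i).
  move=> i; apply: pj; rewrite linearB lincomb_map /= -[p (a i)]dE.
  by rewrite (@eq_lincomb _ _ _ c (p \o y) d) ?subrr.
have [|a1 a1E] := ujP _ _ _ S a0 (fun l => (fst \o b) l - u (y l)).
  by move=> i; rewrite lincombB E1 /= a0E linearB (lincomb_map u).
exists (fun l => y l + j (a1 l)) => i; rewrite lincombD -(lincomb_map j c a1) a1E a0E.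
by rewrite addrC subrK.
Qed.

Section ClassK.
Variable K : lmodType R -> Prop.
Hypotheses (K_sums : closed_direct_sums K) (K_sub : closed_submodules sys_pure K)
  (K_epi : closed_epi_images sys_pure K).

Lemma K_iso A B (f : {linear A -> B}) :
  injective f -> (forall b, exists a, f a = b) -> K A -> K B.
Proof.
move=> fI fS KA; have [g [gK Kg]] := lin_inverse fI fS.
by apply: K_sub KA (sys_pure_split Kg).
Qed.

Lemma K_quotient A B C (f : {linear A -> B}) (g : {linear B -> C}) :
  K B -> sys_pure f -> (forall c, exists b, g b = c) ->
  (forall b, g b = 0 <-> exists a, f a = b) -> K C.
Proof.
move=> KB fP gS gf; apply: (K_epi KB (f := g)); exists A, f; split=> //; split.
- by case: fP.
- apply/seteqP; split=> b /=; first by move=> [a _ <-]; apply/gf; exists a.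
  by move=> /gf [a <-]; exists a.
- by apply/seteqP; split=> c // _; have [b <-] := gS c; exists b.
Qed.

Lemma K_pair A B : K A -> K B -> K (A * B)%type.
Proof.
move=> KA KB; pose F (b : bool) := if b then A else B.
have KF : K (direct_sum F) by apply: K_sums; case.
pose f : {linear direct_sum F -> (A * B)%type} :=
  pairL (coordL F true) (coordL F false).
apply: (K_iso (f := f)) KF.
  by apply: lin_inj => u; rewrite pairLE => -[u1 u2]; apply: dsum_ext; case; rewrite linear0.
move=> [x y]; exists (injL F true x + injL F false y).
by rewrite linearD !pairLE !coord_inj !coord_inj_neq //=; congr pair; rewrite ?addr0 ?add0r.
Qed.

Lemma K_zero : exists Z : lmodType R, K Z /\ forall x : Z, x = 0.
Proof.
exists (direct_sum (fun v : void => match v return lmodType R with end)).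
by split; [apply: K_sums; case | move=> x; apply: dsum_ext; case].
Qed.

Lemma sys_pure_zero A B (f : {linear A -> B}) : (forall x : A, x = 0) -> sys_pure f.
Proof.
move=> A0; split=> [x y _|m n c S a b E]; first by rewrite [x]A0 [y]A0.
by exists (fun _ => 0) => i; rewrite [RHS]A0 [LHS]A0.
Qed.

(** The pushout is the quotient of E * B by the graph of (g, - f).  The graph map
    is pure because followed by the projection to B it is [- f], so the quotient
    is an M-epimorphic image of E * B. *)
Lemma pushout A B E (f : {linear A -> B}) (g : {linear A -> E}) :
  K B -> K E -> sys_pure f ->
  exists (P : lmodType R) (u : {linear E -> P}) (v : {linear B -> P}),
    [/\ K P, sys_pure u, forall a, v (f a) = u (g a),
        forall p, exists e b, p = u e + v b & sys_pure g -> sys_pure v].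
Proof.
move=> KB KE fP; have [fI fS] := fP.
pose d : {linear A -> (E * B)%type} := pairL g (compL (-%R : {linear B -> B}) f).
have dE a : d a = (g a, - f a) by rewrite pairLE.
have dP : sys_pure d.
  apply: (sys_pure_cancel_ext fP (g := compL (-%R : {linear B -> B}) (sndL E B))) => x /=.
  by rewrite dE /= opprK.
pose P : lmodType R := quo (ranS d).
pose p : {linear (E * B)%type -> P} := piL (ranS d).
have pS q : exists x, p x = q by exact: piL_surj.
have p0 x : p x = 0 <-> exists a, d a = x by exact: piL0.
have pE x y : p (inlL E B x) + p (inrL E B y) = p (x, y).
  by rewrite -linearD inlLE inrLE; congr (p (_, _)); rewrite ?addr0 ?add0r.
exists P, (compL p (inlL E B)), (compL p (inrL E B)); split.
- by apply: K_quotient (K_pair KE KB) dP pS p0.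
- split=> [|m n c S a b Eq].
    apply: lin_inj => x /= /p0 [a]; rewrite dE inlLE => -[gx /eqP].
    by rewrite oppr_eq0 -(linear0 f) => /eqP /fI a0; rewrite -gx a0 linear0.
  have [y yE] := choice (fun l => pS (b l)).
  have [|a0 a0E] := choice (X := 'I_m) (P := fun i x => d x = lincomb c y i - inlL E B (a i)).
    move=> i; apply/p0; rewrite linearB lincomb_map -[X in _ - X](Eq i).
    by rewrite (@eq_lincomb _ _ _ c (p \o y) b) ?subrr.
  have E1 i : g (a0 i) = lincomb c (fst \o y) i - a i.
    have := congr1 (fun x => fstL _ _ x) (a0E i).
    by rewrite linearB lincomb_map dE inlLE.
  have E2 i : - f (a0 i) = lincomb c (snd \o y) i.
    have := congr1 (fun x => sndL _ _ x) (a0E i).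
    by rewrite linearB lincomb_map dE inlLE /= subr0.
  have [|a1 a1E] := fS _ _ _ S (fun i => - a0 i) (snd \o y).
    by move=> i; rewrite -E2 linearN.
  exists (fun l => (y l).1 + g (a1 l)) => i.
  rewrite lincombD -(lincomb_map g c a1) a1E linearN E1 opprB.
  by rewrite addrC subrK.
- move=> a /=; apply/subr0_eq; rewrite -linearB; apply/p0; exists (- a).
  rewrite dE inlLE inrLE !linearN opprK; congr pair; rewrite /= ?sub0r ?subr0 //.
- move=> q; have [[x y] <-] := pS q; exists x, y.
  by rewrite -pE.
- move=> [gI gS]; split=> [|m n c S a b Eq].
    apply: lin_inj => x /= /p0 [a]; rewrite dE inrLE => -[/eqP].
    by rewrite -(linear0 g) => /eqP /gI -> <-; rewrite linear0 oppr0.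
  have [y yE] := choice (fun l => pS (b l)).
  have [|a0 a0E] := choice (X := 'I_m) (P := fun i x => d x = lincomb c y i - inrL E B (a i)).
    move=> i; apply/p0; rewrite linearB lincomb_map -[X in _ - X](Eq i).
    by rewrite (@eq_lincomb _ _ _ c (p \o y) b) ?subrr.
  have E1 i : g (a0 i) = lincomb c (fst \o y) i.
    have := congr1 (fun x => fstL _ _ x) (a0E i).
    by rewrite linearB lincomb_map dE inrLE /= subr0.
  have E2 i : - f (a0 i) = lincomb c (snd \o y) i - a i.
    have := congr1 (fun x => sndL _ _ x) (a0E i).
    by rewrite linearB lincomb_map dE inrLE.
  have [|a1 a1E] := gS _ _ _ S a0 (fst \o y).
    by move=> i; rewrite -E1.
  exists (fun l => (y l).2 + f (a1 l)) => i.
  rewrite lincombD -(lincomb_map f c a1) a1E.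
  by apply/eqP; rewrite -subr_eq0 addrAC -[X in X + _]E2 addNr.
Qed.

(** X is the directed union of the images of the [u j]. *)
Section Colimit.
Variables (J : small) (F : J -> lmodType R) (X : lmodType R)
  (u : forall j, {linear F j -> X}).
Hypotheses (KF : forall j, K (F j)) (uI : forall j, injective (u j)) (j0 : J)
  (dir : forall i j, exists k,
     (forall a, exists b, u k b = u i a) /\ (forall a, exists b, u k b = u j a))
  (surj : forall x, exists j a, u j a = x).

Lemma directed_seq (s : seq X) : exists k, forall x, x \in s -> exists a, u k a = x.
Proof.
elim: s => [|y s [k kP]]; first by exists j0.
have [j [a ya]] := surj y; have [l [lj lk]] := dir j k; exists l => x.
rewrite inE => /orP[/eqP ->|/kP [b <-]]; last exact: lk.
by rewrite -ya; exact: lj.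
Qed.

Lemma directed_tuple n (x : 'I_n -> X) : exists k, forall j, exists a, u k a = x j.
Proof.
have [k kP] := directed_seq [seq x i | i <- enum 'I_n].
by exists k => j; apply: kP; apply: map_f; rewrite mem_enum.
Qed.

(** X is the image of the direct sum of the F j, and the kernel is pure in it:
    given a solution [b] of a system with constants in the kernel, all its images
    in X lie in one F k; subtracting from each [b j] the element of F k with the
    same image moves the solution into the kernel, and it does not change the
    constants because [u k] is injective. *)
Lemma K_directed_union : K X.
Proof.
pose p := liftL u; have KS := K_sums KF.
apply: (K_quotient (f := incL (kerS p)) (g := p) KS).
- split=> [|m n c S a b Eq]; first exact: incL_inj.
  have [k kP] := directed_tuple (fun j => p (b j)).
  have [t tE] := choice kP.
  have tc i : lincomb c t i = 0.
    apply: (@uI k); rewrite lincomb_map linear0.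
    rewrite (@eq_lincomb _ _ _ c (u k \o t) (fun j => p (b j))) // -[LHS]lincomb_map Eq; exact: (@incLP _ _ (kerS p) (a i)).
  have bk j : kerS p (b j - injL F k (t j)).
    by rewrite /= linearB /= /p liftLE tE subrr.
  have [b' b'E] := choice (fun j => incL_ex (bk j)).
  exists b' => i; apply: (@incL_inj _ _ (kerS p)); rewrite lincomb_map -Eq.
  rewrite (eq_lincomb c i (b'E : (incL (kerS p) \o b') =1 _)) lincombB.
  by rewrite -(lincomb_map (injL F k) c t) tc linear0 subr0.
- by move=> x; have [j [a <-]] := surj x; exists (injL F j a); rewrite /p liftLE.
- move=> b; split=> [pb|[a <-]]; last exact: (@incLP _ _ (kerS p) a).
  by have [|a aE] := @incL_ex _ _ (kerS p) b; [ | exists a].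
Qed.

Lemma sys_pure_directed_union j :
  (forall k, (forall a, exists b, u k b = u j a) ->
     exists h : {linear F j -> F k}, sys_pure h /\ forall a, u k (h a) = u j a) ->
  sys_pure (u j).
Proof.
move=> jP; split=> // m n c S a b Eq.
have [k kP] := directed_tuple b; have [l [lk lj]] := dir k j.
have {kP}lP i : exists a, u l a = b i by have [x <-] := kP i; exact: lk.
have [h [[hI hS] hE]] := jP l lj; have [t tE] := choice lP.
apply: (hS _ _ _ S a t) => i; apply: (@uI l); rewrite hE -Eq lincomb_map.
exact: eq_lincomb.
Qed.
End Colimit.
End ClassK.
End Pure.

(** * Zorn's lemma, well-founded trees and small pure submodules *)
Section Zorn.
Variable T : Type.
(** The chains are nonempty, so that the empty set need not satisfy P. *)
Lemma zorn_sets (P : set (set T)) (X0 : set T) : P X0 ->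
  (forall F : set (set T), F !=set0 -> F `<=` P -> total_on F subset ->
     P (\bigcup_(X in F) X)) ->
  exists A, P A /\ forall B, A `<=` B -> P B -> B `<=` A.
Proof.
move=> PX0 PU; pose Q (G : set T) := G = set0 \/ P G.
have [|A [QA maxA]] := @Zorn_bigcup T Q.
  move=> F FQ Ft; have [F0|/set0P F0] := eqVneq (F `&` P) set0.
    left; apply/seteqP; split=> // x [X FX Xx].
    have [E|PX] := FQ _ FX; first by rewrite E in Xx.
    by have : (F `&` P) X by []; rewrite F0.
  right; have -> : \bigcup_(X in F) X = \bigcup_(X in F `&` P) X.
    apply/seteqP; split=> x [X]; last by case=> FX _ Xx; exists X.
    move=> FX Xx; have [E|PX] := FQ _ FX; first by rewrite E in Xx.
    by exists X.
  by apply: PU => [//|X [//]|X Y [FX _] [FY _]]; exact: Ft.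
have PA : P A.
  case: QA => // A0; have [X00|/eqP X00] := pselect (X0 = set0); first by rewrite A0 -X00.
  exfalso; apply: (maxA X0); last by right.
  rewrite A0; split=> //.
  by move/set0P: X00 => [x Xx] /(_ _ Xx).
exists A; split=> // B AB PB; apply: contrapT => nBA.
by apply: (maxA B); [split | right].
Qed.

Lemma chain_tuple (F : set (set T)) n (x : 'I_n -> T) :
  F !=set0 -> total_on F subset -> (forall i, (\bigcup_(X in F) X) (x i)) ->
  exists2 X, F X & forall i, X (x i).
Proof.
move=> [X0 FX0] Ft xF.
suff [X FX Xx] : exists2 X, F X & forall i, i \in enum 'I_n -> X (x i).
  by exists X => // i; apply: Xx; rewrite mem_enum.
elim: (enum 'I_n) => [|i s [X FX IH]]; first by exists X0.
have [Y FY Yi] := xF i; have [XY|YX] := Ft _ _ FX FY.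
  by exists Y => // j; rewrite inE => /orP[/eqP-> //|/IH /XY].
by exists X => // j; rewrite inE => /orP[/eqP->|/IH //]; exact: YX.
Qed.
End Zorn.

(** The closure of a set under operations of arbitrary arity is the image of the
    well-founded trees over the signature.  This bounds its size by the signature
    alone, without cardinal arithmetic. *)
Section Trees.
Inductive tree (Op : small) (ar : Op -> small) : small :=
  Node (o : Op) (t : ar o -> tree ar).
Variables (Op : small) (ar : Op -> small) (T : Type)
  (int : forall o, (ar o -> T) -> T).
Fixpoint tree_eval (t : tree ar) : T :=
  match t with Node o k => int (fun a => tree_eval (k a)) end.
Lemma tree_eval_closed o (k : ar o -> T) :
  (forall a, exists t, tree_eval t = k a) -> exists t, tree_eval t = int k.
Proof.
move=> /choice [t tE]; exists (Node t) => /=; congr int.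
exact/funext.
Qed.
End Trees.

Section LowenheimSkolem.
Variables (R : pzRingType) (Sys : systems R).

Definition capS (V : lmodType R) (X Y : submod V) : submod V.
Proof.
apply: (@Submod _ _ (fun v => X v /\ Y v)); first by split; exact: smem0.
by move=> a u v [? ?] [? ?]; split; exact: smemP.
Defined.
Definition addS (V : lmodType R) (X Y : submod V) : submod V.
Proof.
apply: (@Submod _ _ (fun v => exists x y, [/\ X x, Y y & v = x + y])).
  by exists 0, 0; split; rewrite ?addr0 //; exact: smem0.
move=> a u v [x [y [Xx Yy ->]]] [x' [y' [Xx' Yy' ->]]].
exists (a *: x + x'), (a *: y + y'); split; [exact: smemP|exact: smemP|].
by rewrite scalerDr addrACA.
Defined.

(** The operations under which a submodule X is closed in order to be pure and in
    good position with respect to D: a base point, the linear operations, and one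
    operation for each unknown of each system. *)
Inductive ls_op : small :=
  | LsPoint | LsZero | LsLin (a : R)
  | LsSolve (k : bool) (m n : nat) (c : 'I_m -> 'I_n -> R) (j : 'I_n).
Definition ls_arity (o : ls_op) : small :=
  match o with LsPoint => void | LsZero => void | LsLin _ => bool | @LsSolve _ m _ _ _ => 'I_m end.

Section Interp.
Variables (B : lmodType R) (D : submod B) (b0 : B).

(** For [k = true], [y] solves the system with constants [x] if it is solvable, and
    inside D whenever possible: this makes X pure in B and the intersection of X and D pure.  For
    [k = false], [y] solves it modulo D: this makes X + D pure. *)
Definition wit_spec (k : bool) m n (c : 'I_m -> 'I_n -> R) (x : 'I_m -> B) (y : 'I_n -> B) :=
  if k then
    ((exists2 z, (forall j, D (z j)) & forall i, lincomb c z i = x i) ->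
       (forall j, D (y j)) /\ forall i, lincomb c y i = x i) /\
    ((exists z, forall i, lincomb c z i = x i) -> forall i, lincomb c y i = x i)
  else (exists z, forall i, D (lincomb c z i - x i)) -> forall i, D (lincomb c y i - x i).

Lemma wit_ex k m n (c : 'I_m -> 'I_n -> R) x : exists y, wit_spec k c x y.
Proof.
rewrite /wit_spec; case: k.
  have [[z Dz zx]|no] := pselect (exists2 z, (forall j, D (z j)) & forall i, lincomb c z i = x i).
    by exists z.
  have [[z zx]|no2] := pselect (exists z, forall i, lincomb c z i = x i).
    by exists z; split=> [/no|].
  by exists (fun _ => 0); split=> [/no|/no2].
have [[z zx]|no] := pselect (exists z, forall i, D (lincomb c z i - x i)).
  by exists z.
by exists (fun _ => 0) => /no.
Qed.

Definition wit k m n (c : 'I_m -> 'I_n -> R) x := projT1 (cid (wit_ex k c x)).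
Lemma witP k m n (c : 'I_m -> 'I_n -> R) x : wit_spec k c x (wit k c x).
Proof. exact: projT2 (cid (wit_ex k c x)). Qed.

Definition ls_interp (o : ls_op) : (ls_arity o -> B) -> B :=
  match o return (ls_arity o -> B) -> B with
  | LsPoint => fun _ => b0
  | LsZero => fun _ => 0
  | LsLin a => fun t => a *: t true + t false
  | LsSolve k m n c j => fun t => wit k c t j
  end.

Variable X : B -> Prop.
Hypothesis Xcl : forall o (t : ls_arity o -> B), (forall a, X (t a)) -> X (ls_interp t).
Definition ls_sub : submod B.
Proof.
apply: (@Submod _ _ X); first by apply: (Xcl (o := LsZero) (t := fun v => match v with end)); case.
move=> a u v Xu Xv; apply: (Xcl (o := LsLin a) (t := fun b : bool => if b then u else v)).
by case.
Defined.
Lemma ls_pt : X b0.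
Proof. by apply: (Xcl (o := LsPoint) (t := fun v => match v with end)); case. Qed.
Lemma ls_wit k m n (c : 'I_m -> 'I_n -> R) (x : 'I_m -> B) j :
  (forall i, X (x i)) -> X (wit k c x j).
Proof. by move=> Xx; apply: (Xcl (o := LsSolve k c j) (t := x)). Qed.

Lemma ls_pure : sys_pure Sys (incL ls_sub).
Proof.
apply: sys_pure_inc => m n c S a b Xa E; exists (wit true c a) => [j|i].
  exact: ls_wit.
by case: (witP true c a) => _; apply; exists b.
Qed.

Hypothesis DP : sys_pure Sys (incL D).

Lemma ls_cap : sys_pure Sys (incL (capS ls_sub D)).
Proof.
apply: sys_pure_inc => m n c S a b Xa E; exists (wit true c a) => [j|i].
  split; first by apply: ls_wit => i; case: (Xa i).
  case: (witP true c a) => + _; case=> // .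
  by have [|b' Db E'] := inc_sys_pure DP S _ E; [move=> i; case: (Xa i)|exists b'].
by case: (witP true c a) => _; apply; exists b.
Qed.

(** If the constants are x + d, the chosen [y] solves the system modulo D, and the
    difference with the given solution solves a system with constants in D; by
    purity of D it has a solution there. *)
Lemma ls_add : sys_pure Sys (incL (addS ls_sub D)).
Proof.
apply: sys_pure_inc => m n c S a b Xa E.
have [x /choice [d xd]] := choice Xa.
pose y := wit false c x.
have yP i : D (lincomb c y i - x i).
  apply: (witP false c x); exists b => l; rewrite E.
  by have [_ Dd ->] := xd l; rewrite addrAC subrr add0r.
have [||b' Db' E'] := inc_sys_pure DP S (a := fun i => a i - lincomb c y i) (b := fun j => b j - y j).
- move=> i; have [_ Dd ->] := xd i.
  by rewrite addrAC -opprB; apply: smemD => //; apply: smemN.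
- by move=> i; rewrite lincombB E.
exists (fun j => y j + b' j) => [j|i].
  exists (y j), (b' j); split=> //.
  by apply: ls_wit => i; case: (xd i).
by rewrite lincombD E' addrC subrK.
Qed.
End Interp.

Definition Theta : small := tree ls_arity.

(** Downward Loewenheim-Skolem for the pair of B and D. *)
Lemma lowenheim_skolem (B : lmodType R) (D : submod B) (b : B) : sys_pure Sys (incL D) ->
  exists X : submod B, [/\ X b, sys_pure Sys (incL X), sys_pure Sys (incL (capS X D)),
    sys_pure Sys (incL (addS X D)) &
    exists f : Theta -> B, forall v, X v <-> exists t, f t = v].
Proof.
move=> DP; pose f := tree_eval (ls_interp D b).
pose X v := exists t, f t = v.
have Xcl o (t : ls_arity o -> B) : (forall a, X (t a)) -> X (ls_interp D b t).
  exact: tree_eval_closed.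
exists (ls_sub Xcl); split.
- exact: ls_pt Xcl.
- exact: ls_pure.
- exact: ls_cap.
- exact: ls_add.
- by exists f.
Qed.
End LowenheimSkolem.

(** * A criterion for relative injectivity with a set of tests *)
Section BaerCriterion.
Variables (R : pzRingType) (Sys : systems R) (K : lmodType R -> Prop).
Hypotheses (K_sub : closed_submodules (sys_pure Sys) K).

(** A test is the inclusion of a submodule into a quotient of the free module on
    [Theta].  Up to isomorphism these are all the small monomorphisms, and they
    form a set. *)
Record test : small := Test {
  test_rel : submod (freemod R (Theta R)); test_sub : submod (quo test_rel) }.
Definition test_cod (s : test) : lmodType R := quo (test_rel s).
Definition test_dom (s : test) : lmodType R := subm (test_sub s).
Definition test_map (s : test) : {linear test_dom s -> test_cod s} := incL (test_sub s).
Definition test_good (s : test) := K (test_cod s) /\ sys_pure Sys (test_map s).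

Lemma K_test_dom s : test_good s -> K (test_dom s).
Proof. by move=> [KB fP]; exact: K_sub KB fP. Qed.

(** G is the graph of a linear map that extends [g] to a submodule of B which
    contains the image of [f] and is pure. *)
Definition fgraph_good (A B E : lmodType R) (f : {linear A -> B}) (g : {linear A -> E})
    (G : set (B * E)) :=
  [/\ forall a, G (f a, g a),
      forall a u v, G u -> G v -> G (a *: u.1 + v.1, a *: u.2 + v.2),
      forall e, G (0, e) -> e = 0 &
      forall m n (c : 'I_m -> 'I_n -> R), Sys c -> forall a b,
        (forall i, exists e, G (a i, e)) -> (forall i, lincomb c b i = a i) ->
        exists2 b', (forall j, exists e, G (b' j, e)) & forall i, lincomb c b' i = a i].

(** Let D be the domain of G and X a small piece around [b] as in
    [lowenheim_skolem].  The map on the intersection of X and D extends to X by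
    a test, and the two maps glue on X + D, which is again pure. *)
Lemma baer_step (A B E : lmodType R) (f : {linear A -> B}) (g : {linear A -> E})
    (G : set (B * E)) b :
  (forall s, test_good s -> forall g : {linear test_dom s -> E},
    exists h : {linear test_cod s -> E}, forall a, h (test_map s a) = g a) ->
  K B -> fgraph_good f g G ->
  exists G', [/\ fgraph_good f g G', G `<=` G' & exists e, G' (b, e)].
Proof.
move=> solv KB [Gfg Glin Gfun Gpure].
have G0 : G (0, 0) by have := Gfg 0; rewrite !linear0.
have D_lin a u v : (exists e, G (u, e)) -> (exists e, G (v, e)) ->
    exists e, G (a *: u + v, e).
  by move=> [e Ge] [e' Ge']; exists (a *: e + e'); exact: (Glin a _ _ Ge Ge').
pose D : submod B := @Submod _ _ (fun v => exists e, G (v, e)) (ex_intro _ 0 G0) D_lin.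
have DP : sys_pure Sys (incL D) by apply: sys_pure_inc => m n c S a x; exact: Gpure.
have Gu v e e' : G (v, e) -> G (v, e') -> e = e'.
  move=> Ge Ge'; apply/esym/subr0_eq/Gfun.
  by have := Glin (-1) _ _ Ge Ge'; rewrite /= !scaleN1r addNr addrC.
have [hD0 hD0E] := choice (fun x : subm D => incLP x).
have hDl : linear hD0.
  move=> a u v; apply: (Gu (incL D (a *: u + v))); first exact: hD0E.
  by rewrite linearP; exact: (Glin a _ _ (hD0E u) (hD0E v)).
pose hD : {linear subm D -> E} := mklin hDl.
have hDE x : G (incL D x, hD x) by rewrite /hD (mklinE hDl); exact: hD0E.
have [X [Xb XP XD_P XaD_P [t tE]]] := lowenheim_skolem b DP.
have tX w : X (t w) by apply/tE; exists w.
have [t' t'E] := choice (fun w => incL_ex (tX w)).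
have [|Z [q [qI qS]]] := quo_free (f := t').
  move=> w; have /tE [x xw] := incLP w; exists x; apply: (@incL_inj _ _ X).
  by rewrite t'E.
pose k := compL (incL X) q.
have kI : injective k by apply: inj_comp => //; exact: incL_inj.
have kX z : X (k z) by exact: incLP.
have Xk v : X v -> exists z, k z = v.
  by move=> /incL_ex [x <-]; have [z <-] := qS x; exists z.
pose s := @Test Z (preS k D).
have [m mE] : exists m : {linear test_dom s -> subm D}, forall y, incL D (m y) = k (test_map s y).
  apply: (lin_factor_inj (g := compL k (test_map s))); first exact: incL_inj.
  by move=> y; apply: incL_ex; exact: (@incLP _ _ (preS k D) y).
have sg : test_good s.
  split; first by apply: (K_sub _ (sys_pure_iso Sys qI qS)); exact: K_sub KB XP.
  have [m' m'E] : exists m' : {linear test_dom s -> subm (capS X D)},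
      forall y, incL (capS X D) (m' y) = k (test_map s y).
    apply: (lin_factor_inj (g := compL k (test_map s))); first exact: incL_inj.
    move=> y; apply: incL_ex; split; first exact: kX.
    exact: (@incLP _ _ (preS k D) y).
  apply: (@sys_pure_cancel _ _ _ _ _ (test_map s) k).
  apply: (sys_pure_comp_ext (h := compL k (test_map s)) _ XD_P m'E); apply: sys_pure_iso.
    by move=> y y' /(congr1 (incL _)); rewrite !m'E => /kI /incL_inj.
  move=> x; have [Xx Dx] := incLP x; have [z zx] := Xk _ Xx.
  have [|y yz] := @incL_ex _ _ (preS k D) z; first by change (D (k z)); rewrite zx.
  by exists y; apply: (@incL_inj _ _ (capS X D)); rewrite m'E -zx -yz.
have [h hE] := solv s sg (compL hD m).
pose G' : set (B * E) := fun p => exists z d, p.1 = k z + incL D d /\ p.2 = h z + hD d.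
have GG' : G `<=` G'.
  move=> [v e] Gv; have [|d dv] := @incL_ex _ _ D v; first by exists e.
  exists 0, d; rewrite !linear0 !add0r dv; split=> //=.
  by apply: (Gu v) => //; rewrite -dv; exact: hDE.
exists G'; split=> //; last first.
  by have [z zb] := Xk _ Xb; exists (h z), z, 0; rewrite !linear0 !addr0 zb.
split.
- by move=> a; apply: GG'.
- move=> a [u1 u2] [v1 v2] [z [d [/= -> ->]]] [z' [d' [/= -> ->]]].
  by exists (a *: z + z'), (a *: d + d'); split=> /=; rewrite !linearP !scalerDr addrACA.
- move=> e [z [d [/= kd ->]]].
  have kz : k z = incL D (- d).
    by rewrite linearN; apply/eqP; rewrite -addr_eq0 -kd.
  have [|y yz] := @incL_ex _ _ (preS k D) z; first by change (D (k z)); rewrite kz; exact: incLP.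
  have -> : z = test_map s y by rewrite -yz.
  have my : m y = - d by apply: (@incL_inj _ _ D); rewrite mE -kz -yz.
  by rewrite hE /= my linearN addNr.
- move=> mm nn c S a x Ga Ex.
  have XDG v : addS X D v <-> exists e, G' (v, e).
    split=> [[x' [y [/Xk [z <-] /incL_ex [d <-] ->]]]|[e [z [d [/= -> _]]]]].
      by exists (h z + hD d), z, d.
    by exists (k z), (incL D d); split=> //; exact: (@incLP _ _ D d).
  have [|x' Xx' Ex'] := inc_sys_pure XaD_P S _ Ex; first by move=> i; apply/XDG.
  by exists x' => // j; apply/XDG.
Qed.

Theorem baer_criterion (E : lmodType R) : K E ->
  (forall s, test_good s -> forall g : {linear test_dom s -> E},
    exists h : {linear test_cod s -> E}, forall a, h (test_map s a) = g a) ->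
  rel_injective (sys_pure Sys) K E.
Proof.
move=> KE solv; split=> // A B f g KA KB [fI fS].
have [||G [Gg Gmax]] := @zorn_sets _ (fgraph_good f g) [set (f a, g a) | a in setT].
- split=> [a|a u v|e|m n c S a b Ga Eq].
  + by exists a.
  + by move=> [x _ <-] [y _ <-]; exists (a *: x + y) => //=; rewrite !linearP.
  + by move=> [a _ [fa <-]]; have -> : a = 0; [apply: fI; rewrite fa linear0|rewrite linear0].
  + have [|x xE] := choice (X := 'I_m) (P := fun i x => f x = a i).
      by move=> i; have [e [x _ [<- _]]] := Ga i; exists x.
    have [|b' b'E] := fS _ _ _ S x b; first by move=> i; rewrite Eq xE.
    exists (f \o b') => [j|i]; first by exists (g (b' j)), (b' j).
    by rewrite -lincomb_map b'E.
- move=> F Fne FP Ft; split=> [a|a u v [X FX Xu] [Y FY Yv]|e [X FX Xe]|m n c S a b Ga Eq].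
  + by have [X FX] := Fne; exists X => //; have [] := FP _ FX.
  + have [XY|YX] := Ft _ _ FX FY; [exists Y => //|exists X => //].
      by have [_ Yl _ _] := FP _ FY; apply: Yl => //; apply: XY.
    by have [_ Xl _ _] := FP _ FX; apply: Xl => //; apply: YX.
  + by have [_ _ X0 _] := FP _ FX; exact: X0.
  + have [e eE] := choice Ga.
    have [X FX Xa] := chain_tuple Fne Ft eE.
    have [_ _ _ Xp] := FP _ FX; have [|b' b'E b'c] := Xp _ _ _ S a b _ Eq.
      by move=> i; exists (e i).
    by exists b' => // j; have [e' Xe'] := b'E j; exists e', X.
have Gtot b : exists e, G (b, e).
  have [G' [G'g GG' [e G'b]]] := baer_step b solv KB Gg.
  by exists e; apply: (Gmax G').
have [h hE] := choice Gtot; have [Gfg Glin Gfun _] := Gg.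
have Gu v e e' : G (v, e) -> G (v, e') -> e = e'.
  move=> Ge Ge'; apply/esym/subr0_eq/Gfun.
  by have := Glin (-1) _ _ Ge Ge'; rewrite /= !scaleN1r addNr addrC.
have hl : linear h.
  move=> a u v; apply: (Gu (a *: u + v)); first exact: hE.
  exact: (Glin a _ _ (hE u) (hE v)).
exists (mklin hl) => a /=; rewrite (mklinE hl).
by apply: (Gu (f a)); [exact: hE|exact: Gfg].
Qed.
End BaerCriterion.

(** * Well-orders and recursion along them *)
Section WellOrder.
Variables (T : small) (le : rel T).
Hypothesis wo : well_order le.
Local Notation lt := (wo_lt le).

Lemma wo_min (P : T -> Prop) : (exists x, P x) ->
  exists2 m, P m & forall x, P x -> le m x.
Proof.
move=> [x Px]; have [|m [[/asboolP Pm mP] _]] := wo (A := fun x => `[< P x >]).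
  by exists x; apply/asboolP.
by exists m => // y Py; apply: mP; apply/asboolP.
Qed.

Lemma wo_min2 x y : exists2 m, m = x \/ m = y & le m x /\ le m y.
Proof.
have [|m mxy mP] := @wo_min (fun z => z = x \/ z = y); first by exists x; left.
by exists m => //; split; apply: mP; [left|right].
Qed.

Lemma wo_refl x : le x x.
Proof. by have [m [->|->] []] := wo_min2 x x. Qed.

Lemma wo_anti x y : le x y -> le y x -> x = y.
Proof.
move=> xy yx; have [|m [_ mU]] := wo (A := fun z => `[< z = x \/ z = y >]).
  by exists x; apply/asboolP; left.
rewrite -(mU x) ?(mU y) //; split; first by apply/asboolP; right.
- by move=> z /asboolP [] -> //; exact: wo_refl.
- by apply/asboolP; left.
- by move=> z /asboolP [] -> //; exact: wo_refl.
Qed.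

Lemma wo_total x y : le x y \/ le y x.
Proof. by have [m [->|->] []] := wo_min2 x y; [left|right]. Qed.

Lemma wo_trans y x z : le x y -> le y z -> le x z.
Proof.
move=> xy yz; have [|m mP mm] := @wo_min (fun w => [\/ w = x, w = y | w = z]).
  by exists x; constructor 1.
have mx := mm x (Or31 _ _ erefl); have my := mm y (Or32 _ _ erefl).
have mz := mm z (Or33 _ _ erefl); case: mP => e; subst m => //.
  by rewrite (wo_anti xy mx).
by move: xy mx; rewrite (wo_anti yz my).
Qed.

Lemma wo_leP x y : le x y <-> x = y \/ lt x y.
Proof.
split=> [xy|[->|[]//]]; last exact: wo_refl.
by have [|n] := pselect (x = y); [left|right; split].
Qed.

Lemma wo_ltNle x y : lt x y <-> ~ le y x.
Proof.
split=> [[xy le_xy] yx|nyx]; first exact/xy/wo_anti.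
split=> [e|]; first by apply: nyx; rewrite e; exact: wo_refl.
by have [//|/nyx] := wo_total x y.
Qed.

Lemma wo_lt_le_trans y x z : lt x y -> le y z -> lt x z.
Proof.
move=> /wo_ltNle nyx yz; apply/wo_ltNle => zx; apply: nyx.
exact: wo_trans yz zx.
Qed.

Lemma wo_le_lt_trans y x z : le x y -> lt y z -> lt x z.
Proof.
move=> xy /wo_ltNle nzy; apply/wo_ltNle => zx; apply: nzy.
exact: wo_trans zx xy.
Qed.

Lemma wo_lt_trans y x z : lt x y -> lt y z -> lt x z.
Proof. by move=> xy [_ yz]; exact: wo_lt_le_trans xy yz. Qed.

Lemma wo_irr x : ~ lt x x. Proof. by case. Qed.

Lemma wo_tri x y : [\/ x = y, lt x y | lt y x].
Proof.
have [/wo_leP[]|/wo_leP[]] := wo_total x y; try by constructor.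
Qed.

Lemma wo_wf : well_founded lt.
Proof.
move=> x; apply: contrapT => nx.
have [m nm mP] := wo_min (ex_intro (fun y => ~ Acc lt y) x nx).
by apply: nm; constructor => y ym; apply: contrapT => /mP my; move/wo_ltNle: ym.
Qed.

Lemma wo_ind (P : T -> Prop) :
  (forall x, (forall y, lt y x -> P y) -> P x) -> forall x, P x.
Proof. by move=> IH; apply: (well_founded_ind wo_wf). Qed.

Lemma wo_succ_ex x : (exists y, lt x y) -> exists y, wo_succ le x y.
Proof. by move=> /wo_min [m xm mP]; exists m; split. Qed.

Lemma wo_succ_le x y z : wo_succ le x y -> lt z y <-> le z x.
Proof.
move=> [xy yP]; split=> [zy|zx]; last exact: wo_le_lt_trans zx xy.
by apply: contrapT => /wo_ltNle xz; move/wo_ltNle: zy; apply; exact: yP.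
Qed.

Lemma wo_cases x : [\/ forall y, ~ lt y x, exists y, wo_succ le y x | wo_limit le x].
Proof.
have [[z zx]|no] := pselect (exists y, lt y x); last first.
  by constructor 1 => y yx; apply: no; exists y.
have [[y yS]|nS] := pselect (exists y, wo_succ le y x).
  by constructor 2; exists y.
constructor 3; split; first by exists z.
move=> y yx; apply: contrapT => nk; apply: nS; exists y; split=> // k yk.
by apply: contrapT => /wo_ltNle kx; apply: nk; exists k.
Qed.

(** Recursion on a well-order in which each value is chosen subject to a condition
    on the earlier ones. *)
Lemma recursive_choice (D : Type) (d0 : D) (Cond : T -> (T -> D) -> D -> Prop) :
  (forall i P P', (forall j, lt j i -> P j = P' j) -> forall d, Cond i P d -> Cond i P' d) ->
  exists E : T -> D, forall i, (exists d, Cond i E d) -> Cond i E (E i).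
Proof.
move=> CondP.
pose ext i (rec : forall j, lt j i -> D) j :=
  if pselect (lt j i) is left h then rec j h else d0.
pose body i rec := if pselect (exists d, Cond i (ext i rec) d) is left h
  then projT1 (cid h) else d0.
pose E := Fix wo_wf (fun _ => D) body.
have EE i : E i = body i (fun j _ => E j).
  rewrite /E Fix_eq // => x f g fg; congr body.
  by apply: functional_extensionality_dep => j; apply: functional_extensionality_dep.
exists E => i [d Cd].
have ext1 j : lt j i -> E j = ext i (fun j _ => E j) j.
  by rewrite /ext; case: pselect.
have ext2 j : lt j i -> ext i (fun j _ => E j) j = E j.
  by move=> /ext1.
apply: (CondP _ _ _ ext2); rewrite EE /body; case: pselect => [h|[]].
  by case: cid.
by exists d; apply: (CondP _ _ _ ext1).
Qed.

End WellOrder.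

Lemma dep_update (T : Type) (F : T -> Type) (f : forall t, F t) (t0 : T) (x : F t0) :
  exists g : forall t, F t, g t0 = x.
Proof.
exists (fun t => if pselect (t0 = t) is left e then ecast s (F s) e x else f t).
by case: pselect => // e; rewrite (Prop_irrelevance e erefl).
Qed.

Lemma dep_choice (I : Type) (Y : I -> Type) (P : forall i, Y i -> Prop) :
  (forall i, exists y, P i y) -> exists f : forall i, Y i, forall i, P i (f i).
Proof.
by move=> h; exists (fun i => projT1 (cid (h i))) => i; case: cid.
Qed.

(** * Towers of modules along a well-order *)
Section Colimits.
Variables (R : pzRingType) (Sys : systems R) (K : lmodType R -> Prop).
Hypotheses (K_sums : closed_direct_sums K) (K_sub : closed_submodules (sys_pure Sys) K)
  (K_epi : closed_epi_images (sys_pure Sys) K).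
Variables (J : small) (lt : J -> J -> Prop) (F : J -> lmodType R)
  (u : forall j k, {linear F j -> F k}) (j0 : J).
Hypotheses (lt_tri : forall j k, [\/ j = k, lt j k | lt k j])
  (lt_irr : forall j, ~ lt j j)
  (lt_trans : forall j k l, lt j k -> lt k l -> lt j l)
  (KF : forall j, K (F j))
  (uP : forall j k, lt j k -> sys_pure Sys (u j k))
  (uu : forall j k l, lt j k -> lt k l -> forall x, u k l (u j k x) = u j l x).

Let v k j : {linear F j -> F k} := if pselect (lt j k) then u j k else zeroL (F j) (F k).
Fact colim_s_linear k : linear (fun x => liftL (v k) x + coordL F k x).
Proof. by move=> a x y; rewrite !linearP scalerDr addrACA. Qed.
(** The map that adds up at stage [k] the components up to [k].  The component at
    [k] itself enters by its coordinate, so no identity map F k -> F j has to be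
    transported along an equality of indices. *)
Let s k : {linear direct_sum F -> F k} := mklin (colim_s_linear k).

Let s_lt j k x : lt j k -> s k (injL F j x) = u j k x.
Proof.
move=> jk; rewrite /s (mklinE (colim_s_linear k)) liftLE coord_inj_neq.
  by rewrite addr0 /v; case: pselect.
by move=> e; subst j; exact: lt_irr jk.
Qed.
Let s_eq k x : s k (injL F k x) = x.
Proof.
rewrite /s (mklinE (colim_s_linear k)) liftLE coord_inj.
have -> : v k k = zeroL _ _ by rewrite /v; case: pselect => // kk; case: (lt_irr kk).
by rewrite add0r.
Qed.

Let bd x k := forall j, coordL F j x <> 0 -> j = k \/ lt j k.
Let bd_s x k l : bd x k -> lt k l -> s l x = u k l (s k x).
Proof.
move=> xk kl; apply: (@dsum_ind _ _ _ (fun x => s l x = u k l (s k x)) x).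
- by rewrite !linear0.
- by move=> y z yE zE; rewrite !linearD yE zE.
- move=> j /xk [e|jk]; first by subst j; rewrite s_lt // s_eq.
  by rewrite (s_lt _ jk) uu // s_lt //; exact: lt_trans kl.
Qed.
Let bd_le x k l : bd x k -> lt k l -> bd x l.
Proof. by move=> xk kl j /xk [->|jk]; right=> //; exact: lt_trans kl. Qed.
Let bd_inj j x : bd (injL F j x) j.
Proof.
move=> k; have [->|jk] := pselect (k = j); first by left.
by rewrite coord_inj_neq // => e; apply: jk.
Qed.
Let bdP a x y k : bd x k -> bd y k -> bd (a *: x + y) k.
Proof.
move=> xk yk j; rewrite linearP => axy; apply: contrapT => njk.
have x0 : coordL F j x = 0 by apply: contrapT => /xk.
have y0 : coordL F j y = 0 by apply: contrapT => /yk.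
by apply: axy; rewrite x0 y0 scaler0 addr0.
Qed.
Let bd_ex x : exists k, bd x k.
Proof.
apply: (@dsum_ind _ _ _ (fun x => exists k, bd x k) x).
- by exists j0 => j; rewrite linear0.
- move=> y z [k yk] [l zl]; have [e|kl|lk] := lt_tri k l.
  + by subst l; exists k; rewrite -[y]scale1r; exact: bdP.
  + by exists l; rewrite -[y]scale1r; apply: bdP => //; exact: bd_le yk kl.
  + by exists k; rewrite -[y]scale1r; apply: bdP => //; exact: bd_le zl lk.
- by move=> j _; exists j; exact: bd_inj.
Qed.

(** The elements that vanish at some stage beyond their support: the relations of
    the direct limit. *)
Let Z0 x := exists2 k, bd x k & s k x = 0.
Let Z0_le x k l : bd x k -> s k x = 0 -> lt k l -> bd x l /\ s l x = 0.
Proof.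
by move=> xk sk kl; split; [exact: bd_le xk kl|rewrite (bd_s xk kl) sk linear0].
Qed.
Fact colim_Z0 : Z0 0.
Proof. by exists j0; [move=> j; rewrite linear0|rewrite linear0]. Qed.
Fact colim_ZP a x y : Z0 x -> Z0 y -> Z0 (a *: x + y).
Proof.
move=> [k xk sx] [l yl sy]; have [e|kl|lk] := lt_tri k l.
- by subst l; exists k; [exact: bdP|rewrite linearP sx sy scaler0 addr0].
- have [xl sxl] := Z0_le xk sx kl.
  by exists l; [exact: bdP|rewrite linearP sxl sy scaler0 addr0].
- have [yk syk] := Z0_le yl sy lk.
  by exists k; [exact: bdP|rewrite linearP sx syk scaler0 addr0].
Qed.

Lemma colimit : exists (A : lmodType R) (q : forall j, {linear F j -> A}),
  [/\ K A, forall j, sys_pure Sys (q j),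
      forall j k, lt j k -> forall x, q k (u j k x) = q j x &
      forall a, exists j x, q j x = a].
Proof.
pose Z := @Submod _ _ Z0 colim_Z0 colim_ZP.
pose q j : {linear F j -> quo Z} := compL (piL Z) (injL F j).
have qI j : injective (q j).
  apply: lin_inj => x /= /piL0 [k xk]; have [e|jk|kj] := lt_tri j k.
  - by subst k; rewrite s_eq.
  - by rewrite (s_lt _ jk) => ux; have [uI _] := uP jk; apply: uI; rewrite linear0.
  - move=> _; apply: contrapT => x0; have [|e|jk] := xk j; first by rewrite coord_inj.
      by subst k; exact: lt_irr kj.
    by apply: (@lt_irr j); exact: lt_trans jk kj.
have qu j k : lt j k -> forall x, q k (u j k x) = q j x.
  move=> jk x; apply/subr0_eq; rewrite /q /= -linearB; apply/piL0; exists k.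
    rewrite -[injL F k _]scale1r; apply: bdP; first exact: bd_inj.
    rewrite -[- _]addr0 -scaleN1r; apply: bdP; last by move=> l; rewrite linear0.
    exact: bd_le (@bd_inj _ _) jk.
  by rewrite linearB s_eq (s_lt _ jk) subrr.
have qS a : exists j x, q j x = a.
  have [x <-] := piL_surj a; have [k xk] := bd_ex x.
  exists k, (s k x); apply/subr0_eq; rewrite /q /= -linearB; apply/piL0; exists k.
    rewrite -[injL F k _]scale1r; apply: bdP; first exact: bd_inj.
    rewrite -[- _]addr0 -scaleN1r; apply: bdP => // l; by rewrite linear0.
  by rewrite linearB s_eq subrr.
have dir i j : exists k,
    (forall a, exists b, q k b = q i a) /\ (forall a, exists b, q k b = q j a).
  have [->|ij|ji] := lt_tri i j.
  - by exists j; split=> a; exists a.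
  - by exists j; split=> a; [exists (u i j a); exact: qu|exists a].
  - by exists i; split=> a; [exists a|exists (u j i a); exact: qu].
exists (quo Z), q; split=> //.
  by apply: (K_directed_union K_sums K_epi (u := q)).
move=> j; apply: (sys_pure_directed_union qI j0 dir qS) => k jk; have [e|jk'|kj] := lt_tri j k.
- by subst k; exists (idL (F j)); split=> //; exact: sys_pure_id.
- by exists (u j k); split; [exact: uP|exact: qu].
- have [||h [hK Kh]] := @lin_inverse _ _ _ (u k j).
  + by have [] := uP kj.
  + by move=> a; have [b qb] := jk a; exists b; apply: (qI j); rewrite qu.
  exists h; split; last by move=> a; rewrite -(qu _ _ kj) Kh.
  by apply: sys_pure_iso => [x y /(congr1 (u k j))|b]; [rewrite !Kh|exists (u k j b)].
Qed.
End Colimits.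

Section Tower.
Variables (R : pzRingType) (Sys : systems R) (K : lmodType R -> Prop).
Hypotheses (K_sums : closed_direct_sums K) (K_sub : closed_submodules (sys_pure Sys) K)
  (K_epi : closed_epi_images (sys_pure Sys) K).
Variables (T : small) (le : rel T).
Hypotheses (wo : well_order le).
Local Notation lt := (wo_lt le).
Variable (S0 : lmodType R) (StepRel : forall A A' : lmodType R, {linear A -> A'} -> Prop).
Hypotheses (KS0 : K S0) (step : forall A, K A ->
  exists (A' : lmodType R) (f : {linear A -> A'}), [/\ K A', sys_pure Sys f & StepRel f]).

(** The datum at stage [i] is the module N' i together with, for each earlier [j],
    a map from every module whatsoever; only the map from N' j matters.  In this
    form the type of the data does not depend on the modules built before, so
    that plain recursion applies. *)
Let Dat := {A : lmodType R & T -> forall B : lmodType R, {linear B -> A}}.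
Let obj (P : T -> Dat) j := projT1 (P j).
Let mor (P : T -> Dat) j k : {linear obj P j -> obj P k} := projT2 (P k) j (obj P j).

(** [A] is the direct limit of the earlier stages, or [S0] at the first stage, and
    [D] is obtained from it by one step. *)
Let Cond i (P : T -> Dat) (D : Dat) :=
  exists (A : lmodType R) (q : T -> forall B : lmodType R, {linear B -> A})
    (f : {linear A -> projT1 D}),
  [/\ [/\ K A, K (projT1 D), sys_pure Sys f & StepRel f],
      forall j, lt j i -> sys_pure Sys (q j (obj P j)),
      forall j k, lt j k -> lt k i -> forall x,
        q k (obj P k) (projT2 (P k) j (obj P j) x) = q j (obj P j) x,
      ((exists j, lt j i) -> forall a, exists2 j, lt j i & exists x, q j (obj P j) x = a) /\
      ((forall j, ~ lt j i) -> exists e : {linear S0 -> A},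
        injective e /\ forall a, exists x, e x = a) &
      forall j B x, projT2 D j B x = f (q j B x)].

Lemma tower_choice : exists P : T -> Dat, forall i, Cond i P (P i).
Proof.
have [|E EP] := recursive_choice wo (existT _ S0 (fun _ B => zeroL B S0) : Dat) (Cond := Cond).
  move=> i P P' PP' D [A [q [f [H1 H2 H3 [H4 H5] H6]]]]; exists A, q, f.
  split=> // [j ji|j k jk ki|].
  - by rewrite /obj -(PP' _ ji); exact: H2.
  - rewrite /obj -(PP' _ ki) -(PP' j); last exact: wo_lt_trans ki.
    exact: H3.
  - split=> // ne a; have [j ji [x xa]] := H4 ne a.
    exists j => //; rewrite /obj -(PP' _ ji); by exists x.
exists E; apply: (wo_ind wo) => i IH; apply: EP.
pose J := {j : T | lt j i}.
have uP j k : lt j k -> lt k i -> sys_pure Sys (mor E j k).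
  move=> jk ki; have [A [q [f [[_ _ fP _] qP _ _ qE]]]] := IH k ki.
  by apply: sys_pure_comp_ext (qP _ jk) fP _ => x; rewrite -qE.
have uu j k l : lt j k -> lt k l -> lt l i -> forall x, mor E k l (mor E j k x) = mor E j l x.
  move=> jk kl li x; have [A [q [f [_ _ qq _ qE]]]] := IH l li.
  by rewrite /mor !qE; congr (f _); exact: qq.
have [A [q [KA qP qq qS qz]]] : exists (A : lmodType R)
    (q : T -> forall B : lmodType R, {linear B -> A}),
  [/\ K A, forall j, lt j i -> sys_pure Sys (q j (obj E j)),
      forall j k, lt j k -> lt k i -> forall x,
        q k (obj E k) (mor E j k x) = q j (obj E j) x,
      (exists j, lt j i) -> forall a, exists2 j, lt j i & exists x, q j (obj E j) x = a &
      (forall j, ~ lt j i) -> exists e : {linear S0 -> A},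
        injective e /\ forall a, exists x, e x = a].
  have [[j0 j0i]|no] := pselect (exists j, lt j i); last first.
    exists S0, (fun _ B => zeroL B S0); split=> //.
    - by move=> j ji; case: no; exists j.
    - by move=> _; exists (idL S0); split=> // a; exists a.
  have [||||||A [q [KA qP qq qS]]] := colimit K_sums K_epi
     (J := J) (lt := fun j k => lt (sval j) (sval k)) (F := fun j => obj E (sval j))
     (u := fun j k => mor E (sval j) (sval k)) (exist _ j0 j0i).
  - move=> [j ji] [k ki] /=; have [e|jk|kj] := wo_tri wo j k.
    + by constructor 1; subst k; congr exist; apply: Prop_irrelevance.
    + by constructor 2.
    + by constructor 3.
  - by move=> [j ji] /= jj; case: (wo_irr jj).
  - by move=> [j ji] [k ki] [l li] /= jk kl; exact: wo_lt_trans jk kl.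
  - by move=> [j ji] /=; have [? [? [? [[]]]]] := IH j ji.
  - by move=> [j ji] [k ki] /= jk; exact: uP.
  - by move=> [j ji] [k ki] [l li] /= jk kl; exact: uu.
  have : forall j : T, exists h : forall B : lmodType R, {linear B -> A},
      forall ji : lt j i, h (obj E j) = q (exist _ j ji).
    move=> j; have [ji|nji] := pselect (lt j i); last by exists (fun B => zeroL B A).
    have [h hE] := dep_update (fun B : lmodType R => zeroL B A) (q (exist _ j ji)).
    by exists h => ji'; rewrite hE (Prop_irrelevance ji ji').
  move=> /choice [h hE]; exists A, h; split=> //.
  - by move=> j ji; rewrite (hE j ji); exact: (qP (exist _ j ji)).
  - move=> j k jk ki x; have ji := wo_lt_trans wo jk ki.
    by rewrite (hE k ki) (hE j ji) -(qq (exist _ j ji) (exist _ k ki)).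
  - by move=> _ a; have [[j ji] [x xa]] := qS a; exists j => //; exists x; rewrite (hE j ji).
  - by move=> no; case: (no j0).
have [A' [f [KA' fP fS]]] := step KA.
exists (existT _ A' (fun j B => compL f (q j B))), A, q, f; split=> //.
Qed.

(** At stage [i] the module [N i] is the union of the earlier stages and [N' i] is
    the result of the step; X is the union of all stages. *)
Theorem tower : inhabited T -> (forall i, exists j, lt i j) ->
  exists (X : lmodType R) (N N' : T -> lmodType R)
    (e : forall i, {linear N i -> X}) (e' : forall i, {linear N' i -> X})
    (f : forall i, {linear N i -> N' i}),
  [/\ K X,
      forall i, [/\ K (N i), K (N' i), sys_pure Sys (e i) & sys_pure Sys (e' i)],
      forall i, [/\ sys_pure Sys (f i), StepRel (f i) & forall x, e' i (f i x) = e i x],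
      forall i j, lt j i -> exists h : {linear N' j -> N i},
        sys_pure Sys h /\ forall x, e i (h x) = e' j x &
      [/\ forall i, (forall j, ~ lt j i) -> exists h : {linear S0 -> N i},
            injective h /\ forall a, exists x, h x = a,
          forall i, (exists j, lt j i) -> forall a, exists2 j, lt j i & exists x, e' j x = e i a &
          forall x, exists i a, e i a = x]].
Proof.
move=> [t0] nomax; have [P PC] := tower_choice.
have [A AP] := dep_choice PC; have [q qP] := dep_choice AP; have [f {AP}fP] := dep_choice qP.
have mf j i x : mor P j i x = f i (q i j (obj P j) x).
  by rewrite /mor; have [_ _ _ _ ->] := fP i.
have [||||||X [e' [KX e'P e'e e'S]]] := colimit K_sums K_epi
   (J := T) (lt := lt) (F := obj P) (u := mor P) t0.
- exact: wo_tri.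
- by move=> j jj; case: (wo_irr jj).
- by move=> j k l jk kl; exact: wo_lt_trans jk kl.
- by move=> j; have [[]] := fP j.
- move=> j k jk; have [[_ _ fkP _] qkP _ _ _] := fP k.
  by apply: sys_pure_comp_ext (qkP _ jk) fkP _ => x; rewrite mf.
- move=> j k l jk kl x; have [_ _ qq _ _] := fP l.
  by rewrite (mf k l) (mf j l); congr (f l _); exact: qq.
exists X, A, (obj P), (fun i => compL (e' i) (f i)), e', f; split=> //.
- by move=> i; have [[KA KA' fiP _] _ _ _ _] := fP i; split=> //; exact: sys_pure_comp.
- by move=> i; have [[KA KA' fiP fiS] _ _ _ _] := fP i; split.
- move=> i j ji; have [_ qiP _ _ _] := fP i.
  exists (q i j (obj P j)); split; first exact: qiP.
  by move=> x; rewrite /= -mf e'e.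
- split.
  + by move=> i no; have [_ _ _ [_ H] _] := fP i; exact: H.
  + move=> i ne a; have [_ _ _ [H _] _] := fP i.
    have [j ji [x xa]] := H ne a; exists j => //; exists x.
    by rewrite /= -xa -mf e'e.
  + move=> x; have [j [y <-]] := e'S x; have [i ji] := nomax j.
    by exists i, (q i j (obj P j) y); rewrite /= -mf e'e.
Qed.
End Tower.

Lemma wo_exists (T : small) : exists le : rel T, well_order le.
Proof. by have [le leW] := @well_ordering_principle {classic T}; exists le. Qed.

Lemma wo_sub (T : small) (le : rel T) (Q : T -> Prop) : well_order le ->
  well_order (fun a b : {y | Q y} => le (sval a) (sval b)).
Proof.
move=> wo A [a Aa].
have [|m [Qm Am] mP] := @wo_min _ _ wo (fun y => exists Qy : Q y, exist _ y Qy \in A).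
  by case: a Aa => y Qy Aa; exists y, Qy.
exists (exist _ m Qm); split.
  split; first by [].
  by move=> [b Qb] Ab; apply: mP; exists Qb.
move=> [b Qb] [Ab bmin]; have e : m = b.
  apply: (wo_anti wo); first by apply: mP; exists Qb.
  by apply: (bmin (exist _ m Qm)).
by subst b; congr exist; apply: Prop_irrelevance.
Qed.

(** Koenig's theorem.  Take X = (seq Th -> bool), which maps onto Th -> X, and cut
    a well-order of X at its first initial segment that maps onto X, if there is
    one.  If f : Th -> T were unbounded, then for each [a] the points up to [f a]
    miss a value [w a] in the a-th coordinate, and no point of T would map to the
    family of all [w a]. *)
Lemma wo_large_cofinality (Th : small) (t0 : Th) :
  exists (T : small) (le : rel T), [/\ well_order le, inhabited T &
    forall f : Th -> T, exists y, forall a, wo_lt le (f a) y].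
Proof.
pose X : small := seq Th -> bool.
have [le wo] := wo_exists X.
pose P x := exists g : X -> X, forall w, exists2 y, wo_lt le y x & g y = w.
have [Q [g [gS QP]]] : exists (Q : X -> Prop) (g : X -> X),
    (forall w, exists2 y, Q y & g y = w) /\ forall z, Q z -> ~ P z.
  have [/(wo_min wo)[x [g gS] xP]|nP] := pselect (exists x, P x).
    exists (fun y => wo_lt le y x), g; split=> // z /(wo_ltNle wo) zx /xP //.
  exists (fun _ => True), id; split=> [w|z _ Pz]; first by exists w.
  by apply: nP; exists z.
(* Dropping the head of sequences has two preimages at each point, so removing
   one point from a segment that maps onto X leaves one that still does. *)
pose cons1 (b : bool) (w : X) : X := fun l => if l is _ :: l' then w l' else b.
have QP' z : Q z -> ~ exists h : X -> X, forall w, exists2 y, le y z & h y = w.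
  move=> Qz [h hS]; apply: (QP _ Qz); exists (fun y l => h y (t0 :: l)) => w.
  have [y1 y1z h1] := hS (cons1 true w); have [y2 y2z h2] := hS (cons1 false w).
  have [e1|n1] := pselect (y1 = z); last first.
    by exists y1 => //; apply/funext => l; rewrite h1.
  have [e2|n2] := pselect (y2 = z); last first.
    by exists y2 => //; apply/funext => l; rewrite h2.
  by have := congr1 (fun f => f [::]) h1; rewrite e1 -e2 h2.
exists {y | Q y}, (fun a b => le (sval a) (sval b)); split.
- exact: wo_sub.
- by have [y Qy _] := gS (fun _ => true); exact: (inhabits (exist _ y Qy)).
move=> f; apply: contrapT => nb.
have : forall a, exists w : X, forall y, le y (sval (f a)) -> (fun l => g y (a :: l)) <> w.
  move=> a; apply: contrapT => nw; apply: (QP' (sval (f a)) (svalP (f a))).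
  exists (fun y l => g y (a :: l)) => w; apply: contrapT => nw'; apply: nw.
  by exists w => y yf e; apply: nw'; exists y.
move=> /choice [w wP]; pose W : X := fun l => if l is a :: l' then w a l' else true.
have [y Qy gy] := gS W; apply: nb; exists (exist _ y Qy) => a.
apply: contrapT => /(wo_ltNle (@wo_sub _ _ Q wo)) /contrapT /= yf.
by apply: (wP a y yf); rewrite gy.
Qed.

Section DirectSumMap.
Variables (R : pzRingType) (Sys : systems R) (I : small) (F G : I -> lmodType R)
  (f : forall i, {linear F i -> G i}).
Definition dsum_map : {linear direct_sum F -> direct_sum G} :=
  liftL (fun i => compL (injL G i) (f i)).
Lemma dsum_map_coord i x : coordL G i (dsum_map x) = f i (coordL F i x).
Proof.
apply: (@dsum_lin_ext _ _ _ _ (compL (coordL G i) dsum_map) (compL (f i) (coordL F i))).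
move=> j y /=; rewrite /dsum_map liftLE /=.
have [e|ij] := pselect (j = i); first by subst j; rewrite !coord_inj.
by rewrite !coord_inj_neq // linear0.
Qed.
Lemma dsum_map_pure : (forall i, sys_pure Sys (f i)) -> sys_pure Sys dsum_map.
Proof.
move=> fP; split.
  apply: lin_inj => x fx0; apply: dsum_ext => i; rewrite linear0.
  have [fI _] := fP i; apply: fI; rewrite -dsum_map_coord fx0 !linear0 //.
move=> m n c S a b E.
have sol i : exists y : 'I_n -> F i, (forall k, lincomb c y k = coordL F i (a k)) /\
    ((forall k, coordL F i (a k) = 0) -> forall j, y j = 0).
  have [a0|na0] := pselect (forall k, coordL F i (a k) = 0).
    exists (fun _ => 0); split=> // k; rewrite a0; apply: big1 => j _.
    exact: scaler0.
  have [_ fS] := fP i; have [|y yE] := fS _ _ _ S (fun k => coordL F i (a k)) (coordL G i \o b).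
    by move=> k; rewrite -lincomb_map E dsum_map_coord.
  by exists y; split=> // /na0.
have [y yP] := dep_choice sol.
have fin j : finite_set [set i | y i j != 0].
  apply: (@sub_finite_set _ _ (\bigcup_(k in [set: 'I_m]) [set i | coordL F i (a k) != 0])).
    move=> i /= /eqP yij; apply: contrapT => na; apply: yij.
    have [_ y0] := yP i; apply: y0 => k; apply: contrapT => /eqP ak; apply: na.
    by exists k.
  by apply: bigcup_finite => // k _; exact: dsum_supp.
have [z zE] := choice (fun j => dsum_mk (fin j)).
exists z => k; apply: dsum_ext => i; rewrite lincomb_map.
have [<- _] := yP i; apply: eq_lincomb => j; exact: zE.
Qed.
End DirectSumMap.

(** * Enough relative injectives *)
Section EnoughInjectives.
Variables (R : pzRingType) (Sys : systems R) (K : lmodType R -> Prop).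
Hypotheses (K_sums : closed_direct_sums K) (K_sub : closed_submodules (sys_pure Sys) K)
  (K_epi : closed_epi_images (sys_pure Sys) K).

Definition solves (A A' : lmodType R) (f : {linear A -> A'}) :=
  forall s, test_good Sys K s -> forall g : {linear test_dom s -> A},
    exists h : {linear test_cod s -> A'}, forall a, h (test_map s a) = f (g a).

(** By cofinality the image of a map from the domain of a test lies in one stage
    [N t]; the step to [N' t] extends it. *)
Lemma tower_injective (T : small) (le : rel T) (X : lmodType R) (N N' : T -> lmodType R)
    (e : forall i, {linear N i -> X}) (e' : forall i, {linear N' i -> X})
    (f : forall i, {linear N i -> N' i}) :
  (forall g : (freemod R (Theta R) : Type) -> T, exists y, forall a, wo_lt le (g a) y) ->
  K X -> (forall i, injective (e i)) -> (forall i x, e' i (f i x) = e i x) ->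
  (forall i j, wo_lt le j i -> forall x, exists y, e i y = e' j x) ->
  (forall x, exists i a, e i a = x) -> (forall i, solves (f i)) ->
  rel_injective (sys_pure Sys) K X.
Proof.
move=> cof KX eI e'f e'e eS fS; apply: (baer_criterion K_sub) => // s sg g.
have [t0 _] := cof (fun _ => projT1 (cid (eS 0))).
have [i iP] := choice eS.
have /choice[u uP] : forall v : freemod R (Theta R), exists t,
    forall a, test_map s a = piL (test_rel s) v -> exists b, e t b = g a.
  move=> v; have [[a av]|no] := pselect (exists a, test_map s a = piL (test_rel s) v).
    exists (i (g a)) => a'; rewrite -av => /incL_inj ->; exact: iP.
  by exists t0 => a av; case: no; exists a.
have [t tP] := cof u.
have [|g0 g0E] := lin_factor_inj (g := g) (eI t).
  move=> a; have [v va] := piL_surj (test_map s a); have [b <-] := uP v a (esym va).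
  by rewrite -e'f; exact: e'e.
have [h hE] := fS t s sg g0; exists (compL (e' t) h) => a /=.
by rewrite hE e'f g0E.
Qed.

(** All tests with all maps into A are solved at once by a pushout along the direct
    sum of the tests. *)
Lemma solving_extension (A : lmodType R) : K A ->
  exists (A' : lmodType R) (f : {linear A -> A'}), [/\ K A', sys_pure Sys f & solves f].
Proof.
move=> KA.
pose I : small := {s : test R & {g : test_dom s -> A | linear g /\ test_good Sys K s}}.
pose F (i : I) := test_dom (projT1 i); pose G (i : I) := test_cod (projT1 i).
pose p : {linear direct_sum F -> direct_sum G} := dsum_map (fun i : I => test_map (projT1 i)).
pose g : {linear direct_sum F -> A} := liftL (fun i : I => mklin (proj1 (svalP (projT2 i)))).
have pP : sys_pure Sys p by apply: dsum_map_pure => -[s [g' [gl []]]].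
have KG : K (direct_sum G) by apply: K_sums => -[s [g' [gl []]]].
have [P [u [v [KP uP uv _ _]]]] := pushout K_sums K_sub K_epi g KG KA pP.
exists P, u; split=> // s sg g'.
have gl : linear g' by move=> a x y; rewrite linearP.
pose i : I := existT _ s (exist _ (g' : _ -> _) (conj gl sg)).
exists (compL v (injL G i)) => a.
have := uv (injL F i a); rewrite /p /dsum_map /g !liftLE /= => ->.
by congr (u _); exact: mklinE.
Qed.

Theorem enough_injectives (A : lmodType R) : K A ->
  exists (E : lmodType R) (f : {linear A -> E}), rel_injective (sys_pure Sys) K E /\ sys_pure Sys f.
Proof.
move=> KA.
have [T [le [wo [t0] cof]]] := @wo_large_cofinality (freemod R (Theta R)) 0.
have nomax i : exists j, wo_lt le i j by have [y yP] := cof (fun _ => i); exists y; exact: yP 0.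
have [X [N [N' [e [e' [f [KX H1 H2 H3 [H4 H5 H6]]]]]]]] :=
  tower K_sums K_epi wo (StepRel := fun A A1 f => solves f) KA solving_extension (inhabits t0) nomax.
have [m _ mP] := wo_min wo (ex_intro (fun _ => True) t0 I).
have [|h [hI hS]] := H4 m; first by move=> j /(wo_ltNle wo); apply; exact: mP.
exists X, (compL (e m) h); split; last first.
  by apply: sys_pure_comp; [exact: sys_pure_iso|case: (H1 m)].
apply: (tower_injective cof KX (e := e) (e' := e') (f := f)) => //.
- by move=> i; have [_ _ []] := H1 i.
- by move=> i; have [_ _] := H2 i.
- by move=> i j ji x; have [h' [_ h'E]] := H3 i j ji; exists (h' x).
- by move=> i; have [] := H2 i.
Qed.
End EnoughInjectives.

(** * Cardinalities *)
Definition card_leq (A B : Type) := exists f : A -> B, injective f.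

Lemma card_leqP (A B : Type) : [set: A] #<= [set: B] <-> card_leq A B.
Proof.
split=> [|[f fI]].
  have [[b0 _]|nB] := pselect (exists b : B, True).
    have [/(@card_leP _ _ [set: A] [set: B])[f] |//] := boolP ([set: A] #<= [set: B]).
    move=> _; exists (fun a => val (f (exist _ a (mem_set I)))) => x y /val_inj.
    by move=> /(@inj _ _ _ f _ _ (mem_set I) (mem_set I)) [].
  move=> AB; have A0 : forall a : A, False.
    move=> a; have [/(@card_leP _ _ [set: A] [set: B])[f] |] := boolP ([set: A] #<= [set: B]).
      by apply: nB; exists (val (f (exist _ a (mem_set I)))).
    by rewrite AB.
  by exists (fun a => False_rect B (A0 a)) => a; case: (A0 a).
elim/Ppointed: B => B in f fI *.
  have A0 : [set: A] = set0 by apply/seteqP; split=> // a _; have := no (f a).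
  by rewrite A0 card_ge0.
by apply/pcard_injP; exists f => x y _ _; exact: fI.
Qed.

Lemma card_leq_refl A : card_leq A A. Proof. by exists id. Qed.
Lemma card_leq_trans B A C : card_leq A B -> card_leq B C -> card_leq A C.
Proof. by move=> [f fI] [g gI]; exists (g \o f); exact: inj_comp. Qed.
Lemma card_leq_surj A B (f : A -> B) : (forall b, exists a, f a = b) -> card_leq B A.
Proof.
move=> /choice [g gE]; exists g => x y /(congr1 f).
by rewrite !gE.
Qed.
Lemma surj_of_card_leq A B : card_leq A B -> A -> exists f : B -> A, forall a, exists b, f b = a.
Proof.
move=> [f fI] a0.
exists (fun b => if pselect (exists a, f a = b) is left h then projT1 (cid h) else a0) => a.
by exists (f a); case: pselect => [h|[]]; [case: cid => x /= /fI|exists a].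
Qed.
Lemma card_leq_mul A A' B B' : card_leq A A' -> card_leq B B' -> card_leq (A * B) (A' * B').
Proof.
move=> [f fI] [g gI]; exists (fun p => (f p.1, g p.2)) => -[a b] [a' b'] /=.
by case=> /fI -> /gI ->.
Qed.
Lemma card_leq_add A A' B B' : card_leq A A' -> card_leq B B' -> card_leq (A + B) (A' + B').
Proof.
move=> [f fI] [g gI].
exists (fun s => match s with inl a => inl (f a) | inr b => inr (g b) end).
by move=> [a|b] [a'|b'] //= [] => [/fI|/gI] ->.
Qed.

(** A maximal partial bijection exhausts one of the two sides. *)
Lemma card_leq_total A B : card_leq A B \/ card_leq B A.
Proof.
pose P (G : set (A * B)) := forall p q, G p -> G q -> (p.1 = q.1) <-> (p.2 = q.2).
have [||G [GP Gmax]] := @zorn_sets _ P set0; first by [].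
  move=> F [X0 FX0] FP Ft p q [X FX Xp] [Y FY Yq].
  have [XY|YX] := Ft _ _ FX FY.
    by apply: (FP _ FY) => //; exact: XY.
  by apply: (FP _ FX) => //; exact: YX.
have [AT|nA] := pselect (forall a, exists b, G (a, b)).
  left; have [f fE] := choice AT; exists f => x y fxy.
  by apply/(GP _ _ (fE x) (fE y)).
have [BT|nB] := pselect (forall b, exists a, G (a, b)).
  right; have [f fE] := choice BT; exists f => x y fxy.
  by apply/(GP _ _ (fE x) (fE y)).
exfalso.
have [a na] : exists a, forall b, ~ G (a, b).
  by apply: contrapT => h; apply: nA => a; apply: contrapT => na; apply: h; exists a => b Gab; apply: na; exists b.
have [b nb] : exists b, forall a, ~ G (a, b).
  by apply: contrapT => h; apply: nB => b; apply: contrapT => nb; apply: h; exists b => x Gab; apply: nb; exists x.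
apply: (na b); apply: (Gmax (G `|` [set (a, b)])).
- by move=> x; left.
- move=> [x y] [x' y'] /= [Gp|[-> ->]] [Gq|[-> ->]] //.
  + exact: (GP _ _ Gp Gq).
  + by split=> e; subst; [case: (na _ Gp)|case: (nb _ Gp)].
  + by split=> e; subst; [case: (na _ Gq)|case: (nb _ Gq)].
- by right.
Qed.

(** The square of an infinite cardinal.  A maximal injection D * D -> D with D
    infinite has a complement that embeds in D: otherwise the complement contains
    a copy of D, and D together with this copy would carry a larger injection
    which sends the new pairs into the copy. *)
Section Square.
Variable T : Type.
Hypothesis natT : card_leq nat T.

Let dom (G : set ((T * T) * T)) x := exists z, G ((x, x), z).
Let P (G : set ((T * T) * T)) :=
  [/\ forall p z z', G (p, z) -> G (p, z') -> z = z',
      forall p p' z, G (p, z) -> G (p', z) -> p = p',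
      forall x y z, G ((x, y), z) -> [/\ dom G x, dom G y & dom G z],
      forall x y, dom G x -> dom G y -> exists z, G ((x, y), z) &
      exists f : nat -> T, injective f /\ forall n, dom G (f n)].

Let square_init : exists G0, P G0.
Proof.
have [f fI] := natT; pose c (n m : nat) : T := f (pickle (n, m)).
have cI n m n' m' : c n m = c n' m' -> n = n' /\ m = m'.
  by move=> /fI /(pcan_inj pickleK) [-> ->].
pose G0 : set ((T * T) * T) := fun p => exists n m, p = ((f n, f m), c n m).
have d x : dom G0 x <-> exists n, x = f n.
  split=> [[z [n [m [-> _ _]]]]|[n ->]]; first by exists n.
  by exists (c n n), n, n.
exists G0; split.
- move=> [x y] z z' [n [m [-> -> ->]]] [n' [m' [e1 e2 ->]]].
  by rewrite (fI _ _ e1) (fI _ _ e2).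
- move=> [x y] [x' y'] z [n [m [-> -> ->]]] [n' [m' [-> -> /cI]]].
  by case=> -> ->.
- move=> x y z [n [m [-> -> ->]]]; split; apply/d; [by exists n|by exists m|].
  by exists (pickle (n, m)).
- by move=> x y /d [n ->] /d [m ->]; exists (c n m), n, m.
- by exists f; split=> // n; apply/d; exists n.
Qed.

Lemma card_square : card_leq (T * T) T.
Proof.
have [G0 PG0] := square_init.
have [||G [[Gf Gi Gd Gt [fn [fnI fnd]]] Gmax]] := @zorn_sets _ P G0; first by [].
  move=> F [X0 FX0] FP Ft.
  have big x y : dom (\bigcup_(X in F) X) x -> dom (\bigcup_(X in F) X) y ->
      exists2 X, F X & dom X x /\ dom X y.
    move=> [z [X FX Xx]] [z' [Y FY Yy]]; have [XY|YX] := Ft _ _ FX FY.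
      by exists Y => //; split; [exists z; exact: XY|exists z'].
    by exists X => //; split; [exists z|exists z'; exact: YX].
  have sub X x : F X -> dom X x -> dom (\bigcup_(X in F) X) x.
    by move=> FX [z Xz]; exists z, X.
  split.
  - move=> p z z' [X FX Xz] [Y FY Yz]; have [XY|YX] := Ft _ _ FX FY.
      by have [h _ _ _ _] := FP _ FY; apply: (h p) => //; exact: XY.
    by have [h _ _ _ _] := FP _ FX; apply: (h p) => //; exact: YX.
  - move=> p p' z [X FX Xz] [Y FY Yz]; have [XY|YX] := Ft _ _ FX FY.
      by have [_ h _ _ _] := FP _ FY; apply: (h _ _ z) => //; exact: XY.
    by have [_ h _ _ _] := FP _ FX; apply: (h _ _ z) => //; exact: YX.
  - move=> x y z [X FX Xz]; have [_ _ h _ _] := FP _ FX.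
    by have [dx dy dz] := h _ _ _ Xz; split; apply: sub FX _.
  - move=> x y dx dy; have [X FX [Xx Xy]] := big _ _ dx dy.
    by have [_ _ _ h _] := FP _ FX; have [z Xz] := h _ _ Xx Xy; exists z, X.
  - have [_ _ _ _ [f [fI fd]]] := FP _ FX0; exists f; split=> // n.
    by apply: sub FX0 _.
pose D := {x | dom G x}; pose E := {x | ~ dom G x}.
have svI (Q : T -> Prop) : injective (fun u : {x | Q x} => sval u).
  by move=> [x hx] [y hy] /= e; subst y; congr exist; apply: Prop_irrelevance.
have DD : card_leq (D * D) D.
  have h (p : D * D) : exists z : D, G ((sval p.1, sval p.2), sval z).
    have [z Gz] := Gt _ _ (svalP p.1) (svalP p.2); have [_ _ dz] := Gd _ _ _ Gz.
    by exists (exist _ z dz).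
  have [f fE] := choice h; exists f => -[a b] [a' b'] e.
  have := Gi _ _ _ (fE (a, b)); rewrite e => /(_ _ (fE (a', b'))) /= [].
  by move=> /svI -> /svI ->.
pose d n : D := exist _ (fn n) (fnd n).
have D2 : card_leq (D + D) D.
  apply: card_leq_trans DD.
  exists (fun s => match s with inl x => (d 0%N, x) | inr x => (d 1%N, x) end).
  by move=> [a|a] [b|b] // [] // => [->|/fnI|/fnI|->].
have [DE|ED] := card_leq_total D E; last first.
  have TD : card_leq T D.
    have h : card_leq T (D + E).
      exists (fun x => match pselect (dom G x) with left h => inl (exist _ x h)
        | right h => inr (exist _ x h) end).
      by move=> x y; case: pselect => hx; case: pselect => hy // [].
    by apply: card_leq_trans h _; apply: card_leq_trans D2; apply: card_leq_add => //; exact: card_leq_refl.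
  apply: card_leq_trans (card_leq_mul TD TD) _; apply: card_leq_trans DD _.
  by exists sval => -[x hx] [y hy] /= e; subst y; congr exist; apply: Prop_irrelevance.
exfalso; have [j jI] := DE.
have [k kI] : card_leq ((D + D) * (D + D)) D by apply: card_leq_trans (card_leq_mul D2 D2) DD.
pose c (s : D + D) : T := match s with inl x => sval x | inr x => sval (j x) end.
have cI : injective c.
  move=> [x|x] [y|y] /= e; [congr inl; exact: svI e| | |congr inr; exact/jI/svI/e].
    by case: (svalP (j y)); rewrite -e; exact: (svalP x).
  by case: (svalP (j x)); rewrite e; exact: (svalP y).
pose isl (s : D + D) := if s is inl _ then true else false.
have cl s : dom G (c s) <-> isl s.
  case: s => x /=; first by split=> // _; exact: (svalP x).
  by split=> // h; case: (svalP (j x)).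
pose G1 : set ((T * T) * T) := fun p => exists s t, ~~ (isl s && isl t) /\
  p = ((c s, c t), sval (j (k (s, t)))).
have GG1 : G `<=` G `|` G1 by move=> p; left.
have dG1 x : dom (G `|` G1) x <-> exists s, x = c s.
  split=> [[z [Gz|[s [t [_ [-> _ _]]]]]]|[[x' ->|x' ->]]].
  - by have [dx _ _] := Gd _ _ _ Gz; exists (inl (exist _ x dx)).
  - by exists s.
  - by have [z Gz] := svalP x'; exists z; left.
  - by exists (sval (j (k (inr x', inr x')))); right; exists (inr x'), (inr x').
have GnG1 x y z z' : G ((x, y), z) -> ~ G1 ((x, y), z').
  move=> Gz [s [t [st [ex ey _]]]]; have [dx dy _] := Gd _ _ _ Gz.
  by move: st; rewrite -(rwP negP); apply; apply/andP; split; apply/cl; rewrite -?ex -?ey.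
have PG1 : P (G `|` G1).
  split.
  - move=> [x y] z z' [Gz|G1z] [Gz'|G1z'].
    + exact: Gf Gz Gz'.
    + by case: (GnG1 _ _ _ _ Gz G1z').
    + by case: (GnG1 _ _ _ _ Gz' G1z).
    + case: G1z => s [t [_ [ex ey ->]]]; case: G1z' => s' [t' [_ [e1 e2 ->]]].
      have es : s = s' by apply: cI; rewrite -ex -e1.
      have et : t = t' by apply: cI; rewrite -ey -e2.
      by rewrite es et.
  - move=> p p' z [Gz|G1z] [Gz'|G1z'].
    + exact: Gi Gz Gz'.
    + case: G1z' => s [t [_ [_ ez]]]; case: p Gz => x y Gz.
      by have [_ _] := Gd _ _ _ Gz; rewrite ez => h; case: (svalP (j (k (s, t)))).
    + case: G1z => s [t [_ [_ ez]]]; case: p' Gz' => x y Gz.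
      by have [_ _] := Gd _ _ _ Gz; rewrite ez => h; case: (svalP (j (k (s, t)))).
    + case: G1z => s [t [_ [-> ez]]]; case: G1z' => s' [t' [_ [-> ez']]].
      by move: ez'; rewrite ez => /svI /jI /kI [-> ->].
  - move=> x y z [Gz|[s [t [_ [-> -> ->]]]]].
      have [[zx Gx] [zy Gy] [zz Gzz]] := Gd _ _ _ Gz.
      by split; [exists zx|exists zy|exists zz]; left.
    by split; apply/dG1; [exists s|exists t|exists (inr (k (s, t)))].
  - move=> x y /dG1 [s ->] /dG1 [t ->].
    have [st|st] := boolP (isl s && isl t).
      move/andP: st => [/cl ds /cl dt]; have [z Gz] := Gt _ _ ds dt.
      by exists z; left.
    by exists (sval (j (k (s, t)))); right; exists s, t.
  - by exists fn; split=> // n; have [z Gz] := fnd n; exists z; left.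
have /(Gmax _ GG1 PG1) : (G `|` G1) ((c (inr (d 0%N)), c (inr (d 0%N))),
   sval (j (k (inr (d 0%N), inr (d 0%N))))).
  by right; exists (inr (d 0%N)), (inr (d 0%N)).
by move=> /Gd [h _ _]; have /= := cl (inr (d 0%N)); case=> /(_ h).
Qed.
End Square.

Section Infinite.
Variable L : Type.
Hypothesis natL : card_leq nat L.

Lemma card_prod A B : card_leq A L -> card_leq B L -> card_leq (A * B) L.
Proof. by move=> AL BL; apply: card_leq_trans (card_leq_mul AL BL) (card_square natL). Qed.

Lemma card_sig (I : Type) (F : I -> Type) : card_leq I L -> (forall i, card_leq (F i) L) ->
  card_leq {i : I & F i} L.
Proof.
move=> IL FL; have [f fI] := dep_choice FL.
have h : card_leq {i : I & F i} (I * L).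
  exists (fun p => (projT1 p, f (projT1 p) (projT2 p))) => -[i x] [i' x'] /= [e].
  by subst i' => /fI ->.
by apply: card_leq_trans h _; apply: card_prod => //; exact: card_leq_refl.
Qed.

Lemma card_seq A : card_leq A L -> card_leq (seq A) L.
Proof.
move=> [f fI]; have [p pI] := card_square natL; have [t _] := natL.
pose g (s : seq A) := foldr (fun x acc => p (f x, acc)) (t 0%N) s.
have h : card_leq (seq A) (nat * L).
  exists (fun s => (size s, g s)); elim=> [|x s IH] [|y s'] //= [ss /pI [/fI -> gs]].
  by congr cons; apply: IH; rewrite ss gs.
by apply: card_leq_trans h _; apply: card_prod => //; exact: card_leq_refl.
Qed.

Lemma card_direct_sum (R : pzRingType) (I : small) (F : I -> lmodType R) :
  card_leq I L -> (forall i, card_leq (F i) L) -> card_leq (direct_sum F) L.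
Proof.
move=> IL FL; apply: (card_leq_trans (B := seq {i : I & F i})); last first.
  exact/card_seq/card_sig.
apply: (@card_leq_surj _ _ (fun l : seq {i : I & F i} =>
   \sum_(p <- l) injL F (projT1 p) (projT2 p))) => u.
have [s us su] := dsum_list u.
exists [seq existT _ (i : I) (coordL F i u) | i <- s].
by rewrite big_map [RHS](dsum_expand us su).
Qed.
End Infinite.

(** * Injectives, universal extensions and partial sums *)
Section Isomorphic.
Variable R : pzRingType.
Lemma iso_sym (A B : lmodType R) : isomorphic A B -> isomorphic B A.
Proof.
move=> [f [g gf fg]]; have [|h [hf fh]] := @lin_inverse _ _ _ f (can_inj gf).
  by move=> b; exists (g b).
by exists h; exists f.
Qed.
Lemma iso_trans (A B C : lmodType R) : isomorphic A B -> isomorphic B C -> isomorphic A C.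
Proof. by move=> [f fb] [g gb]; exists (compL g f); exact: bij_comp. Qed.
End Isomorphic.

Section Injective.
Variables (R : pzRingType) (Sys : systems R) (K : lmodType R -> Prop).
Hypotheses (K_sums : closed_direct_sums K) (K_sub : closed_submodules (sys_pure Sys) K)
  (K_epi : closed_epi_images (sys_pure Sys) K).
Local Notation M := (sys_pure Sys).
Local Notation inj E := (rel_injective M K E).

Lemma injective_retract (E A : lmodType R) (f : {linear A -> E}) (g : {linear E -> A}) :
  (forall x, g (f x) = x) -> inj E -> inj A.
Proof.
move=> gf [KE EP]; split; first by apply: K_sub KE (sys_pure_split Sys gf).
move=> X Y u v KX KY uM; have [h hE] := EP _ _ u (compL f v) KX KY uM.
by exists (compL g h) => x /=; have /= -> := hE x.
Qed.

Lemma injective_iso (E A : lmodType R) : isomorphic E A -> inj E -> inj A.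
Proof. by move=> /iso_sym [f [g0 gf fg]]; have [|h [hf fh]] := @lin_inverse _ _ _ f (can_inj gf);
  [by move=> b; exists (g0 b)|exact: injective_retract hf]. Qed.

Lemma injective_pair (A B : lmodType R) : inj A -> inj B -> inj (A * B)%type.
Proof.
move=> [KA AP] [KB BP]; split; first exact: K_pair K_sums K_sub _ _ KA KB.
move=> X Y u v KX KY uM.
have [h hE] := AP _ _ u (compL (fstL A B) v) KX KY uM.
have [k kE] := BP _ _ u (compL (sndL A B) v) KX KY uM.
exists (pairL h k) => x; rewrite /= pairLE.
by have /= -> := hE x; have /= -> := kE x; case: (v x).
Qed.

Lemma injective_split (E X : lmodType R) (f : {linear E -> X}) : inj E -> K X -> M f ->
  exists g : {linear X -> E}, forall x, g (f x) = x.
Proof. by move=> [KE EP] KX fM; have [g gE] := EP _ _ f (idL E) KE KX fM; exists g. Qed.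

(** The complement of a retract is a retract. *)
Lemma ker_retract (E X : lmodType R) (f : {linear E -> X}) (g : {linear X -> E}) :
  (forall x, g (f x) = x) ->
  exists p : {linear X -> subm (kerS g)},
    (forall z, p (incL _ z) = z) /\ forall x, incL _ (p x) = x - f (g x).
Proof.
move=> gf; have pl : linear (fun x => x - f (g x)).
  by move=> a x y; rewrite !linearP scalerDr addrACA.
have [|p pE] := lin_factor_inj (g := mklin pl) (@incL_inj _ _ (kerS g)).
  by move=> x; apply: incL_ex; rewrite (mklinE pl) /= linearB gf subrr.
exists p; split=> [z|x]; last by rewrite pE (mklinE pl).
apply: (@incL_inj _ _ (kerS g)); rewrite pE (mklinE pl).
by have /= -> := @incLP _ _ (kerS g) z; rewrite linear0 subr0.
Qed.

Definition size_universal (L : Type) (U : lmodType R) :=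
  forall C, K C -> card_leq C L -> exists k : {linear C -> U}, M k.

(** An extension C of A maps to A by injectivity of A and to U through C / A; the
    pair of both maps is pure by [sys_pure_pair]. *)
Lemma universal_over_injective (L : Type) (A B U : lmodType R) (f : {linear A -> B}) (c : {linear U -> B}) :
  inj A -> K B -> M (copairL f c) -> size_universal L U ->
  card_leq L A -> card_leq B L -> universal_over M K f.
Proof.
move=> [KA AP] KB fcM Uu LA BL.
have fM : M f.
  apply: (sys_pure_comp_ext _ fcM (f := inlL A U)).
    by apply: (sys_pure_split Sys (g := fstL A U)) => x; rewrite inlLE.
  by move=> x; rewrite inlLE copairLE /= linear0 addr0.
split=> //.
  apply/card_eqPle; split; apply/card_leqP; first by exists f; case: fM.
  exact: card_leq_trans BL LA.
move=> C g KC gM /card_leqP CB.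
have [h0 h0E] := AP _ _ g (idL A) KA KC gM.
have KD : K (quo (ranS g)).
  by apply: (K_quotient K_epi KC gM (@piL_surj _ _ (ranS g))) => b; exact: piL0.
have [k kM] := Uu _ KD (card_leq_trans (card_leq_surj (@piL_surj _ _ (ranS g))) (card_leq_trans CB BL)).
have pM : M (pairL h0 (compL k (piL (ranS g)))).
  apply: (sys_pure_pair (j := g)) => //.
  - by apply: sys_pure_ext (sys_pure_id Sys A) => x; have := h0E x.
  - by move=> x /piL0.
  - by move=> a; apply/piL0; exists a.
  - exact: piL_surj.
exists (compL (copairL f c) (pairL h0 (compL k (piL (ranS g))))).
split; first exact: sys_pure_comp.
move=> a /=; rewrite pairLE copairLE /=; have /= -> := h0E a.
have -> : piL (ranS g) (g a) = 0 by apply/piL0; exists a.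
by rewrite !linear0 addr0.
Qed.

(** Embed C as a summand of A * C, an extension of A. *)
Lemma size_universal_of_universal_over (L : Type) (A B : lmodType R) (f : {linear A -> B}) :
  card_leq nat L -> card_leq A L -> card_leq L A -> universal_over M K f -> size_universal L B.
Proof.
move=> natL AL LA [KA KB fM /card_eqPle [/card_leqP AB _] fU] C KC CL.
have [||h [hM _]] := fU _ (inlL A C) (K_pair K_sums K_sub KA KC).
- by apply: (sys_pure_split Sys (g := fstL A C)) => x; rewrite inlLE.
- apply/card_leqP; apply: card_leq_trans (card_prod natL AL CL) _.
  exact: card_leq_trans LA AB.
exists (compL h (inrL A C)); apply: sys_pure_comp hM.
by apply: (sys_pure_split Sys (g := sndL A C)) => x; rewrite inrLE.
Qed.

Lemma universal_over_iso (A B C : lmodType R) (f : {linear A -> B}) (g : {linear B -> C}) :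
  injective g -> (forall c, exists b, g b = c) ->
  universal_over M K f -> universal_over M K (compL g f).
Proof.
move=> gI gS [KA KB fM /card_eqPle[/card_leqP AB /card_leqP BA] fU].
have BC : card_leq B C by exists g.
have CB : card_leq C B := card_leq_surj gS.
have gM := sys_pure_iso Sys gI gS; split=> //.
- exact: (K_iso K_sub gI gS KB).
- exact: sys_pure_comp.
- by apply/card_eqPle; split; apply/card_leqP; [exact: card_leq_trans AB BC|exact: card_leq_trans CB BA].
move=> D h KD hM /card_leqP DC; have [|k [kM kE]] := fU D h KD hM.
  by apply/card_leqP; exact: card_leq_trans DC CB.
exists (compL g k); split; first exact: sys_pure_comp.
by move=> x /=; have /= -> := kE x.
Qed.

(** The partial sums of V + B_0 + B_1 + ... along a well-order.  The summand V
    gives each partial sum, even the empty one, size L. *)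
Section PartialSums.
Variables (L : small) (T : small) (le : rel T) (V : lmodType R) (B : T -> lmodType R).
Hypotheses (natL : card_leq nat L) (wo : well_order le) (TL : card_leq T L)
  (KV : K V) (VL : card_leq V L) (LV : card_leq L V) (Vu : size_universal L V)
  (KB : forall a, K (B a)) (BL : forall a, card_leq (B a) L)
  (BV : forall a, exists (c : {linear V -> B a}) (d : {linear B a -> V}), forall x, d (c x) = x).
Local Notation lt := (wo_lt le).

Definition psum : lmodType R := (V * direct_sum B)%type.
Implicit Types D E : T -> Prop.

Fact psub_P D a u v : (forall t, coordL B t (sndL V _ u) <> 0 -> D t) ->
  (forall t, coordL B t (sndL V _ v) <> 0 -> D t) ->
  forall t, coordL B t (sndL V _ (a *: u + v)) <> 0 -> D t.
Proof.
move=> uD vD t; rewrite !linearP => uv; apply: contrapT => nD; apply: uv.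
have -> : coordL B t (sndL V _ u) = 0 by apply: contrapT => /uD.
have -> : coordL B t (sndL V _ v) = 0 by apply: contrapT => /vD.
by rewrite scaler0 addr0.
Qed.
Fact psub_0 D : forall t, coordL B t (sndL V _ (0 : psum)) <> 0 -> D t.
Proof. by move=> t; rewrite !linear0. Qed.
Definition psub D : submod psum := Submod (@psub_0 D) (@psub_P D).

Lemma psub_proj D : exists p : {linear psum -> subm (psub D)},
  [/\ forall z, p (incL _ z) = z, forall x, (incL _ (p x)).1 = x.1 &
   forall x t, D t -> coordL B t (incL _ (p x)).2 = coordL B t x.2].
Proof.
pose m t : {linear B t -> B t} := if pselect (D t) then idL (B t) else zeroL (B t) (B t).
have mD t : D t -> forall x, m t x = x by rewrite /m; case: pselect.
have mN t : ~ D t -> forall x, m t x = 0 by rewrite /m; case: pselect.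
pose r : {linear psum -> psum} :=
  pairL (fstL V (direct_sum B)) (compL (dsum_map m) (sndL V (direct_sum B))).
have rE x : r x = (x.1, dsum_map m x.2) by rewrite /r pairLE.
have [|p pE] := lin_factor_inj (g := r) (@incL_inj _ _ (psub D)).
  move=> x; apply: incL_ex => t; rewrite rE /= dsum_map_coord => mt.
  by apply: contrapT => /mN /(_ (coordL B t x.2)).
exists p; split=> [z|x|x t Dt]; [|by rewrite pE rE|by rewrite pE rE /= dsum_map_coord mD].
apply: (@incL_inj _ _ (psub D)); rewrite pE rE.
have := @incLP _ _ (psub D) z; case: (incL _ z) => v w /= wD.
congr pair; apply: dsum_ext => t; rewrite dsum_map_coord.
have [Dt|nD] := pselect (D t); first by rewrite mD.
by rewrite mN //; apply/esym; apply: contrapT => /wD.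
Qed.

Lemma K_psum : K psum.
Proof. by apply: (K_pair K_sums K_sub) => //; exact: K_sums. Qed.
Lemma K_psub D : K (subm (psub D)).
Proof. by have [p [pK _ _]] := psub_proj D; apply: K_sub K_psum (sys_pure_split Sys pK). Qed.
Lemma psub_le D : card_leq (subm (psub D)) L.
Proof.
apply: (card_leq_trans (B := psum)); first by exists (incL _); exact: incL_inj.
by apply: card_prod => //; apply: card_direct_sum.
Qed.
Lemma psub_ge D : card_leq L (subm (psub D)).
Proof.
apply: card_leq_trans LV _.
have h (v : V) : psub D (inlL V (direct_sum B) v) by move=> t; rewrite inlLE /= linear0.
have [f fE] := choice (fun v => incL_ex (h v)); exists f => x y /(congr1 (incL _)).
by rewrite !fE !inlLE => -[].
Qed.

Lemma psub_inc D E : (forall t, D t -> E t) ->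
  exists h : {linear subm (psub D) -> subm (psub E)},
    M h /\ forall x, incL _ (h x) = incL _ x.
Proof.
move=> DE; have [|h hE] := @sub_factor _ _ (psub D) (psub E).
  by move=> v vD t /vD /DE.
have [p [pK _ _]] := psub_proj D; exists h; split=> //.
by apply: (sys_pure_split Sys (g := compL p (incL (psub E)))) => x /=; rewrite hE.
Qed.

Lemma psub_universal D E t0 : inj (subm (psub D)) -> (forall t, D t -> E t) ->
  ~ D t0 -> E t0 ->
  exists h : {linear subm (psub D) -> subm (psub E)},
    universal_over M K h /\ forall x, incL _ (h x) = incL _ x.
Proof.
move=> Dinj DE nD Et; have [h [hM hE]] := psub_inc DE; exists h; split=> //.
have [c [d dc]] := BV t0.
have [|k kE] := lin_factor_inj (g := compL (inrL V (direct_sum B)) (compL (injL B t0) c))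
   (@incL_inj _ _ (psub E)).
  move=> v; apply: incL_ex => t /=; rewrite inrLE /= => ct.
  have [<- //|ne] := pselect (t0 = t).
  by case: ct; apply: coord_inj_neq.
apply: (universal_over_injective (c := k) Dinj (K_psub E) _ Vu (psub_ge D) (psub_le E)).
have [p [pK p1 p2]] := psub_proj D.
have k2 v t : coordL B t (incL _ (k v)).2 = coordL B t (injL B t0 (c v)).
  by rewrite kE /= inrLE.
have p0 v : p (incL _ (k v)) = 0.
  apply: (@incL_inj _ _ (psub D)); rewrite linear0.
  have := p1 (incL _ (k v)); rewrite kE /= inrLE /=.
  have := p2 (inrL V (direct_sum B) (injL B t0 (c v))); rewrite inrLE /=.
  have := @incLP _ _ (psub D) (p (0, injL B t0 (c v))).
  case: (incL _ (p _)) => u w /= wD w2 ->; congr pair; apply: dsum_ext => t.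
  rewrite linear0; apply: contrapT => wt; apply: (wt); rewrite w2; last exact: wD.
  by apply: coord_inj_neq => e; apply: nD; rewrite e; exact: wD.
pose r : {linear subm (psub E) -> (subm (psub D) * V)%type} :=
  pairL (compL p (incL _)) (compL d (compL (coordL B t0) (compL (sndL V (direct_sum B)) (incL _)))).
apply: (sys_pure_split Sys (g := r)) => -[x v]; rewrite copairLE /= /r pairLE /=.
rewrite (linearD (incL (psub E))) hE (linearD p) pK p0 addr0; congr pair.
rewrite -[(_ + _).2]/((incL (psub D) x).2 + (incL (psub E) (k v)).2).
rewrite (linearD (coordL B t0)) k2 coord_inj (linearD d) dc.
have -> : coordL B t0 (incL _ x).2 = 0 by apply: contrapT => /(@incLP _ _ (psub D) x t0).
by rewrite linear0 add0r.
Qed.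

(** D is a limit segment.  Each summand [B a] contains a copy of the universal
    module V, so each step is universal once the smaller partial sum is injective;
    continuity holds because supports are finite. *)
Lemma psub_limit_model (D : T -> Prop) : (exists a, D a) ->
  (forall a b, D b -> lt a b -> D a) -> (forall a, D a -> exists2 b, D b & lt a b) ->
  (forall a, D a -> inj (subm (psub (fun t => lt t a)))) ->
  limit_model M K L (subm (psub D)).
Proof.
move=> [a0 Da0] Ddown Dlim Dinj; split; first exact/card_leqP.
pose S : small := {a | D a}; pose les : rel S := fun a b => le (sval a) (sval b).
have wos : well_order les by exact: wo_sub.
have lts (a b : S) : wo_lt les a b <-> lt (sval a) (sval b).
  split=> [/(wo_ltNle wos) h|/(wo_ltNle wo) h]; first exact/(wo_ltNle wo).
  exact/(wo_ltNle wos).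
have bound (D' : T -> Prop) x : (exists a, D' a) -> psub D' x ->
    exists2 a, D' a & forall t, coordL B t x.2 <> 0 -> le t a.
  move=> [b Db] xD; have [s us su] := dsum_list x.2.
  have : exists2 a, D' a & forall t, t \in s -> coordL B t x.2 <> 0 -> le t a.
    elim: s {us su} => [|t s [a Da IH]]; first by exists b.
    have [xt|xt] := pselect (coordL B t x.2 = 0).
      by exists a => // t'; rewrite inE => /orP[/eqP ->|/IH].
    have [ta|at_] := wo_total wo t a.
      by exists a => // t'; rewrite inE => /orP[/eqP -> //|/IH].
    exists t; first exact: xD.
    move=> t'; rewrite inE => /orP[/eqP -> _|t's xt']; first exact: wo_refl.
    by apply: wo_trans at_ => //; exact: IH.
  by move=> [a Da aP]; exists a => // t xt; apply: aP => //; exact: su.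
exists S, les; split.
- split=> //; first by exists; exists a0.
  by move=> [a Da]; have [b Db ab] := Dlim a Da; exists (exist _ b Db); apply/lts.
- by apply/card_leqP; apply: card_leq_trans TL; exists sval => -[a Da] [b Db] /= e; subst b; congr exist; apply: Prop_irrelevance.
pose N (a : S) : lmodType R := subm (psub (fun t => lt t (sval a))).
have [e eE] : exists e : forall a : S, {linear N a -> subm (psub D)},
    forall a, M (e a) /\ forall x, incL _ (e a x) = incL _ x.
  apply: (dep_choice (P := fun a (f : {linear N a -> subm (psub D)}) =>
    M f /\ forall x, incL _ (f x) = incL _ x)) => -[a Da].
  by apply: psub_inc => t ta; exact: Ddown ta.
have eran (a : S) x : range (e a) x <-> forall t, coordL B t (incL _ x).2 <> 0 -> lt t (sval a).
  split=> [[y _ <-] t|xa]; first by have [_ ->] := eE a; exact: (@incLP _ _ (psub _) y).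
  have [|y yx] := @incL_ex _ _ (psub (fun t => lt t (sval a))) (incL _ x); first exact: xa.
  by exists y => //; apply: (@incL_inj _ _ (psub D)); have [_ ->] := eE a.
exists N, e; split.
- move=> a; split; [exact: K_psub| |by have [[]] := eE a].
  by apply/card_eqPle; split; apply/card_leqP; [exact: psub_le|exact: psub_ge].
- move=> a b ab; have [|h [hM hE]] := @psub_inc (fun t => lt t (sval a)) (fun t => lt t (sval b)).
    by move=> t ta; exact: wo_lt_le_trans ta ab.
  exists h; split=> // x; apply: (@incL_inj _ _ (psub D)) => /=.
  by have [_ ->] := eE b; have [_ ->] := eE a.
- move=> b [[a /lts ab] bl]; apply/seteqP; split=> [x /eran xb|x [c /lts cb /eran xc]].
    have [|c cb xc] := bound (fun t => lt t (sval b)) (incL _ x) _ xb; first by exists (sval a).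
    have [|d /lts cd db] := bl (exist _ c (Ddown _ _ (svalP b) cb)); first exact/lts.
    exists d => //; apply/eran => t /xc tc; exact: wo_le_lt_trans tc cd.
  by apply/eran => t /xc tc; exact: wo_lt_trans tc cb.
- move=> a b [/lts ab _].
  have [||||h [hU hE]] := @psub_universal (fun t => lt t (sval a)) (fun t => lt t (sval b)) (sval a).
  + exact: Dinj (svalP a).
  + by move=> t ta; exact: wo_lt_trans ta ab.
  + exact: wo_irr.
  + exact: ab.
  exists h; split=> // x; apply: (@incL_inj _ _ (psub D)) => /=.
  by have [_ ->] := eE b; have [_ ->] := eE a.
- apply/seteqP; split=> // x _.
  have [|a Da xa] := bound D (incL _ x) _ (@incLP _ _ _ x); first by exists a0.
  have [b Db ab] := Dlim a Da; exists (exist _ b Db) => //; apply/eran => t /xa ta.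
  exact: wo_le_lt_trans ta ab.
Qed.
End PartialSums.
End Injective.

(** * Superstability implies that sums of injectives are injective *)
Section SuperstableNoetherian.
Variables (R : pzRingType) (Sys : systems R) (K : lmodType R -> Prop).
Hypotheses (K_sums : closed_direct_sums K) (K_sub : closed_submodules (sys_pure Sys) K)
  (K_epi : closed_epi_images (sys_pure Sys) K).
Local Notation M := (sys_pure Sys).
Local Notation inj E := (rel_injective M K E).

Lemma card_eq_leq (A B : Type) : [set: A] #= [set: B] <-> card_leq A B /\ card_leq B A.
Proof.
by split=> [/card_eqPle[/card_leqP ? /card_leqP ?]|[? ?]]; [split|apply/card_eqPle; split; apply/card_leqP].
Qed.

(** Take three consecutive members C0, C1, C2 of the chain.  N embeds in C1, which is
    universal for its size; C2 is universal over N because an extension D of N can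
    be amalgamated with C1 over N and then embedded in C2 over C1. *)
Lemma universal_extension (L : small) (X N : lmodType R) : card_leq nat L ->
  limit_model M K L X -> K N -> card_leq N L -> card_leq L N ->
  exists (N' : lmodType R) (f : {linear N -> N'}), universal_over M K f.
Proof.
move=> natL [_ [al [le [[wo [i0] nomax] _ [C [e [CK _ _ Csucc _]]]]]]] KN NL LN.
have [i1 s1] := wo_succ_ex wo (nomax i0).
have [i2 s2] := wo_succ_ex wo (nomax i1).
have [f1 [f1U _]] := Csucc _ _ s1; have [f2 [f2U _]] := Csucc _ _ s2.
have sz i : card_leq (C i) L /\ card_leq L (C i) by have [_ /card_eq_leq] := CK i.
have [k kM] := size_universal_of_universal_over K_sums K_sub natL (sz i0).1 (sz i0).2 f1U KN NL.
have [KC1 KC2 f2M _ f2P] := f2U.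
exists (C i2), (compL f2 k); split=> //.
- exact: sys_pure_comp.
- by apply/card_eq_leq; split; [apply: card_leq_trans NL (sz i2).2|apply: card_leq_trans (sz i2).1 LN].
move=> D g KD gM /card_leqP DC.
have [Q [u [v [KQ uM uv Qs vM]]]] := pushout K_sums K_sub K_epi k KD KC1 gM.
have [|h [hM hE]] := f2P Q u KQ uM.
  apply/card_leqP; apply: card_leq_trans (sz i2).2.
  apply: (card_leq_trans (B := (C i1 * D)%type)).
    apply: (@card_leq_surj _ _ (fun p : C i1 * D => u p.1 + v p.2)) => q.
    by have [a [b ->]] := Qs q; exists (a, b).
  by apply: card_prod => //; [exact: (sz i1).1|exact: card_leq_trans DC (sz i2).1].
exists (compL h v); split; first by apply: sys_pure_comp hM; exact: vM.
by move=> x /=; rewrite uv; have /= -> := hE (k x).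
Qed.

(** Iterate universal extensions along a well-order of large cofinality. *)
Lemma injective_limit_model (L : small) (X0 N0 : lmodType R) (T : small) (le : rel T) (t0 : T) :
  card_leq nat L -> card_leq (freemod R (Theta R)) L -> card_leq T L -> well_order le ->
  (forall g : (freemod R (Theta R) : Type) -> T, exists y, forall a, wo_lt le (g a) y) ->
  limit_model M K L X0 -> K N0 -> card_leq N0 L -> card_leq L N0 ->
  exists V, [/\ limit_model M K L V, inj V & size_universal Sys K L V].
Proof.
move=> natL ThL TL wo cof X0lim KN0 N0L LN0.
have nomax i : exists j, wo_lt le i j by have [y yP] := cof (fun _ => i); exists y; exact: yP 0.
(* The step constrains modules of size L only; at every stage the size is L by
   induction. *)
pose SR (A A' : lmodType R) (f : {linear A -> A'}) :=
  card_leq A L -> card_leq L A -> universal_over M K f.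
have step A : K A -> exists (A' : lmodType R) (f : {linear A -> A'}), [/\ K A', M f & SR _ _ f].
  move=> KA; have [[AL LA]|no] := pselect (card_leq A L /\ card_leq L A).
    have [A' [f fU]] := universal_extension natL X0lim KA AL LA.
    by exists A', f; case: (fU).
  exists A, (idL A); split=> //; first exact: sys_pure_id.
  by move=> AL LA; case: no.
have [X [N [N' [e [e' [f [KX H1 H2 H3 [H4 H5 H6]]]]]]]] :=
  tower K_sums K_epi wo (StepRel := SR) KN0 step (inhabits t0) nomax.
have sz : forall i, card_leq (N i) L /\ card_leq L (N i).
  apply: (wo_ind wo) => i IH; have [[j0 ji0]|no] := pselect (exists j, wo_lt le j i); last first.
    have [|h [hI hS]] := H4 i; first by move=> j ji; apply: no; exists j.
    by split; [apply: card_leq_trans (card_leq_surj hS) N0L|apply: card_leq_trans LN0 _; exists h].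
  have sz' j : wo_lt le j i -> card_leq (N' j) L /\ card_leq L (N' j).
    move=> ji; have [NL LN] := IH j ji; have [_ fS _] := H2 j.
    have [_ _ _ /card_eq_leq [NN' N'N] _] := fS NL LN.
    by split; [apply: card_leq_trans N'N NL|apply: card_leq_trans LN NN'].
  split; last first.
    have [h [[hI _] _]] := H3 i j0 ji0.
    by apply: card_leq_trans (sz' _ ji0).2 _; exists h.
  have /choice[g gE] : forall a : N i, exists p : {j : {j | wo_lt le j i} & N' (sval j)},
      e' _ (projT2 p) = e i a.
    move=> a.
    have [j ji [x xa]] := H5 i (ex_intro _ j0 ji0) a.
    by exists (existT _ (exist _ j ji) x).
  apply: (card_leq_trans (B := {j : {j | wo_lt le j i} & N' (sval j)})).
    exists g => a b gab; have [_ _ [eI _] _] := H1 i; apply: eI.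
    by rewrite -!gE gab.
  apply: (card_sig natL) => [|[j ji]]; last exact: (sz' j ji).1.
  apply: card_leq_trans TL; exists sval => -[a Da] [b Db] /= E; subst b.
  by congr exist; apply: Prop_irrelevance.
have fU i : universal_over M K (f i) by have [_ fS _] := H2 i; apply: fS; have [] := sz i.
have e'f i x : e' i (f i x) = e i x by have [_ _ ->] := H2 i.
have eI i : injective (e i) by have [_ _ [] ] := H1 i.
have e'e i j : wo_lt le j i -> forall x, exists y, e i y = e' j x.
  by move=> ji x; have [h [_ hE]] := H3 i j ji; exists (h x).
exists X; split.
- split; first exact/card_leqP.
  exists T, le; split; [by split|exact/card_leqP|].
  exists N, e; split.
  + by move=> i; split; [have [] := H1 i|apply/card_eq_leq|exact: eI].
  + move=> i j /(wo_leP wo) [<-|ij]; first by exists (idL (N i)); split=> //; exact: sys_pure_id.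
    have [h [hM hE]] := H3 j i ij; exists (compL h (f i)); split.
      by apply: sys_pure_comp hM; have [] := H2 i.
    by move=> x /=; rewrite hE.
  + move=> j [[i0 ij0] jl]; apply/seteqP; split=> x.
      move=> [a _ <-]; have [i ij [y <-]] := H5 j (ex_intro _ i0 ij0) a.
      have [k ik kj] := jl i ij; have [b <-] := e'e _ _ ik y.
      by exists k => //; exists b.
    move=> [i ij [a _ <-]]; rewrite -e'f; have [b <-] := e'e _ _ ij (f i a).
    by exists b.
  + move=> i j ij; have [h [[hI _] hE]] := H3 j i ij.1; exists (compL h (f i)).
    split; last by move=> x /=; rewrite hE.
    apply: universal_over_iso => // a.
    have [k kj [x xa]] := H5 j (ex_intro _ i ij.1) a.
    have /(wo_succ_le wo _ ij) /(wo_leP wo) [ki|ki] := kj.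
      by subst k; exists x; apply: (eI j); rewrite hE.
    have [y yx] := e'e _ _ ki x; exists (f i y); apply: (eI j).
    by rewrite hE e'f yx.
  + apply/seteqP; split=> // x _; have [i [a <-]] := H6 x.
    by exists i => //; exists a.
- apply: (tower_injective K_sub cof KX eI e'f e'e H6) => // i s [KB sM] g.
  have [KN _ _ _] := H1 i.
  have [P [u [v [KP uM uv Ps _]]]] := pushout K_sums K_sub K_epi g KB KN sM.
  have [_ _ _ /card_eq_leq [NN' _] fP] := fU i.
  have [|h [hM hE]] := fP P u KP uM.
    apply/card_leqP; apply: card_leq_trans NN'; apply: card_leq_trans (sz i).2.
    apply: (card_leq_trans (B := (N i * test_cod s)%type)).
      apply: (@card_leq_surj _ _ (fun p : N i * test_cod s => u p.1 + v p.2)) => q.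
      by have [a [b ->]] := Ps q; exists (a, b).
    apply: card_prod => //; first exact: (sz i).1.
    exact: card_leq_trans (card_leq_surj (@piL_surj _ _ (test_rel s))) ThL.
  by exists (compL h v) => a /=; rewrite uv; have /= -> := hE (g a).
- move=> C KC CL.
  have [k kM] := size_universal_of_universal_over K_sums K_sub natL (sz t0).1 (sz t0).2 (fU t0) KC CL.
  by exists (compL (e' t0) k); apply: sys_pure_comp kM _; have [] := H1 t0.
Qed.

(** Otherwise A would map onto B, and the values of such a map are unbounded. *)
Lemma card_leq_cofinal (A B : small) (b0 : A) (f : A -> B) (le : rel B) : well_order le ->
  (forall g : A -> B, exists y, forall a, wo_lt le (g a) y) -> card_leq A B.
Proof.
move=> wo cof; have [//|BA] := card_leq_total A B.
have [g gS] := surj_of_card_leq BA (f b0); have [y yP] := cof g.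
by have [a ay] := gS y; have := yP a; rewrite ay => yy; case: (wo_irr yy).
Qed.

Lemma dep_family (S P : Type) (F : P -> Type) (key : S -> P) (d : forall p, F p)
    (f : forall s, F (key s)) : injective key ->
  exists h : forall p, F p, forall s, h (key s) = f s.
Proof.
move=> keyI; suff h p : exists y : F p, forall s (e : key s = p), y = ecast q (F q) e (f s).
  have [h' hE] := dep_choice h; exists h' => s; exact: (hE (key s) s erefl).
have [[s e]|no] := pselect (exists s, key s = p); last first.
  by exists (d p) => s e; case: no; exists s.
exists (ecast q (F q) e (f s)) => s' e'.
have es : s' = s by apply: keyI; rewrite e e'.
by subst s'; rewrite (Prop_irrelevance e e').
Qed.

Lemma limit_model_size (L : small) (X : lmodType R) : limit_model M K L X ->
  card_leq X L /\ card_leq L X.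
Proof.
move=> [/card_leqP natL [al [le [[wo [i0] _] /card_leqP alL [N [e [NK _ _ _ Xe]]]]]]].
have sz i : card_leq (N i) L /\ card_leq L (N i) by have [_ /card_eq_leq] := NK i.
split; last first.
  by apply: card_leq_trans (sz i0).2 _; exists (e i0); have [] := NK i0.
have /choice[g gE] : forall x, exists p : {i : al & N i}, e _ (projT2 p) = x.
  move=> x; have : [set: X] x by []; rewrite Xe => -[i _ [a _ <-]].
  by exists (existT _ i a).
apply: (card_leq_trans (B := {i : al & N i})); first by exists g => x y /(congr1 (fun p => e _ (projT2 p))); rewrite !gE.
by apply: (card_sig natL) => // i; exact: (sz i).1.
Qed.

Theorem superstable_noetherian : superstable M K -> noetherian M K.
Proof.
move=> [mu [_ muP]] I F Finj.
(* The second summand makes the order so long that I embeds in it. *)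
pose Th : small := (freemod R (Theta R) + I)%type.
have [T [le [wo [t0] cof]]] := @wo_large_cofinality Th (inl 0).
have cofL (g : (freemod R (Theta R) : Type) -> T) : exists y, forall a, wo_lt le (g a) y.
  have [y yP] := cof (fun s : Th => if s is inl v then g v else t0).
  by exists y => a; exact: (yP (inl a)).
have [iota iotaI] : card_leq I T.
  apply: (card_leq_trans (B := Th)); first by exists inr => x y [].
  exact: card_leq_cofinal (inl 0 : Th) (fun _ => t0) le wo cof.
(* L bounds everything in sight, and is large enough for uniqueness of the limit
   models. *)
pose L : small := (mu + (T + (freemod R (Theta R) + ({i : I & F i} + nat))))%type.
have muL : card_leq mu L by exists inl => x y [].
have TL : card_leq T L by exists (fun x => inr (inl x)) => x y [].
have ThL : card_leq (freemod R (Theta R)) L by exists (fun x => inr (inr (inl x))) => x y [].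
have natL : card_leq nat L by exists (fun x => inr (inr (inr (inr x)))) => x y [].
have FL i : card_leq (F i) L.
  apply: (card_leq_trans (B := {i : I & F i})); first exists (existT _ i).
    by move=> x y /(congr1 (fun p : {i : I & F i} => @delta R I F (projT1 p) (projT2 p) i)); rewrite /= !delta_eq.
  by exists (fun x => inr (inr (inr (inl x)))) => x y [].
have [[X0 X0lim] Xiso] := muP L (proj2 (card_leqP _ _) muL).
have [N0 [KN0 N0L LN0]] : exists N0, [/\ K N0, card_leq N0 L & card_leq L N0].
  have [_ [al [le' [[_ [i0] _] _ [N [e [NK _ _ _ _]]]]]]] := X0lim.
  by have [KN /card_eq_leq [? ?] _] := NK i0; exists (N i0).
have [V [Vlim Vinj Vu]] := injective_limit_model t0 natL ThL TL wo cofL X0lim KN0 N0L LN0.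
have lim_inj X : limit_model M K L X -> inj X.
  by move=> Xlim; apply: injective_iso Vinj => //; exact: Xiso.
have [VL LV] := limit_model_size Vlim.
have [r rE] : exists r : T -> option I, forall i, r (iota i) = Some i.
  by apply: (dep_family (F := fun _ => option I) (fun _ => None) Some iotaI).
have [B [Binj BL BV Bs]] : exists B : T -> lmodType R, [/\ forall a, inj (B a),
    forall a, card_leq (B a) L,
    forall a, exists (c : {linear V -> B a}) (d : {linear B a -> V}), forall x, d (c x) = x &
    forall a i, exists (s : {linear F i -> B a}) (p : {linear B a -> F i}),
      r a = Some i -> forall x, p (s x) = x].
  (* Positions outside the image of I are filled with V, which is injective. *)
  pose G o : lmodType R := if o is Some i then F i else V.
  exists (fun a => (G (r a) * V)%type); split=> a.
  - by apply: (injective_pair K_sums K_sub) => //; case: (r a).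
  - by apply: card_prod => //; case: (r a).
  - exists (inrL (G (r a)) V), (sndL (G (r a)) V) => x.
    by rewrite inrLE.
  - move=> i; case: (r a) => [j|]; last first.
      by exists (zeroL _ _), (zeroL _ _).
    have [e|ne] := pselect (j = i); last first.
      by exists (zeroL _ _), (zeroL _ _) => -[/ne].
    subst j; exists (inlL (F i) V), (fstL (F i) V) => _ x.
    by rewrite inlLE.
have KB a : K (B a) by have [] := Binj a.
have KV : K V by case: Vinj.
pose Q := psum V B.
pose N a := subm (psub V B (fun t => wo_lt le t a)).
have nomax i : exists j, wo_lt le i j.
  by have [y yP] := cof (fun _ => i); exists y; exact: yP (inl 0).
have limD := psub_limit_model K_sums K_sub K_epi natL wo TL KV VL LV Vu KB BL BV.
have Ninj : forall a, inj (N a).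
  apply: (wo_ind wo) => a IH; have [amin|[b ba]|alim] := wo_cases wo a.
  - have [|g gE] := lin_factor_inj (g := inlL V (direct_sum B))
      (@incL_inj _ _ (psub V B (fun t => wo_lt le t a))).
      by move=> v; apply: incL_ex => t; rewrite inlLE /= linear0.
    apply: (injective_retract K_sub (f := compL (fstL V (direct_sum B)) (incL _)) (g := g)) Vinj => x.
    apply: (@incL_inj _ _ (psub V B (fun t => wo_lt le t a))); rewrite gE inlLE /=.
    have := @incLP _ _ (psub V B (fun t => wo_lt le t a)) x.
    case: (incL _ x) => v w /= wD; congr pair; apply: dsum_ext => t.
    by rewrite linear0; apply/esym; apply: contrapT => /wD /amin.
  - have [p [pK p1 p2]] := psub_proj V B (fun t => wo_lt le t b).
    have [|h [_ hE]] := psub_inc Sys V B (D := fun t => wo_lt le t b) (E := fun t => wo_lt le t a).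
      by move=> t tb; exact: wo_lt_trans tb ba.1.
    have [|k kE] := lin_factor_inj (g := compL (inrL V (direct_sum B)) (injL B b))
      (@incL_inj _ _ (psub V B (fun t => wo_lt le t a))).
      move=> v; apply: incL_ex => t /=; rewrite inrLE /= => vt.
      have [<-|bt] := pselect (b = t); first by case: ba.
      by case: vt; apply: coord_inj_neq.
    apply: (injective_retract K_sub (E := (N b * B b)%type)
      (f := pairL (compL p (incL _)) (compL (coordL B b) (compL (sndL V (direct_sum B)) (incL _))))
      (g := copairL h k)); last first.
      by apply: (injective_pair K_sums K_sub) => //; apply: IH; case: ba.
    move=> x; apply: (@incL_inj _ _ (psub V B (fun t => wo_lt le t a))).
    rewrite pairLE copairLE /= (linearD (incL (psub V B (fun t => wo_lt le t a)))) hE kE /= inrLE.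
    have := @incLP _ _ (psub V B (fun t => wo_lt le t a)) x.
    have := p1 (incL _ x); have := p2 (incL _ x).
    have := @incLP _ _ (psub V B (fun t => wo_lt le t b)) (p (incL _ x)).
    case: (incL _ x) => v w; case: (incL _ (p _)) => v' w' /= w'D w'w -> wD.
    congr pair; rewrite /= ?addr0 //; apply: dsum_ext => t; rewrite linearD.
    have [tb|tb] := pselect (wo_lt le t b).
      by rewrite w'w // coord_inj_neq ?addr0 // => e; subst t; case: tb.
    have -> : coordL B t w' = 0 by apply: contrapT => /w'D.
    rewrite add0r; have [e|bt] := pselect (b = t); first by subst t; rewrite coord_inj.
    rewrite coord_inj_neq //; apply/esym; apply: contrapT => /wD.
    by move=> /(wo_succ_le wo _ ba) /(wo_leP wo) [e|//]; apply: bt.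
  - apply: lim_inj; apply: limD.
    + by case: alim => -[b ba] _; exists b.
    + by move=> c d da cd; exact: wo_lt_trans cd da.
    + by case: alim => _ h b /h [c bc ca]; exists c.
    + by move=> b ba; exact: IH.
have Qinj : inj Q.
  have Tinj : inj (subm (psub V B (fun _ => True))).
    apply: lim_inj; apply: limD => //.
    by move=> a _; have [b ab] := nomax a; exists b.
  have [p [pK p1 p2]] := psub_proj V B (fun _ => True).
  apply: (injective_retract K_sub (f := p) (g := incL _)) Tinj => x.
  have := p1 x; have := p2 x; case: (incL _ _) => v w; case: x => v' w' /= ww ->.
  by congr pair; apply: dsum_ext => t; exact: ww.
have [s sE] := dep_choice (fun a => dep_choice (Bs a)).
have /dep_choice[h hE] : forall a, exists h : {linear B a -> direct_sum F},
    forall i x, r a = Some i -> h (s a i x) = injL F i x.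
  move=> a; case ra: (r a) => [i|]; last by exists (zeroL _ _).
  have [p pE] := sE a i; exists (compL (injL F i) p) => j x [e]; subst j.
  by rewrite /= pE.
apply: (injective_retract K_sub (E := Q)
  (f := compL (inrL V (direct_sum B)) (liftL (fun i => compL (injL B (iota i)) (s (iota i) i))))
  (g := compL (liftL h) (sndL V (direct_sum B)))) Qinj => x.
rewrite /= inrLE /=.
apply: (@dsum_lin_ext _ _ _ _ (compL (liftL h) (liftL (fun i => compL (injL B (iota i)) (s (iota i) i)))) (idL _)).
by move=> i y; rewrite /= !liftLE /= ?liftLE hE.
Qed.
End SuperstableNoetherian.

(** * Unions of chains of injectives *)
Section NoetherianTools.
Variables (R : pzRingType) (Sys : systems R) (K : lmodType R -> Prop).
Hypotheses (K_sums : closed_direct_sums K) (K_sub : closed_submodules (sys_pure Sys) K)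
  (K_epi : closed_epi_images (sys_pure Sys) K).
Hypothesis noeth : noetherian (sys_pure Sys) K.
Local Notation M := (sys_pure Sys).
Local Notation inj E := (rel_injective M K E).

Lemma injective_zero (Z : lmodType R) : (forall x : Z, x = 0) -> inj Z.
Proof.
move=> Z0; split.
  have [Z1 [KZ1 _]] := K_zero K_sums.
  exact: K_sub KZ1 (sys_pure_zero Sys (zeroL Z Z1) Z0).
move=> A B f g _ _ _; exists (zeroL B Z) => x; rewrite [RHS]Z0 [LHS]Z0 //.
Qed.

Section Internal.
Variables (I : small) (E : lmodType R).
Implicit Type G : I -> submod E.

(** Families of submodules of E are compared inside one module, the direct sum of
    I copies of E, where all their direct sums live. *)
Definition copower : lmodType R := direct_sum (fun _ : I => E).
Definition copower_sum : {linear copower -> E} := liftL (fun _ : I => idL E).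
Definition copower_in (i : I) : {linear E -> copower} := injL (fun _ : I => E) i.
Definition copower_coord (i : I) : {linear copower -> E} := coordL (fun _ : I => E) i.
Lemma copower_sum_in i x : copower_sum (copower_in i x) = x.
Proof. by rewrite /copower_sum /copower_in liftLE. Qed.
Lemma copower_coord_in i x : copower_coord i (copower_in i x) = x.
Proof. exact: coord_inj. Qed.
Lemma copower_coord_in_neq i j x : i <> j -> copower_coord j (copower_in i x) = 0.
Proof. exact: coord_inj_neq. Qed.
Lemma copower_ext u v : (forall i, copower_coord i u = copower_coord i v) -> u = v.
Proof. exact: dsum_ext. Qed.

Fact copower_sub_0 G : forall i, G i (copower_coord i 0).
Proof. by move=> i; rewrite linear0; exact: smem0. Qed.
Fact copower_sub_P G a u v : (forall i, G i (copower_coord i u)) -> (forall i, G i (copower_coord i v)) ->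
  forall i, G i (copower_coord i (a *: u + v)).
Proof. by move=> Gu Gv i; rewrite linearP; exact: smemP. Qed.
Definition copower_sub G : submod copower := Submod (@copower_sub_0 G) (@copower_sub_P G).

Lemma copower_sub_in G i x : G i x -> copower_sub G (copower_in i x).
Proof.
move=> Gx j; have [<-|ij] := pselect (i = j); first by rewrite copower_coord_in.
by rewrite copower_coord_in_neq //; exact: smem0.
Qed.

Lemma copower_sub_iso G : isomorphic (direct_sum (fun i => subm (G i))) (subm (copower_sub G)).
Proof.
pose d := dsum_map (fun i => incL (G i)).
have dE i x : copower_coord i (d x) = incL (G i) (coordL (fun i => subm (G i)) i x).
  exact: dsum_map_coord.
have [|f fE] := lin_factor_inj (g := d) (@incL_inj _ _ (copower_sub G)).
  by move=> x; apply: incL_ex => i; rewrite dE; exact: incLP.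
apply: (@isomorphicP _ _ _ f).
  apply: lin_inj => x fx; apply: dsum_ext => i; apply: (@incL_inj _ _ (G i)).
  by rewrite -dE -fE fx !linear0.
move=> v; have vG := @incLP _ _ (copower_sub G) v.
have [x xE] := dep_choice (fun i => incL_ex (vG i)).
have [|u uE] := @dsum_mk _ _ (fun i => subm (G i)) x.
  apply: sub_finite_set (dsum_supp (incL (copower_sub G) v)) => i /= xi.
  apply: contraNN xi => /eqP vi; apply/eqP; apply: (@incL_inj _ _ (G i)).
  by rewrite linear0 xE.
exists u; apply: (@incL_inj _ _ (copower_sub G)); rewrite fE; apply: copower_ext => i.
by rewrite dE uE xE.
Qed.

Lemma copower_sub_injective G : (forall i, inj (subm (G i))) -> inj (subm (copower_sub G)).
Proof. by move=> Ginj; apply: (injective_iso K_sub (copower_sub_iso G)); exact: noeth. Qed.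
End Internal.

(** An increasing family [E i] of injective pure submodules has an injective union.
    By induction the union [F i] of the [E j] with j < i is injective, so it has
    a complement [C i] in [E i]; the union of the [E i] over a down-closed set is
    the direct sum of the [C i]. *)
Section ChainInjective.
Variables (T : small) (le : rel T) (Y : lmodType R) (E : T -> submod Y).
Local Notation lt := (wo_lt le).
Hypotheses (wo : well_order le) (EM : forall i, M (incL (E i)))
  (Einj : forall i, inj (subm (E i))) (Emono : forall i j, lt i j -> forall y, E i y -> E j y).

Let F0 (D : T -> Prop) y := y = 0 \/ exists2 i, D i & E i y.
Let F00 D : F0 D 0. Proof. by left. Qed.
Let F0P D a u v : F0 D u -> F0 D v -> F0 D (a *: u + v).
Proof.
move=> [->|[i Di Eu]] [->|[j Dj Ev]].
- by left; rewrite scaler0 addr0.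
- by right; exists j; rewrite // scaler0 add0r.
- by right; exists i; rewrite // addr0; exact: smemZ.
- right; have [e|ij|ji] := wo_tri wo i j.
  + by subst j; exists i => //; exact: smemP.
  + by exists j => //; apply: smemP => //; exact: Emono Eu.
  + by exists i => //; apply: smemP => //; exact: Emono Ev.
Qed.
Let FD (D : T -> Prop) : submod Y := Submod (F00 D) (@F0P D).

Let FD_M D : M (incL (FD D)).
Proof.
apply: sys_pure_inc => m n c S a b Fa Eq.
have [[i0 Di0]|no] := pselect (exists i, D i); last first.
  exists (fun _ => 0) => [j|i]; first by left.
  have [->|[k Dk]] := Fa i; last by case: no; exists k.
  by apply: big1 => j _; exact: scaler0.
suff [i Di Ea] : exists2 i, D i & forall k, E i (a k).
  have [b' Eb' b'E] := inc_sys_pure (EM i) S Ea Eq.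
  by exists b' => // j; right; exists i.
suff [i Di Ea] : exists2 i, D i & forall k, k \in enum 'I_m -> E i (a k).
  by exists i => // k; apply: Ea; rewrite mem_enum.
elim: (enum 'I_m) => [|k s [i Di IH]]; first by exists i0.
have [k0|[j Dj Ek]] := Fa k.
  by exists i => // l; rewrite inE => /orP[/eqP ->|/IH //]; rewrite k0; exact: smem0.
have [e|ij|ji] := wo_tri wo i j.
- by subst j; exists i => // l; rewrite inE => /orP[/eqP -> //|/IH].
- exists j => // l; rewrite inE => /orP[/eqP -> //|/IH]; exact: Emono.
- by exists i => // l; rewrite inE => /orP[/eqP ->|/IH //]; exact: Emono Ek.
Qed.

Let F i := FD (fun j => lt j i).

Let complement i : exists C : submod Y, inj (subm (F i)) ->
  [/\ inj (subm C), forall y, C y -> E i y, forall y, C y -> F i y -> y = 0 &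
      forall y, E i y -> exists f c, [/\ F i f, C c & y = f + c]].
Proof.
have [Finj|no] := pselect (inj (subm (F i))); last by exists (botS Y) => /no.
have FE y : F i y -> E i y.
  by move=> [->|[j ji Ey]]; [exact: smem0|exact: Emono Ey].
have [h hE] := sub_factor FE.
have hM : M h by apply: sys_pure_cancel_ext (FD_M _) hE.
have [g gh] := injective_split Finj (proj1 (Einj i)) hM.
have [p [pK pE]] := ker_retract gh.
exists (imS (incL (E i)) (kerS g)) => _; split.
- have [|k kE] := lin_factor_inj (g := compL (incL (E i)) (incL (kerS g)))
    (@incL_inj _ _ (imS (incL (E i)) (kerS g))).
    by move=> x; apply: incL_ex; exists x.
  apply: (injective_iso K_sub (E := subm (kerS g))); last exact: (injective_retract K_sub pK (Einj i)).
  apply: (@isomorphicP _ _ _ k).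
    by move=> x y /(congr1 (incL _)); rewrite !kE => /incL_inj /incL_inj.
  move=> y; have [x xy] := @incLP _ _ (imS _ _) y; exists x.
  by apply: (@incL_inj _ _ (imS (incL (E i)) (kerS g))); rewrite kE.
- by move=> y /imSP [x _ <-]; exact: incLP.
- move=> y /imSP [x gx <-] Fx; have [f fx] := incL_ex Fx.
  have hx : h f = x by apply: (@incL_inj _ _ (E i)); rewrite hE.
  by move: gx; rewrite /= -hx gh => ->; rewrite !linear0.
- move=> y /incL_ex [x <-]; exists (incL (F i) (g x)), (incL (E i) (incL _ (p x))).
  split; first exact: incLP.
    by apply/imSP; exists (incL _ (p x)) => //; exact: incLP.
  by rewrite pE linearB hE addrC subrK.
Qed.

Let C i := projT1 (cid (complement i)).
Let CP i : inj (subm (F i)) ->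
  [/\ inj (subm (C i)), forall y, C i y -> E i y, forall y, C i y -> F i y -> y = 0 &
      forall y, E i y -> exists f c, [/\ F i f, C i c & y = f + c]].
Proof. exact: (projT2 (cid (complement i))). Qed.

(** Independence: in a vanishing sum the component of largest index [m] lies in
    both [C m] and [F m].  Generation: by induction, E i = F i + C i. *)
Let FD_inj (D : T -> Prop) : (forall i j, D j -> lt i j -> D i) ->
  (forall i, D i -> inj (subm (F i))) -> inj (subm (FD D)).
Proof.
move=> Ddown DF; pose G i := if pselect (D i) then C i else botS Y.
have GD i : D i -> G i = C i by rewrite /G; case: pselect.
have GB i : ~ D i -> G i = botS Y by rewrite /G; case: pselect.
have GN i y : ~ D i -> G i y -> y = 0 by move=> /GB ->.
have Ginj i : inj (subm (G i)).
  have [Di|/GB ->] := pselect (D i); first by rewrite GD //; have [] := CP (DF i Di).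
  by apply: injective_zero => x; apply: (@incL_inj _ _ (botS Y)); rewrite linear0; exact: (@incLP _ _ (botS Y) x).
have Gsupp v i : copower_sub G v -> copower_coord Y i v <> 0 -> D i.
  by move=> Gv vi; apply: contrapT => nD; apply: vi; apply: (GN i _ nD).
have Gsum v (P : T -> Prop) : copower_sub G v -> (forall i, copower_coord Y i v <> 0 -> P i) -> FD P (copower_sum T Y v).
  move=> Gv vP; suff : FD P (copower_sum T Y v) by [].
  apply: (@dsum_ind _ _ _ (fun w => FD P (copower_sum T Y w)) v).
  - by rewrite linear0; exact: smem0.
  - by move=> x y Px Py; rewrite linearD; exact: smemD.
  - move=> i vi; rewrite -[injL _ _ _]/(copower_in Y i (copower_coord Y i v)) copower_sum_in.
    right; exists i; first exact: vP.
    have Di := Gsupp _ _ Gv vi; have [_ CE _ _] := CP (DF i Di).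
    by apply: CE; rewrite -(GD _ Di).
have sI v : copower_sub G v -> copower_sum T Y v = 0 -> v = 0.
  move=> Gv v0; apply: contrapT => nv.
  have [j0 vj0] : exists j, copower_coord Y j v <> 0.
    apply: contrapT => no; apply: nv; apply: copower_ext => i; rewrite linear0.
    by apply: contrapT => vi; apply: no; exists i.
  have [s us su] := dsum_list v.
  have [m vm mP] : exists2 m, copower_coord Y m v <> 0 & forall i, copower_coord Y i v <> 0 -> le i m.
    suff [m vm mP] : exists2 m, copower_coord Y m v <> 0 & forall i, i \in s -> copower_coord Y i v <> 0 -> le i m.
      by exists m => // i vi; apply: mP => //; exact: su.
    elim: s {us su} => [|i s [m vm IH]]; first by exists j0.
    have [vi|vi] := pselect (copower_coord Y i v = 0).
      by exists m => // l; rewrite inE => /orP[/eqP ->|/IH].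
    have [im|mi] := wo_total wo i m.
      by exists m => // l; rewrite inE => /orP[/eqP -> //|/IH].
    exists i => // l; rewrite inE => /orP[/eqP -> _|/IH h /h lm]; first exact: wo_refl.
    exact: wo_trans lm mi.
  have Dm := Gsupp _ _ Gv vm; have [_ _ C0 _] := CP (DF m Dm).
  have Cm : C m (copower_coord Y m v) by rewrite -(GD _ Dm).
  apply: vm; apply: C0 => //.
  have Gw : copower_sub G (v - copower_in Y m (copower_coord Y m v)).
    by apply: smemB => //; exact: copower_sub_in.
  have := Gsum _ (fun i => lt i m) Gw; rewrite linearB v0 copower_sum_in sub0r => Fm.
  rewrite -[copower_coord Y m v]opprK; apply: smemN; apply: Fm => i.
  rewrite linearB; have [<-|mi] := pselect (m = i); first by rewrite copower_coord_in subrr.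
  by rewrite copower_coord_in_neq // subr0 => /mP /(wo_leP wo) [e|//]; case: mi.
have span i : D i -> forall y, E i y -> exists2 v, copower_sub G v & copower_sum T Y v = y.
  elim/(wo_ind wo): i => i IH Di y Ey.
  have [_ _ _ CS] := CP (DF i Di); have [f [c [Ff Cc ->]]] := CS y Ey.
  have [v Gv <-] : exists2 v, copower_sub G v & copower_sum T Y v = f.
    case: Ff => [->|[j ji Ef]]; first by exists 0; rewrite ?linear0 //; exact: smem0.
    by apply: (IH j) => //; exact: Ddown ji.
  exists (v + copower_in Y i c); last by rewrite linearD copower_sum_in.
  by apply: smemD => //; apply: copower_sub_in; rewrite GD.
have [|k kE] := lin_factor_inj (g := compL (copower_sum T Y) (incL (copower_sub G)))
    (@incL_inj _ _ (FD D)).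
  move=> x; apply: incL_ex; apply: Gsum; first exact: incLP.
  by move=> i; apply: Gsupp; exact: incLP.
apply: (injective_iso K_sub (E := subm (copower_sub G))); last exact: copower_sub_injective.
apply: (@isomorphicP _ _ _ k).
  apply: lin_inj => x kx; apply: (@incL_inj _ _ (copower_sub G)); rewrite linear0.
  by apply: sI; [exact: incLP|have := kE x; rewrite kx linear0].
move=> y; have [v Gv vy] : exists2 v, copower_sub G v & copower_sum T Y v = incL _ y.
  have [->|[i Di Ey]] := @incLP _ _ (FD D) y; last exact: span Ey.
  by exists 0; rewrite ?linear0 //; exact: smem0.
have [x xv] := incL_ex Gv; exists x; apply: (@incL_inj _ _ (FD D)).
by rewrite kE -vy -xv.
Qed.

Lemma chain_injective : (forall y, exists i, E i y) -> inj Y.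
Proof.
move=> EY; have Finj : forall i, inj (subm (F i)).
  apply: (wo_ind wo) => i IH; apply: FD_inj => // j k ki jk.
  exact: wo_lt_trans jk ki.
have Tinj : inj (subm (FD (fun _ => True))) by apply: FD_inj.
apply: (injective_iso K_sub) Tinj; apply: (@isomorphicP _ _ _ (incL (FD (fun _ => True)))).
  exact: incL_inj.
by move=> y; have [i Ei] := EY y; apply: incL_ex; right; exists i.
Qed.
End ChainInjective.

End NoetherianTools.

(** * Decomposition of injectives into small ones *)
Section SmallInjectives.
Variables (R : pzRingType) (Sys : systems R) (K : lmodType R -> Prop).
Hypotheses (K_sums : closed_direct_sums K) (K_sub : closed_submodules (sys_pure Sys) K)
  (K_epi : closed_epi_images (sys_pure Sys) K).
Local Notation M := (sys_pure Sys).
Local Notation inj E := (rel_injective M K E).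

(** The operations of [ls_op], and for each test and each element of its codomain
    the value there of a chosen extension. *)
Inductive omega_op : small := OmegaLs (o : ls_op R) | OmegaSolve (s : test R) (b : test_cod s).
Definition omega_arity (o : omega_op) : small :=
  match o with OmegaLs o => ls_arity o | OmegaSolve s _ => test_dom s end.
Definition Omega : small := tree omega_arity.

Definition small_sub (E : lmodType R) (X : submod E) :=
  [/\ M (incL X), inj (subm X) & exists f : Omega -> E, forall v, X v <-> exists t, f t = v].

(** A submodule closed under these operations solves every test, because the
    chosen extension of a map into it takes its values in it. *)
Lemma in_small_sub (E : lmodType R) (d : E) : inj E -> exists2 X : submod E, X d & small_sub X.
Proof.
move=> [KE EP].
have sol s (k : test_dom s -> E) : exists h : test_cod s -> E,
    linear k -> test_good Sys K s -> linear h /\ forall a, h (test_map s a) = k a.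
  have [[kl sg]|no] := pselect (linear k /\ test_good Sys K s); last first.
    by exists (fun _ => 0) => kl sg; case: no.
  have [h hE] := EP _ _ (test_map s) (mklin kl) (K_test_dom K_sub sg) sg.1 sg.2.
  exists h => _ _; split=> [a x y|a]; first by rewrite linearP.
  by have /= -> := hE a; rewrite (mklinE kl).
have [h hP] := dep_choice (fun s => dep_choice (sol s)).
pose int (o : omega_op) : (omega_arity o -> E) -> E :=
  match o return (omega_arity o -> E) -> E with
  | OmegaLs o => fun t => ls_interp (botS E) d t
  | OmegaSolve s b => fun k => h s k b
  end.
pose f := tree_eval int; pose X v := exists t, f t = v.
have Xcl o (t : ls_arity o -> E) : (forall a, X (t a)) -> X (ls_interp (botS E) d t).
  exact: (@tree_eval_closed _ _ _ int (OmegaLs o) t).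
have XM := ls_pure Sys Xcl.
exists (ls_sub Xcl); first exact: ls_pt Xcl.
split=> //; last by exists f.
apply: (baer_criterion K_sub); first exact: K_sub KE XM.
move=> s sg g; pose k := incL (ls_sub Xcl) \o g.
have kl : linear k by move=> a x y; rewrite /k /= !linearP.
have [hl hE] := hP s k kl sg.
have [|h' h'E] := lin_factor_inj (g := mklin hl) (@incL_inj _ _ (ls_sub Xcl)).
  move=> b; apply: incL_ex; rewrite (mklinE hl).
  apply: (@tree_eval_closed _ _ _ int (OmegaSolve b) k) => a.
  exact: (@incLP _ _ (ls_sub Xcl) (g a)).
exists h' => a; apply: (@incL_inj _ _ (ls_sub Xcl)).
by rewrite h'E (mklinE hl) hE.
Qed.

(** A set of representatives for the small injectives. *)
Definition injtype : small := {Z : submod (freemod R Omega) | inj (quo Z)}.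
Definition injmod (t : injtype) : lmodType R := quo (sval t).

Lemma injmod_injective t : inj (injmod t). Proof. exact: (svalP t). Qed.

Lemma small_sub_injmod (E : lmodType R) (X : submod E) : small_sub X ->
  exists t, isomorphic (injmod t) (subm X).
Proof.
move=> [XM Xinj [f fX]].
have fX' w : X (f w) by apply/fX; exists w.
have [f' f'E] := choice (fun w => incL_ex (fX' w)).
have [|Z [q [qI qS]]] := quo_free (f := f').
  move=> x; have /fX [w wx] := incLP x; exists w; apply: (@incL_inj _ _ X).
  by rewrite f'E.
have iso : isomorphic (quo Z) (subm X) by apply: isomorphicP qI qS.
have Zinj : inj (quo Z) by apply: (injective_iso K_sub (iso_sym iso)).
by exists (exist _ Z Zinj).
Qed.

Hypothesis noeth : noetherian M K.

(** A maximal independent set J of small injective submodules with pure sum.  The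
    sum is injective, so it has a complement; a nonzero element of the complement
    would lie in a small injective submodule that could be added to J. *)
Section Decomposition.
Variable E : lmodType R.
Hypothesis Einj : inj E.
Let I : small := {X : submod E | small_sub X}.
(** Members outside J are replaced by zero, so that the index type stays fixed. *)
Let G (J : set I) (i : I) : submod E := if pselect (J i) then sval i else botS E.
Let GJ (J : set I) i : J i -> G J i = sval i.
Proof. by rewrite /G; case: pselect. Qed.
Let GN (J : set I) i : ~ J i -> G J i = botS E.
Proof. by rewrite /G; case: pselect. Qed.
Let sg J : {linear subm (copower_sub (G J)) -> E} := compL (copower_sum I E) (incL (copower_sub (G J))).
Let P (J : set I) := M (sg J).

Let copower_subP J v : copower_sub (G J) v <-> forall i, (J i -> sval i (copower_coord E i v)) /\ (copower_coord E i v <> 0 -> J i).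
Proof.
split=> [Gv i|Gv i]; have [Ji|nJ] := pselect (J i).
- by split=> // _; rewrite -(GJ Ji); exact: Gv.
- split=> // vi; case: vi; have := Gv i; rewrite (GN nJ); exact.
- by rewrite (GJ Ji); case: (Gv i) => /(_ Ji).
- by rewrite (GN nJ) /=; apply: contrapT => /(proj2 (Gv i)).
Qed.

Let copower_sub_mono J J' : J `<=` J' -> forall v, copower_sub (G J) v -> copower_sub (G J') v.
Proof.
move=> JJ v /copower_subP Gv; apply/copower_subP => i; have [Gi Ji] := Gv i; split=> [J'i|/Ji /JJ //].
have [vi|/Ji /Gi //] := pselect (copower_coord E i v = 0); by rewrite vi; exact: smem0.
Qed.

Let inj_G J : inj (subm (copower_sub (G J))).
Proof.
apply: (copower_sub_injective K_sub noeth) => i; have [Ji|nJ] := pselect (J i).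
  by rewrite (GJ Ji); case: (svalP i).
rewrite (GN nJ); apply: (injective_zero K_sums K_sub) => x; apply: (@incL_inj _ _ (botS E)).
by rewrite linear0; exact: (@incLP _ _ (botS E) x).
Qed.

Let P_elem J : P J <-> (forall v, copower_sub (G J) v -> copower_sum I E v = 0 -> v = 0) /\
  forall m n (c : 'I_m -> 'I_n -> R), Sys c -> forall (a : 'I_m -> copower I E) b,
    (forall i, copower_sub (G J) (a i)) -> (forall i, lincomb c b i = copower_sum I E (a i)) ->
    exists2 b', (forall j, copower_sub (G J) (b' j)) & forall i, lincomb c b' i = a i.
Proof.
split=> [[sI sP]|[sI sP]]; split.
- move=> v /incL_ex [x <-] x0.
  have -> : x = 0; last by rewrite linear0.
  by apply: sI; rewrite linear0.
- move=> m n c S a b Ga Eq; have [a' a'E] := choice (fun i => incL_ex (Ga i)).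
  have [|b' b'E] := sP _ _ _ S a' b; first by move=> i; rewrite Eq /= a'E.
  exists (fun j => incL (copower_sub (G J)) (b' j)) => [j|i]; first exact: incLP.
  by rewrite -a'E -b'E lincomb_map.
- apply: lin_inj => x x0; apply: (@incL_inj _ _ (copower_sub (G J))); rewrite linear0.
  by apply: sI => //; exact: incLP.
- move=> m n c S a b Eq.
  have [|b' Gb' b'E] := sP _ _ _ S _ b (fun i => incLP (a i)); first exact: Eq.
  have [x xE] := choice (fun j => incL_ex (Gb' j)).
  exists x => i; apply: (@incL_inj _ _ (copower_sub (G J))); rewrite lincomb_map -b'E.
  exact: eq_lincomb.
Qed.

Let P_chain (F : set (set I)) : F !=set0 -> F `<=` P -> total_on F subset ->
  P (\bigcup_(J in F) J).
Proof.
move=> [J0 FJ0] FP Ft; set U := \bigcup_(J in F) J.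
have Uv v : copower_sub (G U) v -> exists2 J, F J & copower_sub (G J) v.
  move=> /copower_subP Gv; have [s us su] := dsum_list v.
  suff [J FJ Jv] : exists2 J, F J & forall i, i \in s -> copower_coord E i v <> 0 -> J i.
    exists J => //; apply/copower_subP => i; have [Gi Ui] := Gv i; split=> [Ji|vi].
      by apply: Gi; exists J.
    by apply: Jv => //; exact: su.
  elim: s {us su} => [|i s [J FJ IH]]; first by exists J0.
  have [vi|vi] := pselect (copower_coord E i v = 0).
    by exists J => // l; rewrite inE => /orP[/eqP ->|/IH].
  have [J' FJ' J'i] := proj2 (Gv i) vi; have [JJ|JJ] := Ft _ _ FJ FJ'.
    by exists J' => // l; rewrite inE => /orP[/eqP -> //|/IH h /h /JJ].
  by exists J => // l; rewrite inE => /orP[/eqP -> _|/IH //]; exact: JJ.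
apply/P_elem; split.
  by move=> v /Uv [J FJ Jv]; have /P_elem [+ _] := FP _ FJ; apply.
move=> m n c S a b Ga Eq.
have [|||W [J FJ <-] Wa] := @chain_tuple _ [set (copower_sub (G J) : set (copower I E)) | J in F] m a.
- by exists (copower_sub (G J0) : set _), J0.
- move=> _ _ [J FJ <-] [J' FJ' <-]; have [JJ|JJ] := Ft _ _ FJ FJ'; [left|right] => v;
    exact: copower_sub_mono.
- by move=> i; have [J FJ Jv] := Uv _ (Ga i); exists (copower_sub (G J) : set _) => //; exists J.
have /P_elem [_ JP] := FP _ FJ; have [b' Gb' b'E] := JP _ _ _ S a b Wa Eq.
exists b' => // j; apply: copower_sub_mono (Gb' j) => i Ji; by exists J.
Qed.

Let P0 : P set0.
Proof.
have v0 v : copower_sub (G set0) v -> v = 0.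
  move=> /copower_subP Gv; apply: copower_ext => i; rewrite linear0.
  by apply: contrapT => /(proj2 (Gv i)).
apply/P_elem; split=> [v /v0 -> //|m n c S a b Ga Eq].
exists (fun _ => 0) => [j|i]; first exact: smem0.
by rewrite (v0 _ (Ga i)); apply: big1 => j _; exact: scaler0.
Qed.

Let sg_surj J : P J -> (forall J', J `<=` J' -> P J' -> J' `<=` J) ->
  forall y, exists x, sg J x = y.
Proof.
move=> PJ Jmax; have [r rs] := injective_split (inj_G J) (proj1 Einj) PJ.
have [p [pK pE]] := ker_retract rs.
suff ker0 y : r y = 0 -> y = 0.
  move=> y; exists (r y); apply/esym/subr0_eq/ker0.
  by rewrite linearB rs subrr.
move=> /(@incL_ex _ _ (kerS r) y) [d <-] {y}; apply: contrapT => d0.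
have Zinj : inj (subm (kerS r)) := injective_retract K_sub pK Einj.
have [X' X'd [X'M X'inj [f fX']]] := in_small_sub d Zinj.
pose X := imS (incL (kerS r)) X'.
have [|k kE] := lin_factor_inj (g := compL (incL (kerS r)) (incL X')) (@incL_inj _ _ X).
  by move=> x; apply: incL_ex; exists x.
have kI : injective k by move=> x y /(congr1 (incL X)); rewrite !kE => /incL_inj /incL_inj.
have kS y : exists x, k x = y.
  have [x xy] := @incLP _ _ X y; exists x; apply: (@incL_inj _ _ X).
  by rewrite kE.
have [k' [k'k kk']] := lin_inverse kI kS.
have XM : M (incL X).
  apply: (sys_pure_comp_ext (f := k') (g := compL (incL (kerS r)) (incL X'))).
  - exact: sys_pure_split kk'.
  - by apply: sys_pure_comp => //; exact: sys_pure_split pK.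
  - by move=> x; rewrite -kE kk'.
have Xr x : X x -> r x = 0.
  by move=> /imSP [z _ <-]; exact: (@incLP _ _ (kerS r) z).
have Xs : small_sub X.
  split=> //; first exact: (injective_retract K_sub kk' X'inj).
  exists (incL (kerS r) \o f) => v; split.
    by move=> /imSP [z /fX' [w <-] <-]; exists w.
  by move=> [w <-]; apply/imSP; exists (f w) => //; apply/fX'; exists w.
pose i0 : I := exist _ X Xs.
have Xd : X (incL _ d) by apply/imSP; exists d.
have rG v : copower_sub (G J) v -> incL _ (r (copower_sum I E v)) = v.
  by move=> /incL_ex [x <-]; have /= -> := rs x.
have nJ : ~ J i0.
  move=> Ji0; have Gd : copower_sub (G J) (copower_in E i0 (incL _ d)).
    by apply: copower_sub_in; rewrite (GJ Ji0).
  have := rG _ Gd; rewrite copower_sum_in Xr // linear0 => d0'.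
  apply: d0; have := congr1 (copower_coord E i0) d0'; rewrite copower_coord_in linear0 => e.
  by [].
apply: nJ; apply: (Jmax (J `|` [set i0])); [by move=> i; left| |by right].
have Gi0 : G (J `|` [set i0]) i0 = X by rewrite GJ //; right.
have split_v v : copower_sub (G (J `|` [set i0])) v -> exists w x,
    [/\ copower_sub (G J) w, X x & v = w + copower_in E i0 x].
  move=> Gv; have Xv : X (copower_coord E i0 v) by rewrite -Gi0; exact: Gv.
  exists (v - copower_in E i0 (copower_coord E i0 v)), (copower_coord E i0 v); split=> //; last by rewrite subrK.
  move/copower_subP: Gv => Gv; apply/copower_subP => i; rewrite linearB.
  have [e|ne] := pselect (i0 = i); first by subst i; rewrite copower_coord_in subrr; split=> // _; exact: (smem0 X).
  rewrite copower_coord_in_neq // subr0; have [Gi Ji] := Gv i; split=> [Ji'|vi].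
    by apply: Gi; left.
  by case: (Ji vi) => // e; case: ne.
have join w x : copower_sub (G J) w -> X x -> copower_sub (G (J `|` [set i0])) (w + copower_in E i0 x).
  move=> Gw Xx; apply: smemD; last by apply: copower_sub_in; rewrite Gi0.
  by apply: copower_sub_mono Gw => i; left.
have rsum w x : copower_sub (G J) w -> X x -> incL _ (r (copower_sum I E (w + copower_in E i0 x))) = w.
  by move=> Gw Xx; rewrite linearD copower_sum_in (linearD r) (Xr _ Xx) addr0 rG.
apply/P_elem; split.
  move=> v /split_v [w [x [Gw Xx ->]]] v0; have := rsum w x Gw Xx.
  rewrite v0 !linear0 => w0; move: v0; rewrite -w0 add0r copower_sum_in => ->.
  by rewrite linear0.
move=> m n c S a b Ga Eq.
have [w wP] := choice (fun i => split_v _ (Ga i)).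
have {wP}[x wxP] := choice wP.
pose y j := incL (copower_sub (G J)) (r (b j)).
have yE i : lincomb c y i = w i.
  have [Gw Xx E1] := wxP i.
  by rewrite -[LHS](lincomb_map (compL (incL _) r)) Eq E1 /= rsum.
have [||x' Xx' x'E] := inc_sys_pure XM S (a := x) (b := fun j => b j - copower_sum I E (y j)).
- by move=> i; case: (wxP i).
- move=> i; have [Gw Xx E1] := wxP i.
  by rewrite lincombB Eq -(lincomb_map (copower_sum I E) c y) yE E1 linearD copower_sum_in addrAC subrr add0r.
exists (fun j => y j + copower_in E i0 (x' j)) => [j|i].
  by apply: join => //; exact: incLP.
have [_ _ ->] := wxP i.
by rewrite lincombD yE -(lincomb_map (copower_in E i0) c x') x'E.
Qed.

Lemma decomposition : exists (J : small) (F : J -> lmodType R),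
  isomorphic (direct_sum F) E /\ forall j, exists t, isomorphic (injmod t) (F j).
Proof.
have [J [PJ Jmax]] := zorn_sets P0 P_chain.
exists I, (fun i => subm (G J i)); split.
  apply: iso_trans (copower_sub_iso (G J)) _; apply: (@isomorphicP _ _ _ (sg J)).
    by case: PJ.
  exact: sg_surj.
move=> i; apply: small_sub_injmod; have [Ji|nJ] := pselect (J i).
  by rewrite (GJ Ji); exact: svalP.
rewrite (GN nJ); have z (x : subm (botS E)) : x = 0.
  by apply: (@incL_inj _ _ (botS E)); rewrite linear0; exact: (@incLP _ _ (botS E) x).
split; [exact: sys_pure_zero|exact: (injective_zero K_sums K_sub)|].
exists (fun _ => 0) => v; split=> [->|[_ <-]] //.
exists (Node (ar := omega_arity) (o := OmegaLs (LsZero R)) (fun v => match v with end)).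
by [].
Qed.
End Decomposition.

(** L copies of each small injective. *)
Definition injmod_sum (L : small) : lmodType R :=
  direct_sum (fun p : (injtype * L)%type => injmod p.1).

Lemma injmod_sum_injective L : inj (injmod_sum L).
Proof. by apply: noeth => p; exact: injmod_injective. Qed.

(** Embed N in an injective, that is, in a direct sum of small injectives.  At most
    L summands occur in the supports of elements of N; number them by L and send
    each to its own copy.  On N the resulting map has a left inverse into the
    injective, hence is pure. *)
Lemma injmod_sum_universal (L : small) : card_leq nat L -> size_universal Sys K L (injmod_sum L).
Proof.
move=> natL N KN NL.
have [E [eps [Einj epsM]]] := enough_injectives K_sums K_sub K_epi KN.
have [J [F [FE Ft]]] := decomposition Einj.
have [tau tauM] : exists tau : {linear N -> direct_sum F}, M tau.
  have [g [g' gg' g'g]] := iso_sym FE.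
  exists (compL g eps); apply: sys_pure_comp => //; apply: sys_pure_iso; first exact: can_inj gg'.
  by move=> b; exists (g' b).
have /dep_choice [t tP] := Ft.
have abP j : exists (al : {linear injmod (t j) -> F j}) (be : {linear F j -> injmod (t j)}),
    forall x, al (be x) = x.
  have [al [be1 K1 K2]] := tP j.
  have [|be [_ Kb]] := @lin_inverse _ _ _ al (can_inj K1); first by move=> b; exists (be1 b).
  by exists al, be.
have [al /dep_choice [be abE]] := dep_choice abP.
pose S := {j | exists n, coordL F j (tau n) <> 0}.
have SL : card_leq S L.
  have /choice[s sP] : forall n, exists s : seq {classic J},
      forall j, coordL F j (tau n) <> 0 -> (j : {classic J}) \in s.
    by move=> n; have [s _ su] := dsum_list (tau n); exists s.
  have /choice[nu nuP] : forall p : S, exists n, coordL F (sval p) (tau n) <> 0.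
    by move=> [j jn].
  apply: (card_leq_trans (B := (N * nat)%type)); last first.
    by apply: (card_prod natL).
  exists (fun p => (nu p, index (sval p : {classic J}) (s (nu p)))).
  move=> p q [npq ipq].
  have := nth_index (sval p : {classic J}) (sP _ _ (nuP p)).
  rewrite ipq npq nth_index; last exact: sP (nuP q).
  move=> e; case: p q e {npq ipq} => [j jn] [k kn] /= e; subst k.
  by congr exist; apply: Prop_irrelevance.
have [c cI] := SL.
pose key (p : S) : (injtype * L)%type := (t (sval p), c p).
have keyI : injective key by move=> p q [_ /cI].
have [h hE] := dep_family (key := key) (F := fun p : (injtype * L)%type => {linear injmod p.1 -> direct_sum F})
  (fun p => zeroL _ _) (fun p : S => compL (injL F (sval p)) (al (sval p))) keyI.
have /dep_choice[ph phE] : forall j, exists f : {linear F j -> injmod_sum L},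
    forall (Sj : exists n, coordL F j (tau n) <> 0) x,
      f x = injL (fun p : (injtype * L)%type => injmod p.1) (key (exist _ j Sj)) (be j x).
  move=> j; have [Sj|no] := pselect (exists n, coordL F j (tau n) <> 0); last first.
    by exists (zeroL _ _) => Sj; case: no.
  exists (compL (injL (fun p : (injtype * L)%type => injmod p.1) (key (exist _ j Sj))) (be j)).
  by move=> Sj' x; rewrite (Prop_irrelevance Sj' Sj).
exists (compL (liftL ph) tau).
apply: (sys_pure_cancel_ext tauM (g := liftL h)) => n /=.
apply: (@dsum_ind _ _ _ (fun u => liftL h (liftL ph u) = u) (tau n)).
- by rewrite !linear0.
- by move=> u v uE vE; rewrite !linearD uE vE.
- move=> j jn; have Sj : exists n, coordL F j (tau n) <> 0 by exists n.
  by rewrite liftLE (phE j Sj) liftLE hE /= abE.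
Qed.
End SmallInjectives.

(** * Limit models under the noetherian hypothesis *)

(** Eilenberg's swindle: if Z is a summand of U, with U = Z + Y, then
    Z + U + U + ... = Z + (Y + Z) + (Y + Z) + ... = U + U + ...  The
    isomorphism shifts the Z-parts by one place; [q] is the projection on Y. *)
Section Absorb.
Variables (R : pzRingType) (U Z : lmodType R) (iz : {linear Z -> U}) (pz : {linear U -> Z}).
Hypothesis pziz : forall z, pz (iz z) = z.
Local Notation UU := (direct_sum (fun _ : nat => U)).
Let ij n : {linear U -> UU} := injL (fun _ : nat => U) n.

Fact absorb_q_linear : linear (fun v => v - iz (pz v)).
Proof. by move=> a x y; rewrite !linearP scalerDr addrACA. Qed.
Let q : {linear U -> U} := mklin absorb_q_linear.
Let qE v : q v = v - iz (pz v). Proof. exact: mklinE. Qed.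
Let qiz z : q (iz z) = 0. Proof. by rewrite qE pziz subrr. Qed.
Let pzq v : pz (q v) = 0. Proof. by rewrite qE linearB pziz subrr. Qed.
Let addq v : iz (pz v) + q v = v. Proof. by rewrite qE addrC subrK. Qed.

Fact absorb_fwd_linear n : linear (fun v => ij n.+1 (iz (pz v)) + ij n (q v)).
Proof. by move=> a x y; rewrite !linearP scalerDr addrACA. Qed.
Let fwd : {linear (Z * UU)%type -> UU} :=
  copairL (compL (ij 0) iz) (liftL (fun n => mklin (absorb_fwd_linear n))).
Let bwd0 n : {linear U -> (Z * UU)%type} :=
  match n with
  | 0%N => pairL pz (compL (ij 0) q)
  | m.+1 => compL (inrL Z UU) (copairL (ij m) (ij m.+1) \o pairL (compL iz pz) q)
  end.
Let bwd : {linear UU -> (Z * UU)%type} := liftL bwd0.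

Lemma absorb_summand : isomorphic (Z * UU)%type UU.
Proof.
have fwd1 z : fwd (z, 0) = ij 0 (iz z) by rewrite copairLE /= linear0 addr0.
have fwd2 n v : fwd (0, ij n v) = ij n.+1 (iz (pz v)) + ij n (q v).
  by rewrite copairLE /= !linear0 add0r liftLE (mklinE (absorb_fwd_linear n)).
have bwd1 v : bwd (ij 0 v) = (pz v, ij 0 (q v)) by rewrite /bwd liftLE /= pairLE.
have bwd2 n v : bwd (ij n.+1 v) = (0, ij n (iz (pz v)) + ij n.+1 (q v)).
  by rewrite /bwd liftLE /= inrLE copairLE pairLE.
have pD (z z' : Z) (u u' : UU) : (z, u) + (z', u') = (z + z', u + u') by [].
have bq n v : bwd (ij n (q v)) = (0, ij n (q v)).
  have qq : q (q v) = q v by rewrite qE pzq linear0 subr0.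
  case: n => [|n]; first by rewrite bwd1 pzq qq.
  by rewrite bwd2 pzq !linear0 add0r qq.
have bf x : bwd (fwd x) = x.
  case: x => z u.
  have -> : (z, u) = (z, 0) + (0, u) :> (Z * UU)%type by rewrite pD addr0 add0r.
  rewrite (linearD fwd) (linearD bwd); congr (_ + _).
    by rewrite fwd1 bwd1 pziz qiz linear0.
  rewrite -!inrLE; apply: (@dsum_lin_ext _ _ _ _ (compL bwd (compL fwd (inrL Z UU))) (inrL Z UU)).
  move=> n v /=; rewrite !inrLE fwd2 (linearD bwd) bq.
  by rewrite bwd2 qiz linear0 addr0 pziz pD addr0 -(linearD (ij n)) addq.
have fb w : fwd (bwd w) = w.
  apply: (@dsum_lin_ext _ _ _ _ (compL fwd bwd) (idL UU)) => n v /=.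
  case: n => [|n].
    have -> : bwd (injL _ 0 v) = (pz v, 0) + (0, ij 0 (q v)).
      by rewrite [LHS]bwd1 pD addr0 add0r.
    rewrite (linearD fwd) fwd1 fwd2 pzq !linear0 add0r.
    have -> : q (q v) = q v by rewrite qE pzq linear0 subr0.
    by rewrite -(linearD (ij 0)) addq.
  have -> : bwd (injL _ n.+1 v) = (0, ij n (iz (pz v))) + (0, ij n.+1 (q v)).
    by rewrite [LHS]bwd2 pD addr0.
  rewrite (linearD fwd) !fwd2 pziz qiz pzq !linear0 addr0 add0r.
  have -> : q (q v) = q v by rewrite qE pzq linear0 subr0.
  by rewrite -(linearD (ij n.+1)) addq.
by exists fwd; exists bwd.
Qed.
End Absorb.

Section NoetherianSuperstable.
Variables (R : pzRingType) (Sys : systems R) (K : lmodType R -> Prop).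
Hypotheses (K_sums : closed_direct_sums K) (K_sub : closed_submodules (sys_pure Sys) K)
  (K_epi : closed_epi_images (sys_pure Sys) K).
Local Notation M := (sys_pure Sys).
Local Notation inj E := (rel_injective M K E).

Lemma range_iso (A B : lmodType R) (f : {linear A -> B}) : injective f ->
  exists (k : {linear A -> subm (ranS f)}) (k' : {linear subm (ranS f) -> A}),
    [/\ forall x, incL _ (k x) = f x, forall x, k' (k x) = x & forall y, k (k' y) = y].
Proof.
move=> fI; have [|k kE] := lin_factor_inj (g := f) (@incL_inj _ _ (ranS f)).
  by move=> x; apply: incL_ex; exists x.
have kI : injective k by move=> x y /(congr1 (incL _)); rewrite !kE => /fI.
have [|k' [k'k kk']] := lin_inverse kI; last by exists k, k'.
move=> y; have [x xy] := @incLP _ _ (ranS f) y; exists x.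
by apply: (@incL_inj _ _ (ranS f)); rewrite kE.
Qed.

Lemma wo_nat : well_order (leq : rel nat).
Proof.
move=> A [x Ax]; have [|m Am mP] := @ex_minnP (fun n => n \in A); first by exists x.
exists m; split; first by split.
by move=> n [An nP]; apply/eqP; rewrite eqn_leq mP //= nP.
Qed.

(** The members of a limit chain are pure in the union, which belongs to K. *)
Lemma limit_chain_pure (L : small) (T : small) (le : rel T) (Y : lmodType R)
    (N : T -> lmodType R) (e : forall i, {linear N i -> Y}) :
  well_order le -> inhabited T -> limit_chain M K L le e -> K Y /\ forall i, M (e i).
Proof.
move=> wo [t0] [NK mono _ _ Ye].
have eI i : injective (e i) by have [] := NK i.
have dir i j : exists k,
    (forall a, exists b, e k b = e i a) /\ (forall a, exists b, e k b = e j a).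
  have [ij|ji] := wo_total wo i j.
    by exists j; split=> a; [have [f [_ fE]] := mono _ _ ij; exists (f a); exact: fE|exists a].
  by exists i; split=> a; [exists a|have [f [_ fE]] := mono _ _ ji; exists (f a); exact: fE].
have surj y : exists i a, e i a = y.
  have : [set: Y] y by []; rewrite Ye => -[i _ [a _ <-]]; by exists i, a.
split; first by apply: (K_directed_union K_sums K_epi _ eI t0 dir surj) => i; have [] := NK i.
move=> i; apply: (sys_pure_directed_union eI t0 dir surj) => k ik; have [ij|ki] := wo_total wo i k.
  by have [f [fM fE]] := mono _ _ ij; exists f; split=> // a; exact: fE.
have [f [[fI _] fE]] := mono _ _ ki; have [|h [hf fh]] := lin_inverse fI.
  by move=> a; have [b ba] := ik a; exists b; apply: (eI i); rewrite -ba; exact: fE.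
exists h; split; first exact: (sys_pure_split Sys fh).
by move=> a; rewrite -[in RHS](fh a); have /= -> := fE (h a).
Qed.

Hypothesis noeth : noetherian M K.
Hypothesis K_nonzero : exists A : lmodType R, K A /\ exists x : A, x != 0.

Section Size.
Variable L : small.
Hypotheses (natL : card_leq nat L) (sL : card_leq (injtype Sys K) L) (fL : card_leq (freemod R (Omega R)) L).

Let U0 := injmod_sum Sys K L.
Let U : lmodType R := direct_sum (fun _ : nat => U0).

Let U0L : card_leq U0 L.
Proof.
apply: (card_direct_sum natL); first by apply: card_prod => //; exact: card_leq_refl.
move=> p; exact: card_leq_trans (card_leq_surj (@piL_surj _ _ (sval p.1))) fL.
Qed.
Let UL : card_leq U L.
Proof. exact: card_direct_sum. Qed.
Let U0inj : inj U0. Proof. exact: injmod_sum_injective. Qed.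
Let Uinj : inj U. Proof. exact: noeth. Qed.
Let U0u : size_universal Sys K L U0. Proof. exact: injmod_sum_universal. Qed.
Let Uu : size_universal Sys K L U.
Proof.
move=> C KC CL; have [k kM] := U0u KC CL.
exists (compL (injL (fun _ : nat => U0) 0%N) k); apply: sys_pure_comp => //.
by apply: (sys_pure_split Sys (g := coordL (fun _ : nat => U0) 0%N)) => x; exact: coord_inj.
Qed.
(** K has a nonzero module, hence a nonzero small injective, and U0 contains L
    copies of it. *)
Let LU : card_leq L U.
Proof.
have [A [KA [x /eqP x0]]] := K_nonzero.
have [E [f [Einj [fI _]]]] := enough_injectives K_sums K_sub K_epi KA.
have [X Xx Xs] := in_small_sub K_sub (f x) Einj; have [t [g [g' g'g gg']]] := small_sub_injmod K_sub Xs.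
have [y yx] := incL_ex Xx; pose z := g' y.
have z0 : z <> 0.
  move=> e; apply: x0; apply: fI; rewrite linear0 -yx -(gg' y) -/z e.
  by rewrite !linear0.
pose F (p : (injtype Sys K * L)%type) := injmod p.1.
exists (fun l => injL (fun _ : nat => U0) 0%N (injL F (t, l) (z : F (t, l)))) => l l'.
move=> /(congr1 (coordL (fun _ : nat => U0) 0%N)); rewrite !coord_inj.
move=> /(congr1 (coordL F (t, l))); rewrite coord_inj => e.
apply: contrapT => ll'; apply: z0; rewrite e coord_inj_neq // => -[e'].
by apply: ll'.
Qed.

Lemma limit_model_exists : exists X, limit_model M K L X.
Proof.
pose B (_ : nat) := U.
have KU : K U by case: Uinj.
have Qinj : inj (psum U B) by apply: (injective_pair K_sums K_sub) => //; exact: noeth.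
exists (subm (psub U B (fun _ => True))).
apply: (psub_limit_model K_sums K_sub K_epi natL wo_nat) => //.
- by move=> a; exists (idL U), (idL U).
- by exists 0%N.
- by move=> a _; exists a.+1.
- move=> a _; have [p [pK _ _]] := psub_proj U B (fun t => wo_lt (leq : rel nat) t a).
  exact: (injective_retract K_sub pK Qinj).
Qed.

(** For each member N of the chain, N embeds in U, so U embeds over N in the next
    member: Y is the union of a chain of copies of U, hence injective.  Therefore
    Y = U + Z, where Z is injective and embeds in U0, and U absorbs Z. *)
Lemma limit_model_iso Y : limit_model M K L Y -> isomorphic Y U.
Proof.
move=> Ylim; have [YL _] := limit_model_size Ylim.
have [_ [T [le [[wo [i0] nomax] _ [N [e eP]]]]]] := Ylim.
have [KY eM] := limit_chain_pure wo (inhabits i0) eP; have [NK mono _ succ Ye] := eP.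
have KU : K U by case: Uinj.
have /dep_choice[ep epP] : forall i, exists ep : {linear U -> Y},
    [/\ M ep, forall x, exists y, ep y = e i x &
        forall k, wo_lt le i k -> forall y, exists z, e k z = ep y].
  move=> i; have [j ij] := wo_succ_ex wo (nomax i).
  have [f [[KNi KNj fM /card_eq_leq[_ _] fP] fE]] := succ _ _ ij.
  have [_ /card_eq_leq [NiL _] _] := NK i; have [_ /card_eq_leq [_ LNj] _] := NK j.
  have [g gM] := Uu KNi NiL.
  have [|h [hM hE]] := fP _ g KU gM; first by apply/card_leqP; exact: card_leq_trans UL LNj.
  exists (compL (e j) h); split; first exact: sys_pure_comp.
    by move=> x; exists (g x); have /= -> := hE x; exact: fE.
  move=> k /(proj2 ij) /mono [m [_ mE]] y; exists (m (h y)); exact: mE.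
have epI i : injective (ep i) by have [[]] := epP i.
have Yinj : inj Y.
  apply: (chain_injective K_sums K_sub noeth (E := fun i => ranS (ep i)) wo).
  - move=> i; have [k [k' [kE k'k kk']]] := range_iso (epI i).
    have [epM _ _] := epP i.
    apply: (sys_pure_comp_ext (f := k') (g := ep i)) => //; first exact: (sys_pure_split Sys kk').
    by move=> x; rewrite -kE kk'.
  - move=> i; have [k [k' [kE k'k kk']]] := range_iso (epI i).
    exact: (injective_retract K_sub kk' Uinj).
  - move=> i j ij y [u <-]; have [_ _ h] := epP i; have [z <-] := h _ ij u.
    have [_ h' _] := epP j; exact: h'.
  - move=> y; have : [set: Y] y by []; rewrite Ye => -[i _ [a _ <-]].
    by exists i; have [_ h _] := epP i; exact: h.
have [epM _ _] := epP i0.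
have [g gep] := injective_split Uinj KY epM; have [p [pK pE]] := ker_retract gep.
have Zinj : inj (subm (kerS g)) := injective_retract K_sub pK Yinj.
have ZL : card_leq (subm (kerS g)) L.
  by apply: card_leq_trans YL; exists (incL _); exact: incL_inj.
have [iz izM] := U0u (proj1 Zinj) ZL.
have [pz pziz] := injective_split Zinj (proj1 U0inj) izM.
apply: iso_trans (absorb_summand pziz).
apply: (isomorphicP (f := pairL p g)).
  apply: lin_inj => y; rewrite pairLE => -[py gy].
  by have := pE y; rewrite py gy !linear0 addr0.
move=> [z u]; exists (incL _ z + ep i0 u).
have gz : g (incL _ z) = 0 by exact: (@incLP _ _ (kerS g) z).
have gy : g (incL _ z + ep i0 u) = u by rewrite linearD gz gep add0r.
rewrite pairLE gy; congr pair; apply: (@incL_inj _ _ (kerS g)).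
by rewrite pE gy addrK.
Qed.
End Size.

Theorem noetherian_superstable : superstable M K.
Proof.
(* Above mu there is room for all small injectives, and the index set of their
   representatives embeds. *)
pose mu : small := ((R + nat) + (injtype Sys K + freemod R (Omega R)))%type.
exists mu; split; first by apply/card_leqP; exists inl => x y [].
move=> L /card_leqP muL.
have natL : card_leq nat L by apply: card_leq_trans muL; exists (fun n => inl (inr n)) => x y [].
have sL : card_leq (injtype Sys K) L.
  by apply: card_leq_trans muL; exists (fun n => inr (inl n)) => x y [].
have fL : card_leq (freemod R (Omega R)) L.
  by apply: card_leq_trans muL; exists (fun n => inr (inr n)) => x y [].
split; first exact: limit_model_exists.
move=> X Y Xlim Ylim; apply: iso_trans (limit_model_iso natL sL fL Xlim) _.
exact: iso_sym (limit_model_iso natL sL fL Ylim).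
Qed.
End NoetherianSuperstable.

(** * The three classes of embeddings and the theorem *)
Section Classes.
Variable R : pzRingType.

Lemma embedding_sys_pure : @embedding R = sys_pure (fun _ _ _ => False).
Proof.
apply/functional_extensionality_dep => A; apply/functional_extensionality_dep => B.
by apply/funext => f; apply/propext; split=> [fI|[]].
Qed.

Lemma pure_sys_pure : @pure_embedding R = sys_pure (fun _ _ _ => True).
Proof.
apply/functional_extensionality_dep => A; apply/functional_extensionality_dep => B.
apply/funext => f; apply/propext; split=> -[fI fP]; split=> //.
  move=> m n c _ a b E; have [|b' b'E] := fP m n (\matrix_(i, j) c i j) a.
    by exists b => i; rewrite -E; apply: eq_bigr => j _; rewrite mxE.
  exists b' => i; apply: fI; rewrite -b'E lincomb_map.
  by apply: eq_bigr => j _; rewrite mxE.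
move=> m n C a [b E]; have [b' b'E] := fP m n (fun i j => C i j) I a b E.
by exists b' => i; rewrite -b'E lincomb_map.
Qed.

Lemma RD_sys_pure : @RD_embedding R = sys_pure (fun m n _ => m = 1%N /\ n = 1%N).
Proof.
apply/functional_extensionality_dep => A; apply/functional_extensionality_dep => B.
apply/funext => f; apply/propext; split=> -[fI fP]; split=> //.
  move=> m n c [em en]; subst m n => a b E.
  have : (range f `&` range (fun b : B => c ord0 ord0 *: b)) (f (a ord0)).
    split; first by exists (a ord0).
    by exists (b ord0) => //; rewrite -E /lincomb big_ord1.
  rewrite fP => -[_ [a' _ <-] fa]; exists (fun _ => a') => i.
  by rewrite [i]ord1 /lincomb big_ord1; apply: fI; rewrite linearZ.
move=> r; apply/seteqP; split=> [_ [[a _ <-] [b _ ra]]|_ [_ [a _ <-] <-]].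
  have [|b' b'E] := fP _ _ (fun _ _ => r) (conj erefl erefl) (fun _ : 'I_1 => a) (fun _ : 'I_1 => b).
    by move=> i; rewrite /lincomb big_ord1.
  exists (f (b' ord0)); first by exists (b' ord0).
  by rewrite -(b'E ord0) /lincomb big_ord1 linearZ.
by split; [exists (r *: a) => //; rewrite linearZ|exists (f a)].
Qed.
End Classes.

Theorem theorem5p11 (R : pzRingType) (M : hom_class R)
    (M_def : M = @embedding R \/ M = @RD_embedding R \/ M = @pure_embedding R)
    (K : lmodType R -> Prop)
    (K_nonzero : exists A : lmodType R, K A /\ exists x : A, x != 0)
    (K_sums : closed_direct_sums K)
    (K_sub : closed_submodules M K)
    (K_epi : closed_epi_images M K) :
  noetherian M K <-> superstable M K.
Proof.
have [Sys ME] : exists Sys : systems R, M = sys_pure Sys.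
  case: M_def => [->|[->|->]]; [exists (fun _ _ _ => False); exact: embedding_sys_pure| |].
    by eexists; exact: RD_sys_pure.
  by eexists; exact: pure_sys_pure.
subst M; split=> [noeth|].
  exact: noetherian_superstable K_sums K_sub K_epi noeth K_nonzero.
exact: superstable_noetherian.
Qed.
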